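(* Let $U_0\in J^3(\mathbb R^3)$ and let $(U,\pi)$ be the solution of the Navier-Stokes Cauchy problem on $(0,T(U_0))\times\mathbb R^3$ with initial datum $U_0$ described in the context. Then for every $q\in(3,+\infty)$, with $\mu:=\frac{q-3}{2q}$, as $t\to0$, $$\|U(t)\|_q=o(t^{-\mu}),\qquad \|\nabla U(t)\|_q=o(t^{-\frac12-\mu}),\qquad \|\nabla\nabla U(t)\|_q=o(t^{-1-\mu}),$$ and $$\lim_{t\to0}t^{\frac32}\|\nabla\nabla U(t)\|_\infty=0.$$
   Context: $\|\cdot\|_p$ is the norm of $L^p(\mathbb R^3)$. $\mathscr C_0(\mathbb R^3)$ is the set of divergence-free vector fields in $C_0^\infty(\mathbb R^3)$, and $J^3(\mathbb R^3)$ is the closure of $\mathscr C_0(\mathbb R^3)$ in $L^3(\mathbb R^3)$. For $\rho>0$, $\|u\|_{3,\rho}^3:=\sup_{x\in\mathbb R^3}\int_{B(x,\rho)}|u(y)|^3\,dy$. The Navier-Stokes Cauchy problem is: $U_t+U\cdot\nabla U+\nabla\pi=\Delta U$, $\nabla\cdot U=0$ in $(0,T)\times\mathbb R^3$, $U=U_0$ on $\{0\}\times\mathbb R^3$. The solution. There is an absolute constant $C>0$ such that for every $U_0\in J^3(\mathbb R^3)$, with $t(\rho):=\sup\{t>0:\ \|U_0\|_{3,\rho}+(e^{-\rho^2/(8t)}+t^{1/2}/\rho)\|U_0\|_3<\frac1{4C}\}$ (supremum of the empty set being $0$) and $T=T(U_0):=\sup_{\rho>0}t(\rho)>0$, the problem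 has a solution $(U,\pi)$ on $(0,T)\times\mathbb R^3$ such that, with constants $c$ independent of $U_0$ and $t$: for all $t\in(0,T)$, $\theta\in[0,1)$, $U(t)\in C^{2,\theta}(\mathbb R^3)$ and $U_t,D^2U\in C^{0,\theta/2}((\eta,T)\times\mathbb R^3)$ for all $\eta\in(0,T)$; $\sup_{(0,T)}t^{1/2}\|U(t)\|_\infty\le c\|U_0\|_3$; $\lim_{t\to0}t^{1/2}\|U(t)\|_\infty=0$; $\lim_{t\to0}t\|\nabla U(t)\|_\infty=0$; $\|U(t)\|_3\le c\|U_0\|_3$ for $t\in[0,T)$; $\lim_{t\to0}\|U(t)-U_0\|_3=0$; $t^{1/2}\|\pi(t)\|_3\le c\|U_0\|_3$ and $\pi(t)\in C^{1,\theta}(\mathbb R^3)$ for $t\in(0,T)$. This is the solution $(U,\pi)$ referred to in the claim. *)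

(* Defs.v *)
From HB Require Import structures.
From mathcomp Require Import all_boot all_order all_algebra.
From mathcomp Require Import all_classical all_reals all_analysis.
Set Implicit Arguments.
Unset Strict Implicit.
Unset Printing Implicit Defensive.
Import Order.TTheory GRing.Theory Num.Theory.
Import numFieldNormedType.Exports.
Local Open Scope classical_set_scope.
Local Open Scope ring_scope.

(* Points and vectors of R^3 are row vectors
   'rV[R]_3. The library norm `|_| on them is the maximum norm; it is used
   only (through limits, derivatives and Hoelder conditions) where equivalent
   norms give the same notion. Balls and L^p norms use the Euclidean
   (Frobenius) norm [enorm]. *)
Definition enorm (R : realType) (m n : nat) (A : 'M[R]_(m, n)) : R :=
  Num.sqrt (\sum_i \sum_j A i j ^+ 2).

(* Matrices carry no measurable structure in the library, so integrals over
   R^3 are taken over R * R * R, identified with 'rV[R]_3 by [row3]. *)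
Definition row3 (R : realType)
    (z : measurableTypeR R * measurableTypeR R * measurableTypeR R) :
    'rV[R]_3 :=
  \row_(i < 3) nth 0 [:: (z.1.1 : R); (z.1.2 : R); (z.2 : R)] i.

Definition leb3 (R : realType) :
    {measure set (measurableTypeR R * measurableTypeR R * measurableTypeR R)
       -> \bar R} :=
  ((@lebesgue_measure R \x @lebesgue_measure R) \x @lebesgue_measure R)%E.

Definition Lp (R : realType) (p : \bar R) (f : 'rV[R]_3 -> R) : \bar R :=
  Lnorm (leb3 R) p (fun z => (f (row3 z))%:E).

Definition vLp (R : realType) (p : \bar R) (u : 'rV[R]_3 -> 'rV[R]_3) :
    \bar R :=
  Lp p (fun x => enorm (u x)).

(* The norm \|u\|_{3,rho}; the cube root is taken after the supremum. *)
Definition uloc3 (R : realType) (u : 'rV[R]_3 -> 'rV[R]_3) (rho : R) :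
    \bar R :=
  (ereal_sup [set \int[leb3 R]_(z in [set z | enorm (row3 z - x) < rho]%R)
                    (enorm (u (row3 z)) ^+ 3)%:E
             | x in [set: 'rV[R]_3]] `^ 3^-1)%E.

Definition partial (R : realType) (V : normedModType R) (i : 'I_3)
    (f : 'rV[R]_3 -> V) (x : 'rV[R]_3) : V :=
  'D_(delta_mx 0 i : 'rV[R]_3) f x.

Definition has_partials (R : realType) (V : normedModType R)
    (f : 'rV[R]_3 -> V) : Prop :=
  forall (i : 'I_3) (x : 'rV[R]_3), derivable f x (delta_mx 0 i : 'rV[R]_3).

(* Row [i] of [grad u x] is the i-th partial derivative of u at x. *)
Definition grad (R : realType) (u : 'rV[R]_3 -> 'rV[R]_3) (x : 'rV[R]_3) :
    'M[R]_3 :=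
  \matrix_(i, j) partial i u x 0 j.

Definition grad_norm (R : realType) (u : 'rV[R]_3 -> 'rV[R]_3)
    (x : 'rV[R]_3) : R :=
  enorm (grad u x).

Definition hess_norm (R : realType) (u : 'rV[R]_3 -> 'rV[R]_3)
    (x : 'rV[R]_3) : R :=
  Num.sqrt (\sum_i \sum_j enorm (partial i (partial j u) x) ^+ 2).

Definition divergence (R : realType) (u : 'rV[R]_3 -> 'rV[R]_3) (x : 'rV[R]_3) : R :=
  \sum_i partial i u x 0 i.

Definition laplacian (R : realType) (u : 'rV[R]_3 -> 'rV[R]_3)
    (x : 'rV[R]_3) : 'rV[R]_3 :=
  \sum_i partial i (partial i u) x.

Definition convection (R : realType) (u : 'rV[R]_3 -> 'rV[R]_3)
    (x : 'rV[R]_3) : 'rV[R]_3 :=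
  \sum_i u x 0 i *: partial i u x.

Definition sgrad (R : realType) (p : 'rV[R]_3 -> R) (x : 'rV[R]_3) :
    'rV[R]_3 :=
  \row_i partial i p x.

Fixpoint Ck (R : realType) (V : normedModType R) (k : nat)
    (f : 'rV[R]_3 -> V) : Prop :=
  continuous f /\
  if k is k'.+1 then has_partials f /\ forall i, Ck k' (partial i f)
  else True.

(* C^{0,th}(D), with finite norm: bounded, continuous (this matters only for
   th = 0), with bounded th-Hoelder quotient. *)
Definition holder0 (R : realType) (W V : normedModType R) (D : set W) (th : R)
    (f : W -> V) : Prop :=
  [/\ {within D, continuous f},
      exists M : R, forall x, D x -> `|f x| <= M
    & exists M : R, forall x y, D x -> D y ->
        `|f x - f y| <= M * (`|x - y| `^ th)].

(* C^{k,th}(R^3), with finite norm. *)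
Fixpoint holder (R : realType) (V : normedModType R) (k : nat) (th : R)
    (f : 'rV[R]_3 -> V) : Prop :=
  if k is k'.+1 then
    [/\ continuous f, exists M : R, forall x, `|f x| <= M,
        has_partials f & forall i, holder k' th (partial i f)]
  else holder0 [set: 'rV[R]_3] th f.

Definition solenoidal_test (R : realType) (phi : 'rV[R]_3 -> 'rV[R]_3) :
    Prop :=
  [/\ forall k, Ck k phi,
      compact (closure [set x | phi x != 0])
    & forall x, divergence phi x = 0].

Definition J3 (R : realType) (u : 'rV[R]_3 -> 'rV[R]_3) : Prop :=
  [/\ forall i : 'I_3, measurable_fun setT
        (fun z : measurableTypeR R * measurableTypeR R * measurableTypeR R =>
           u (row3 z) 0 i),
      (vLp 3%:E u < +oo)%E
    & forall e : R, 0 < e -> exists2 phi, solenoidal_test phi &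
        (vLp 3%:E (u \- phi)%R < e%:E)%E].

(* The maximum with 0 makes the supremum of the empty set 0. *)
Definition lifespan_at (R : realType) (C : R) (U0 : 'rV[R]_3 -> 'rV[R]_3)
    (rho : R) : \bar R :=
  maxe 0%E (ereal_sup [set t%:E | t in [set t : R | 0 < t /\
    (uloc3 U0 rho
     + (expR (- (rho ^+ 2 / (8 * t))) + Num.sqrt t / rho)%:E * vLp 3%:E U0
     < (1 / (4 * C))%:E)%E]]).

Definition lifespan (R : realType) (C : R) (U0 : 'rV[R]_3 -> 'rV[R]_3) :
    \bar R :=
  ereal_sup [set lifespan_at C U0 rho | rho in [set rho : R | 0 < rho]].

Definition NS_solution (R : realType) (T : \bar R)
    (U0 : 'rV[R]_3 -> 'rV[R]_3) (U : R -> 'rV[R]_3 -> 'rV[R]_3)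
    (p : R -> 'rV[R]_3 -> R) : Prop :=
  (forall (t : R) (x : 'rV[R]_3), 0 < t -> (t%:E < T)%E ->
     [/\ derivable (U ^~ x) t 1,
         derive1 (U ^~ x) t + convection (U t) x + sgrad (p t) x
           = laplacian (U t) x
       & divergence (U t) x = 0])
  /\ {ae leb3 R, forall z, U 0 (row3 z) = U0 (row3 z)}.

(* [C] is the constant defining the existence time T(U0) = [lifespan C U0];
   [c] serves as the constant of all the bounds. *)
Record described_solution (R : realType) (C c : R)
    (U0 : 'rV[R]_3 -> 'rV[R]_3) (U : R -> 'rV[R]_3 -> 'rV[R]_3)
    (p : R -> 'rV[R]_3 -> R) : Prop := DescribedSolution {
  ds_NS : NS_solution (lifespan C U0) U0 U p;
  ds_C2 : forall t th : R, 0 < t -> (t%:E < lifespan C U0)%E ->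
    0 <= th < 1 -> holder 2 th (U t);
  ds_Ut : forall eta th : R, 0 < eta -> (eta%:E < lifespan C U0)%E ->
    0 <= th < 1 ->
    holder0 [set z : R * 'rV[R]_3 | eta < z.1 /\ (z.1%:E < lifespan C U0)%E]
      (th / 2) (fun z => derive1 (U ^~ z.2) z.1);
  ds_D2 : forall eta th : R, 0 < eta -> (eta%:E < lifespan C U0)%E ->
    0 <= th < 1 -> forall i j : 'I_3,
    holder0 [set z : R * 'rV[R]_3 | eta < z.1 /\ (z.1%:E < lifespan C U0)%E]
      (th / 2) (fun z => partial i (partial j (U z.1)) z.2);
  ds_sup : (ereal_sup [set (Num.sqrt t)%:E * vLp +oo (U t)
              | t in [set t : R | (0 < t)%R /\ t%:E < lifespan C U0]]
            <= c%:E * vLp 3%:E U0)%E;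
  ds_lim : ((Num.sqrt t)%:E * vLp +oo (U t))%E @[t --> 0^'+] --> 0%E;
  ds_grad_lim : (t%:E * Lp +oo (grad_norm (U t)))%E @[t --> 0^'+] --> 0%E;
  ds_L3 : forall t : R, 0 <= t -> (t%:E < lifespan C U0)%E ->
    (vLp 3%:E (U t) <= c%:E * vLp 3%:E U0)%E;
  ds_init : vLp 3%:E (U t \- U0)%R @[t --> 0^'+] --> 0%E;
  ds_pressure : forall t : R, 0 < t -> (t%:E < lifespan C U0)%E ->
    ((Num.sqrt t)%:E * Lp 3%:E (p t) <= c%:E * vLp 3%:E U0)%E;
  ds_pressure_C1 : forall t th : R, 0 < t -> (t%:E < lifespan C U0)%E ->
    0 <= th < 1 -> holder 1 th (p t) }.

(* N(t) = o(g(t)) as t -> 0+ for an extended-real N >= 0. The first clause is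
   needed because [fine] sends +oo to 0. *)
Definition ereal_littleo (R : realType) (N : R -> \bar R) (g : R -> R) : Prop :=
  (\forall t \near 0^'+, N t \is a fin_num)
  /\ (fun t => fine (N t)) =o_ (0^'+) g.

(* Main.v *)
Require Import Defs.
From HB Require Import structures.
From mathcomp Require Import all_boot all_order all_algebra.
From mathcomp Require Import all_classical all_reals all_analysis.
From mathcomp Require Import measurable_realfun ring lra.
Import Order.TTheory GRing.Theory Num.Theory.
Import numFieldNormedType.Exports.
Local Open Scope classical_set_scope.
Local Open Scope ring_scope.

Set Implicit Arguments.
Unset Strict Implicit.
Unset Printing Implicit Defensive.

(** The L^q norms are interpolated between L^3 and L^oo, so it suffices that, as
    t tends to 0, the quantities [|D^k U(t)|_3] are [O(t^(-k/2))] and the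
    [|D^k U(t)|_oo] are [o(t^(-(k+1)/2))] for k = 0, 1, 2. For k = 0 and for the
    sup norm of the gradient this is part of the description of the solution.
    The rest follows from estimates for the linear system
    [u_t = Lap u - G - grad P], [div u = 0], with [G = U . grad U]: for t0 < t,
    d = t - t0,
      [|Du(t)| <= C (d^(-1/2) (|u(t)| + |u(t0)|) + d^(1/2) sup |G|)],
    which are obtained without any estimate of the pressure. In the derivatives of
    the vorticity, averaged over Gaussians, the pressure disappears and the heat
    operator is compensated by letting the width of the Gaussian depend on time;
    since [div u = 0], the vorticity controls [Lap u], whose averages give back
    [Du]. As the estimate is invariant under translations it passes to difference
    quotients (hence to [D^2 u]), and to convolutions with test functions (hence,
    by duality, to L^3). Applied to U, the bound of [D^2 U] contains [U D^2 U] on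
    the right; since [t^(1/2) |U|_oo] tends to 0 this term is absorbed.
    That the lifespan is positive follows from the density of smooth fields. *)

(** * Measurability and translation invariance on R^3 *)

(** The obstacle is the pressure: the description bounds it only in L^3, with no rate for its
    gradient, and singular integrals are unbounded in the sup norm. A Gaussian of width c is the
    heat kernel at time c^2/2, so the derivative of an average in c is c times the average of the
    Laplacian; a width q(r) with q q' = -1 therefore cancels the Laplacian in the time derivative.
    The three derivatives carried by the weight cost q^(-3), whose integral in time is of order 1/c.
    Recovering Du integrates c (1/c) over the widths c below d^(1/2), which converges and produces
    the factor d^(1/2) in front of G. The sup bound of D^2 U has to precede its L^3 bound: the
    latter then treats U D^2 U as an L^3 function times a function with a known bound, so that
    neither absorption nor any prior L^3 information on D^2 U is needed there. In the duality
    argument the kernel is built from the unknown derivative at the final time, and the norm of the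
    convolution operator never enters the constants. *)

Section measurability.
Context d (X : measurableType d) (R : realType).

(* Caratheodory functions are measurable: freeze the second variable on a grid
   of mesh 1/(n+1). *)
Lemma measurable_caratheodory (f : X * measurableTypeR R -> R) :
  (forall y, measurable_fun setT (fun x => f (x, y))) ->
  (forall x, continuous (fun y : R => f (x, y))) ->
  measurable_fun setT f.
Proof.
move=> mf cf.
pose r (n : nat) (y : R) : R := (Num.floor (y * n.+1%:R))%:~R / n.+1%:R.
apply: (@measurable_fun_cvg _ _ _ setT (fun n z => f (z.1, r n z.2))); last first.
  move=> [x y] _ /=.
  have : r n y @[n --> \oo] --> y.
    apply/cvgrPdist_le => e e0; near=> n.
    have n0 : (0 : R) < n.+1%:R by rewrite ltr0n.
    have -> : y - r n y = (y * n.+1%:R - (Num.floor (y * n.+1%:R))%:~R) / n.+1%:R.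
      by rewrite /r mulrBl mulfK// gt_eqF.
    have f1 := floor_le (y * n.+1%:R).
    have f2 := floorD1_gt (y * n.+1%:R).
    rewrite ger0_norm; last by rewrite divr_ge0 ?subr_ge0// ltW.
    apply: (@le_trans _ _ (n.+1%:R^-1)).
      rewrite ler_pdivrMr// mulVf ?gt_eqF//.
      by rewrite lerBlDl -(intrD _ _ 1) ltW.
    near: n.
    have := @cvg_harmonic R; move/cvgrPdist_le => /(_ _ e0).
    apply: filterS => n; rewrite sub0r normrN ger0_norm//=.
  by move=> h; apply: (cvg_comp _ _ h (cf x y)).
move=> n _ B mB; rewrite setTI.
have -> : (fun z : X * measurableTypeR R => f (z.1, r n z.2)) @^-1` B =
   \bigcup_(k : int) ([set z : X * measurableTypeR R | B (f (z.1, k%:~R / n.+1%:R))] `&`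
      (setT `*` [set y : measurableTypeR R | Num.floor ((y : R) * n.+1%:R) = k])).
  apply/seteqP; split => [[x y] /= h|[x y] /= [k _ [/= h [_ kE]]]].
    by exists (Num.floor (y * n.+1%:R)) => //; split.
  by rewrite /r kE.
apply: countable_bigcupT_measurable; first exact: countableP.
move=> k; apply: measurableI.
  have -> : [set z : X * measurableTypeR R | B (f (z.1, k%:~R / n.+1%:R))] =
     ((fun x => f (x, k%:~R / n.+1%:R)) @^-1` B) `*` setT.
    by apply/seteqP; split => [[x y]//=|[x y] /= []].
  apply: measurableX => //.
  by rewrite -[X in measurable X]setTI; exact: mf.
apply: measurableX => //.
have -> : [set y : measurableTypeR R | Num.floor ((y : R) * n.+1%:R) = k] =
   [set` `[(k%:~R / n.+1%:R)%R, ((k + 1)%:~R / n.+1%:R)%R[].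
  have n0 : (0 : R) < n.+1%:R by rewrite ltr0n.
  apply/seteqP; split => y /=; rewrite in_itv/= ler_pdivrMr// ltr_pdivlMr//.
    by move=> <-; rewrite floor_le floorD1_gt.
  by move=> h; apply: floor_def.
exact: measurable_itv.
Unshelve. all: by end_near. Qed.
End measurability.

Section R3.
Context (R : realType).
Notation V := 'rV[R]_3.
Notation T3 := (measurableTypeR R * measurableTypeR R * measurableTypeR R)%type.

Lemma row3_ij (z : T3) (i : 'I_3) :
  row3 z 0 i = if i == 0 then z.1.1 else if i == 1 then z.1.2 else z.2.
Proof. by case: i => -[|[|[|//]]] p; rewrite mxE. Qed.

Lemma row3D (z w : T3) : row3 ((z.1.1 + w.1.1, z.1.2 + w.1.2, z.2 + w.2) : T3) =
  row3 z + row3 w.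
Proof.
apply/rowP => i; rewrite row3_ij [RHS]mxE !row3_ij/=; by case: ifP => // _; case: ifP.
Qed.

Lemma rV_norm_le (v : V) (i : 'I_3) : `|v 0 i| <= `|v|.
Proof.
rewrite [leRHS]/Num.norm/= mx_normrE.
by apply/bigmax_geP; right => /=; exists (0, i).
Qed.

Lemma rV_norm_leP (v : V) (e : R) : 0 <= e -> (forall i, `|v 0 i| <= e) -> `|v| <= e.
Proof.
move=> e0 h; rewrite [leLHS]/Num.norm/= mx_normrE.
apply/bigmax_leP; split => //= -[i j] _ /=; rewrite ord1; exact: h.
Qed.

Lemma coord_continuous3 (T : topologicalType) (f : T -> V) :
  (forall i, continuous (fun x => f x 0 i)) -> continuous f.
Proof.
move=> h x; apply/cvgrPdist_le => e e0.
have H : \forall y \near x, forall i : 'I_3, `|f x 0 i - f y 0 i| <= e.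
  apply: filter_forall => i; have := h i x; move/cvgrPdist_le => /(_ _ e0).
  by apply.
apply: filterS H => y hy; apply: rV_norm_leP; first exact: ltW.
by move=> i; rewrite !mxE.
Qed.

(** [measurable_caratheodory] is applied twice, peeling off one real coordinate of the product at a
    time. *)
Lemma continuous_measurable3 (f : V -> R) : continuous f ->
  measurable_fun setT (fun z : T3 => f (row3 z)).
Proof.
move=> cf.
have cc (g : R -> T3) :
   continuous (fun t => (g t).1.1 : R) -> continuous (fun t => (g t).1.2 : R) ->
   continuous (fun t => (g t).2 : R) -> continuous (fun t => f (row3 (g t))).
  move=> h1 h2 h3 t; apply: continuous_comp; last exact: cf.
  apply: coord_continuous3 => i s; under eq_fun do rewrite row3_ij.
  by case: ifP => _; [exact: h1|case: ifP => _; [exact: h2|exact: h3]].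
apply: measurable_caratheodory => [y|[x1 x2]]; last first.
  apply: cc => t /=; [exact: cvg_cst|exact: cvg_cst|exact: cvg_id].
apply: measurable_caratheodory => [y'|x1]; last first.
  apply: cc => t /=; [exact: cvg_cst|exact: cvg_id|exact: cvg_cst].
apply: continuous_measurable_fun.
apply: cc => t /=; [exact: cvg_id|exact: cvg_cst|exact: cvg_cst].
Qed.
End R3.

(* The canonical sigma-finite structure on [m1 \x m2] cannot be inferred, being
   shadowed by the one for subprobabilities; this alias carries it. *)
Section sigma_finite_product.
Context d1 d2 (T1 : measurableType d1) (T2 : measurableType d2) (R : realType).
Variables (m1 : {sigma_finite_measure set T1 -> \bar R})
  (m2 : {sigma_finite_measure set T2 -> \bar R}).

Definition sf_prod : set (T1 * T2) -> \bar R := (m1 \x m2)%E.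

HB.instance Definition _ := Measure.copy sf_prod (m1 \x m2)%E.

Let sf_prod_sigma_finite : sigma_finite setT sf_prod.
Proof.
by case: (lebesgue_integral_fubini.measure_function_Measure_isSigmaFinite__to__measure_function_isSigmaFinite
  m1 m2).
Qed.

HB.instance Definition _ := @Measure_isSigmaFinite.Build _ _ _ sf_prod
  sf_prod_sigma_finite.

End sigma_finite_product.

Section product_preserving.
Context d1 d2 (T1 : measurableType d1) (T2 : measurableType d2) (R : realType).
Variables (m1 : {sigma_finite_measure set T1 -> \bar R})
  (m2 : {sigma_finite_measure set T2 -> \bar R}) (f1 : T1 -> T1) (f2 : T2 -> T2).
Hypotheses (mf1 : measurable_fun setT f1) (mf2 : measurable_fun setT f2).

Definition map_pair (z : T1 * T2) := (f1 z.1, f2 z.2).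

Lemma measurable_map_pair : measurable_fun setT map_pair.
Proof.
apply: measurable_fun_pair.
- exact: (measurableT_comp mf1).
- exact: (measurableT_comp mf2).
Qed.

Hypotheses (h1 : forall A, measurable A -> m1 (f1 @^-1` A) = m1 A)
  (h2 : forall A, measurable A -> m2 (f2 @^-1` A) = m2 A).

(** The image of the product measure agrees with the product measure on rectangles, and rectangles
    determine it. *)
Lemma product_measure_preserving (X : set (T1 * T2)) : measurable X ->
  (m1 \x m2)%E (map_pair @^-1` X) = (m1 \x m2)%E X.
Proof.
move=> mX; have mF := measurable_map_pair.
rewrite -[LHS]/(pushforward (m1 \x m2)%E map_pair X).
apply/esym; apply: product_measure_unique mX => A B mA mB.
rewrite -[LHS]/((m1 \x m2)%E ((f1 @^-1` A) `*` (f2 @^-1` B))).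
rewrite product_measure1E; first by congr (_ * _)%E; [exact: h1|exact: h2].
- by rewrite -[X in measurable X]setTI; exact: mf1.
- by rewrite -[X in measurable X]setTI; exact: mf2.
Qed.
End product_preserving.

Section shift.
Context (R : realType).
Notation V := 'rV[R]_3.
Notation M := (measurableTypeR R).
Notation T3 := (M * M * M)%type.
Notation lebesgue := (@lebesgue_measure R).

Lemma measurable_addr (a : R) : measurable_fun setT ((fun x => x + a) : M -> M).
Proof. by apply: measurable_funD => //; exact: measurable_cst. Qed.

(** Lebesgue measure is determined by its values on half-open intervals, whose length a translation
    does not change. *)
Lemma lebesgue_measure_shift (a : R) (A : set M) : measurable A ->
  pushforward lebesgue ((fun x => x + a) : M -> M) A = lebesgue A.
Proof.
have ma := measurable_addr a.
move=> mA; apply/esym/lebesgue_measure_unique => //= _ [[b c]] _ <-.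
rewrite /pushforward.
have -> : ((fun x : R => x + a) @^-1` `]b, c]) = `]b - a, c - a]%classic.
  by apply/seteqP; split => x /=; rewrite !in_itv/= ltrBlDr lerBrDr.
by rewrite !lebesgue_measure_itv/= !lte_fin ltrD2r -!EFinB opprB addrA addrNK.
Qed.

Definition shift3 (a z : T3) : T3 := (z.1.1 + a.1.1, z.1.2 + a.1.2, z.2 + a.2).

Lemma measurable_shift3 a : measurable_fun setT (shift3 a).
Proof.
apply: measurable_fun_pair; first apply: measurable_fun_pair.
- by apply: (measurableT_comp (measurable_addr _)); apply: measurableT_comp.
- by apply: (measurableT_comp (measurable_addr _)); apply: measurableT_comp.
- by apply: (measurableT_comp (measurable_addr _)).
Qed.

Lemma leb3_shift (a : T3) (A : set T3) : measurable A ->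
  pushforward (leb3 R) (shift3 a) A = leb3 R A.
Proof.
move=> mA; pose s1 := fun x : M => x + a.1.1 : M.
pose s2 := fun x : M => x + a.1.2 : M; pose s3 := fun x : M => x + a.2 : M.
pose L1 : {sigma_finite_measure set M -> \bar R} := lebesgue.
have sh c (C : set M) (mC : measurable C) : L1 ((fun x : M => x + c : M) @^-1` C) = L1 C.
  exact: lebesgue_measure_shift.
pose L2 : {sigma_finite_measure set (M * M)%type -> \bar R} := sf_prod L1 L1.
have m12 := measurable_map_pair (measurable_addr a.1.1) (measurable_addr a.1.2).
have h2 := @product_measure_preserving _ _ _ _ R L1 L1 s1 s2 (measurable_addr _)
  (measurable_addr _) (sh _) (sh _).
exact: (@product_measure_preserving _ _ _ _ R L2 L1 (map_pair s1 s2) s3 m12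
  (measurable_addr _) h2 (sh _) A mA).
Qed.

Lemma ge0_integral_shift3 (a : T3) (f : T3 -> \bar R) :
  measurable_fun setT f -> (forall z, 0 <= f z)%E ->
  (\int[leb3 R]_z f (shift3 a z) = \int[leb3 R]_z f z)%E.
Proof.
move=> mf f0; have ms := measurable_shift3 a.
rewrite [RHS](_ : _ = \int[pushforward (leb3 R) (shift3 a)]_z f z)%E.
  by rewrite ge0_integral_pushforward//= => y _; exact: f0.
by apply: eq_measure_integral => A mA _; exact/esym/leb3_shift.
Qed.

Lemma integrable_shift3 (a : T3) (f : T3 -> \bar R) :
  (leb3 R).-integrable setT f -> (leb3 R).-integrable setT (f \o shift3 a).
Proof.
move=> /integrableP[mf foo]; apply/integrableP; split.
  exact: (measurableT_comp mf (measurable_shift3 a)).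
rewrite (ge0_integral_shift3 a (f := fun z => `|f z|%E))//.
exact: measurableT_comp.
Qed.

Lemma integral_shift3 (a : T3) (f : T3 -> \bar R) :
  (leb3 R).-integrable setT f ->
  (\int[leb3 R]_z f (shift3 a z) = \int[leb3 R]_z f z)%E.
Proof.
move=> fi; have ms := measurable_shift3 a.
rewrite [RHS](_ : _ = \int[pushforward (leb3 R) (shift3 a)]_z f z)%E.
  rewrite integral_pushforward//=; first by case/integrableP: fi.
  exact: integrable_shift3.
by apply: eq_measure_integral => A mA _; exact/esym/leb3_shift.
Qed.
End shift.

Section integrable_product.
Context d1 d2 (T1 : measurableType d1) (T2 : measurableType d2) (R : realType).
Variables (m1 : {sigma_finite_measure set T1 -> \bar R})
  (m2 : {sigma_finite_measure set T2 -> \bar R}).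
Variables (f : T1 -> R) (g : T2 -> R).
Hypotheses (f0 : forall x, 0 <= f x) (g0 : forall x, 0 <= g x).
Hypotheses (fi : m1.-integrable setT (EFin \o f))
  (gi : m2.-integrable setT (EFin \o g)).

Let mf : measurable_fun setT f.
Proof. by apply/measurable_EFinP; case/integrableP: fi. Qed.

Let mg : measurable_fun setT g.
Proof. by apply/measurable_EFinP; case/integrableP: gi. Qed.

Let mfg : measurable_fun setT (fun z : T1 * T2 => (f z.1 * g z.2)%:E).
Proof.
apply/measurable_EFinP; apply: measurable_funM.
- exact: (measurableT_comp mf).
- exact: (measurableT_comp mg).
Qed.

Lemma integral_prodM : (\int[m1 \x m2]_z (f z.1 * g z.2)%:E =
  (\int[m1]_x (f x)%:E) * (\int[m2]_y (g y)%:E))%E.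
Proof.
rewrite (fubini_tonelli1 _ mfg); last by move=> z; rewrite lee_fin mulr_ge0.
rewrite /fubini_F -ge0_integralZr//; first last.
- by apply: integral_ge0 => y _; rewrite lee_fin.
- by move=> x _; rewrite lee_fin.
- exact/measurable_EFinP.
apply: eq_integral => x _; under eq_integral do rewrite EFinM/=.
rewrite ge0_integralZl//; first exact/measurable_EFinP.
- by move=> y _; rewrite lee_fin.
- by rewrite lee_fin.
Qed.

Lemma integrable_prodM :
  (m1 \x m2)%E.-integrable setT (fun z => (f z.1 * g z.2)%:E).
Proof.
apply/integrableP; split => //.
under eq_integral do rewrite gee0_abs ?lee_fin ?mulr_ge0//.
rewrite integral_prodM.
case/integrableP: fi => _; case/integrableP: gi => _.
under eq_integral do rewrite gee0_abs ?lee_fin//.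
under [X in (_ -> X < _ -> _)%E]eq_integral do rewrite gee0_abs ?lee_fin//.
by move=> h2 h1; rewrite lte_mul_pinfty// ?integral_ge0// => *;
  rewrite ?lee_fin// ge0_fin_numE// integral_ge0// => *; rewrite lee_fin.
Qed.
End integrable_product.

(** * Gaussian weights *)

Section gaussian.
Context (R : realType).
Notation V := 'rV[R]_3.
Notation M := (measurableTypeR R).
Notation T3 := (M * M * M)%type.
Notation lebesgue := (@lebesgue_measure R).

Definition gauss (a x : R) := expR (- a * x ^+ 2).

(** A multiple of the normal density of variance 1/(2a), from which integrability and positivity of
    the integral are inherited. *)
Lemma gaussE (a x : R) : 0 < a -> gauss a x =
  (normal_peak (Num.sqrt (a^-1 / 2)))^-1 * normal_pdf 0 (Num.sqrt (a^-1 / 2)) x.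
Proof.
move=> a0; have s0 : 0 < Num.sqrt (a^-1 / 2) :> R.
  by rewrite sqrtr_gt0 divr_gt0// invr_gt0.
rewrite normal_pdfE ?gt_eqF// mulrA mulVf ?gt_eqF ?normal_peak_gt0 ?gt_eqF//.
rewrite mul1r /normal_fun subr0 sqr_sqrtr ?divr_ge0 ?invr_ge0 ?ltW//.
by congr expR; rewrite -mulr_natr divfK// invrK mulrC mulrN mulNr mulrC.
Qed.

Lemma integrable_gauss (a : R) : 0 < a ->
  lebesgue.-integrable setT (EFin \o gauss a).
Proof.
move=> a0.
rewrite (_ : EFin \o _ = fun x => ((normal_peak (Num.sqrt (a^-1 / 2)))^-1%:E *
  (normal_pdf 0 (Num.sqrt (a^-1 / 2)) x)%:E)%E); last first.
  by apply/funext => x /=; rewrite gaussE.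
by apply: integrableZl => //; exact: integrable_normal_pdf.
Qed.

Lemma integral_gauss_gt0 (a : R) : 0 < a ->
  (0 < \int[lebesgue]_x (gauss a x)%:E)%E.
Proof.
move=> a0.
under eq_integral do rewrite gaussE// EFinM.
rewrite integralZl//; last exact: integrable_normal_pdf.
rewrite integral_normal_pdf mule1 lte_fin invr_gt0 normal_peak_gt0//.
by rewrite gt_eqF// sqrtr_gt0 divr_gt0// invr_gt0.
Qed.

Definition gauss3 (a : R) (v : V) := expR (- a * \sum_i v 0 i ^+ 2).

Lemma gauss3E a (z : T3) :
  gauss3 a (row3 z) = gauss a z.1.1 * gauss a z.1.2 * gauss a z.2.
Proof.
rewrite /gauss3 /gauss -!expRD; congr expR.
by rewrite !big_ord_recr big_ord0/= !row3_ij/= add0r !mulrDr.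
Qed.

Let L1 : {sigma_finite_measure set M -> \bar R} := lebesgue.

Lemma integrable_gauss3 (a : R) : 0 < a ->
  (leb3 R).-integrable setT (fun z => (gauss3 a (row3 z))%:E).
Proof.
move=> a0; under eq_fun do rewrite gauss3E.
have h := @integrable_prodM _ _ M M R L1 L1 (gauss a) (gauss a)
  (fun x => expR_ge0 _) (fun x => expR_ge0 _) (integrable_gauss a0) (integrable_gauss a0).
exact: (@integrable_prodM _ _ _ M R (sf_prod L1 L1) L1
  (fun z : M * M => gauss a z.1 * gauss a z.2) (gauss a)
  (fun x => mulr_ge0 (expR_ge0 _) (expR_ge0 _)) (fun x => expR_ge0 _) h (integrable_gauss a0)).
Qed.

Lemma integral_gauss3_gt0 (a : R) : 0 < a ->
  (0 < \int[leb3 R]_z (gauss3 a (row3 z))%:E)%E.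
Proof.
move=> a0; under eq_integral do rewrite gauss3E.
have g0 x : 0 <= gauss a x by exact: expR_ge0.
have g20 (z : M * M) : 0 <= gauss a z.1 * gauss a z.2 by exact: mulr_ge0.
have ig := integrable_gauss a0.
have i2 := @integrable_prodM _ _ M M R L1 L1 (gauss a) (gauss a) g0 g0 ig ig.
rewrite -[ltRHS]/(\int[(sf_prod L1 L1) \x L1]_z
   ((gauss a z.1.1 * gauss a z.1.2) * gauss a z.2)%:E)%E.
rewrite (@integral_prodM _ _ _ M R (sf_prod L1 L1) L1
  (fun z : M * M => gauss a z.1 * gauss a z.2) (gauss a) g20 g0 i2 ig).
rewrite (@integral_prodM _ _ M M R L1 L1 (gauss a) (gauss a) g0 g0 ig ig).
by rewrite !mule_gt0// integral_gauss_gt0.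
Qed.
End gaussian.

(** * Real-valued integrals over R^3 *)

Section int3.
Context (R : realType).
Notation V := 'rV[R]_3.
Notation M := (measurableTypeR R).
Notation T3 := (M * M * M)%type.
Implicit Types F G : V -> R.

(** A real number, obtained by [fine] from an extended one; for this reason most rules of
    calculation below carry [integrable3] hypotheses. *)
Definition int3 F : R := \int[leb3 R]_z F (row3 z).
Definition integrable3 F := (leb3 R).-integrable setT (fun z => (F (row3 z))%:E).

Lemma integrable3D F G : integrable3 F -> integrable3 G -> integrable3 (fun v => F v + G v).
Proof.
move=> h1 h2; rewrite /integrable3; under eq_fun do rewrite EFinD.
exact: integrableD.
Qed.

Lemma integrable3Z c F : integrable3 F -> integrable3 (fun v => c * F v).
Proof.
move=> h1; rewrite /integrable3; under eq_fun do rewrite EFinM.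
exact: integrableZl.
Qed.

Lemma integrable3B F G : integrable3 F -> integrable3 G -> integrable3 (fun v => F v - G v).
Proof.
move=> h1 h2; rewrite /integrable3; under eq_fun do rewrite EFinB.
exact: integrableB.
Qed.

Lemma integrable3_norm F : integrable3 F -> integrable3 (fun v => `|F v|).
Proof. by move=> h; exact: (integrable_abse h). Qed.

Lemma int3D F G : integrable3 F -> integrable3 G -> int3 (fun v => F v + G v) = int3 F + int3 G.
Proof. by move=> h1 h2; rewrite /int3 RintegralD. Qed.

Lemma int3B F G : integrable3 F -> integrable3 G -> int3 (fun v => F v - G v) = int3 F - int3 G.
Proof. by move=> h1 h2; rewrite /int3 RintegralB. Qed.

Lemma int3Z c F : integrable3 F -> int3 (fun v => c * F v) = c * int3 F.
Proof. by move=> h1; rewrite /int3 RintegralZl. Qed.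

Lemma le_int3 F G : integrable3 F -> integrable3 G -> (forall v, F v <= G v) -> int3 F <= int3 G.
Proof. by move=> h1 h2 h; apply: le_Rintegral => // z _; exact: h. Qed.

Lemma ler_norm_int3 F G : integrable3 F -> integrable3 G -> (forall v, `|F v| <= G v) ->
  `|int3 F| <= int3 G.
Proof.
move=> h1 h2 h; apply: (@le_trans _ _ (int3 (fun v => `|F v|))).
  exact: le_normr_Rintegral.
by apply: le_int3 => //; exact: integrable3_norm.
Qed.

Lemma int3_ge0 F : (forall v, 0 <= F v) -> 0 <= int3 F.
Proof. by move=> h; apply: Rintegral_ge0 => z _; exact: h. Qed.

Lemma integrable3_dom F G : continuous F -> integrable3 G -> (forall v, `|F v| <= G v) -> integrable3 F.
Proof.
move=> cF okG FG; apply: (le_integrable measurableT _ _ okG).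
  by apply/measurable_EFinP; exact: continuous_measurable3.
move=> z _ /=; rewrite lee_fin; apply: (le_trans (FG _)); exact: ler_norm.
Qed.

(** The inverse of [row3]; it turns the translation by a vector into the coordinatewise [shift3]. *)
Definition coord3 (v : V) : T3 := ((v 0 0, v 0 1), v 0 (inord 2)).

Lemma coord3K v : row3 (coord3 v) = v.
Proof.
apply/rowP => i; rewrite row3_ij /=.
by case: i => -[|[|[|//]]] p; congr (v _ _); apply/val_inj => //=; rewrite inordK.
Qed.

Lemma integrable3_shift (a : V) F : integrable3 F -> integrable3 (fun v => F (v + a)).
Proof.
move=> h; have := integrable_shift3 (coord3 a) h.
by rewrite /integrable3; apply: eq_integrable => // z _ /=; rewrite row3D coord3K.
Qed.

Lemma int3_shift (a : V) F : integrable3 F -> int3 (fun v => F (v + a)) = int3 F.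
Proof.
move=> h; rewrite /int3 /Rintegral; congr fine.
rewrite -(integral_shift3 (coord3 a) h).
by apply: eq_integral => z _ /=; rewrite row3D coord3K.
Qed.

Lemma eq_int3 F G : F =1 G -> int3 F = int3 G.
Proof. by move=> /funext ->. Qed.
End int3.

Section growth.
Context (R : realType).
Notation V := 'rV[R]_3.

(** Each further power of 1 + r is paid for with half of the exponent, which is why the induction
    generalizes over [a]. *)
Lemma expX_le_exp_sqr n (a : R) : 0 < a ->
  exists2 C, 0 <= C & forall r, 0 <= r -> (1 + r) ^+ n <= C * expR (a * r ^+ 2).
Proof.
elim: n a => [|n ih] a a0.
  exists 1 => // r r0; rewrite expr0 mul1r -expR0 ler_expR mulr_ge0 ?sqr_ge0 ?ltW//.
have a20 : 0 < a / 2 by rewrite divr_gt0.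
have [C C0 hC] := ih _ a20.
(* Expanding [0 <= a / 2 * (r - a^-1) ^+ 2] gives r <= (a/2) r^2 + 1/(2a), whence 1 + r <= K (1 +
   (a/2) r^2). *)
pose K : R := 1 + (4 * (a / 2))^-1.
have K1 : 0 <= (4 * (a / 2))^-1 by rewrite invr_ge0 mulr_ge0// ltW.
exists (C * K) => [|r r0]; first by rewrite mulr_ge0// addr_ge0.
rewrite exprSr.
have -> : a * r ^+ 2 = (a / 2) * r ^+ 2 + (a / 2) * r ^+ 2 by field.
rewrite expRD mulrACA ler_pM ?exprn_ge0 ?addr_ge0//; first exact: hC.
apply: (@le_trans _ _ (K * (1 + a / 2 * r ^+ 2))); last first.
  by rewrite ler_wpM2l ?addr_ge0// expR_ge1Dx.
have : 0 <= a / 2 * (r - (a)^-1) ^+ 2 by rewrite mulr_ge0 ?sqr_ge0// ltW.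
rewrite /K sqrrB !mulrDr.
have -> : a / 2 * (- (r * a^-1 *+ 2)) = - r by field; rewrite gt_eqF.
have -> : a / 2 * (a^-1) ^+ 2 = (4 * (a/2))^-1 by field; rewrite gt_eqF.
move=> h.
have h2 : 0 <= (4 * (a / 2))^-1 * (a / 2 * r ^+ 2).
  by rewrite mulr_ge0// mulr_ge0 ?sqr_ge0// ltW.
rewrite mulrDl !mul1r mulr1 ; lra.
Qed.

Lemma sqr_norm_le_sum (v : V) : `|v| ^+ 2 <= \sum_i v 0 i ^+ 2.
Proof.
have h : `|v| <= Num.sqrt (\sum_i v 0 i ^+ 2).
  apply: rV_norm_leP => [|i]; first exact: sqrtr_ge0.
  rewrite -sqrtr_sqr ler_wsqrtr// (bigD1 i)//= lerDl sumr_ge0// => j _.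
  exact: sqr_ge0.
rewrite -[leRHS]sqr_sqrtr ?sumr_ge0// => [|j _]; last exact: sqr_ge0.
by rewrite lerXn2r// nnegrE ?sqrtr_ge0.
Qed.

Lemma expX_gauss3 n (a : R) : 0 < a ->
  exists2 C, 0 <= C & forall v : V, (1 + `|v|) ^+ n * gauss3 a v <= C * gauss3 (a / 2) v.
Proof.
move=> a0; have [|C C0 hC] := @expX_le_exp_sqr n (a / 2); first by rewrite divr_gt0.
exists C => // v.
apply: (@le_trans _ _ (C * expR (a / 2 * `|v| ^+ 2) * gauss3 a v)).
  by rewrite ler_wpM2r ?expR_ge0// hC.
rewrite -mulrA ler_wpM2l// /gauss3 -expRD ler_expR.
have := sqr_norm_le_sum v; set S := \sum_i _ => h.
have : a / 2 * `|v| ^+ 2 <= a / 2 * S by rewrite ler_wpM2l// divr_ge0// ltW.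
lra.
Qed.

Lemma continuous_coord (i : 'I_3) : continuous (fun v : V => v 0 i).
Proof. by move=> v; exact: coord_continuous. Qed.

Lemma continuous_sum (T : topologicalType) n (f : 'I_n -> T -> R) :
  (forall i, continuous (f i)) -> continuous (fun x => \sum_i f i x).
Proof.
elim: n f => [|n ih] f cf.
  by under eq_fun do rewrite big_ord0; move=> x; exact: cvg_cst.
under eq_fun do rewrite big_ord_recr/=.
by move=> x; apply: cvgD; [exact: ih|exact: cf].
Qed.

Lemma continuous_prod (T : topologicalType) n (f : 'I_n -> T -> R) :
  (forall i, continuous (f i)) -> continuous (fun x => \prod_i f i x).
Proof.
elim: n f => [|n ih] f cf.
  by under eq_fun do rewrite big_ord0; move=> x; exact: cvg_cst.
under eq_fun do rewrite big_ord_recr/=.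
by move=> x; apply: cvgM; [exact: ih|exact: cf].
Qed.

Lemma continuous_gauss3 (a : R) : continuous (@gauss3 R a).
Proof.
move=> v; apply: (@continuous_comp _ _ _ (fun v : V => - a * \sum_i v 0 i ^+ 2) expR);
  last exact: continuous_expR.
apply: (@continuousM _ _ (cst (- a))); first exact: cst_continuous.
apply: (@continuous_sum V 3 (fun i (v : V) => v 0 i ^+ 2)) => i w.
apply: (@continuous_comp _ _ _ (fun v : V => v 0 i) (fun x : R => x ^+ 2)); [exact: continuous_coord|exact: exprn_continuous].
Qed.

Lemma integrable3_gauss3 (a : R) : 0 < a -> integrable3 (@gauss3 R a).
Proof. exact: integrable_gauss3. Qed.

Lemma integrable3_gdom (F : V -> R) (a C : R) : 0 < a -> continuous F ->
  (forall v, `|F v| <= C * gauss3 a v) -> integrable3 F.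
Proof. by move=> a0 cF h; apply: (integrable3_dom cF _ h); apply: integrable3Z; exact: integrable3_gauss3. Qed.
End growth.

(** * Derivatives of the one-dimensional Gaussian *)

Section hermite_functions.
Context (R : realType).

(* The n-th derivative of [exp(-x^2/2)], a Hermite polynomial times the Gaussian. *)
Fixpoint hermite (n : nat) (x : R) : R :=
  match n with
  | 0%N => gauss (1 / 2) x
  | m.+1 => match m with
            | 0%N => - (x * gauss (1 / 2) x)
            | k.+1 => - (x * hermite m x + m%:R * hermite k x)
            end
  end.

Lemma hermiteSS n x : hermite n.+2 x = - (x * hermite n.+1 x + n.+1%:R * hermite n x).
Proof. by []. Qed.

Lemma hermite_mulx n x : x * hermite n x = - (hermite n.+1 x + n%:R * hermite n.-1 x).
Proof.
case: n => [|n]; first by rewrite /= mul0r addr0 opprK.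
by rewrite hermiteSS /=; ring.
Qed.

Arguments hermite : simpl never.

Lemma is_derive_hg n (x : R) : is_derive x 1 (hermite n) (hermite n.+1 x).
Proof.
have h0 (y : R) : is_derive y 1 (hermite 0) (hermite 1 y).
  rewrite /hermite /gauss.
  have h1 : is_derive y 1 (fun z : R => - (1 / 2) * z ^+ 2) (- y).
    by apply: is_derive_eq; rewrite /GRing.scale/=; field.
    apply: (is_derive_eq (is_derive1_comp (is_derive_expR _) h1)); ring.
suff [] : is_derive x 1 (hermite n) (hermite n.+1 x) /\ is_derive x 1 (hermite n.+1) (hermite n.+2 x) by [].
elim: n x => [|n ih] x.
  split=> //.
  have h1 := h0 x.
  rewrite (_ : hermite 1 = fun y => - (y * hermite 0 y)); last by apply/funext.
  by apply: is_derive_eq; rewrite /GRing.scale/= hermiteSS; ring.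
have [h1 h2] := ih x; split => //.
rewrite (_ : hermite n.+2 = fun y => - (y * hermite n.+1 y + n.+1%:R * hermite n y)); last by apply/funext.
apply: is_derive_eq; rewrite /GRing.scale/=.
by rewrite [RHS]hermiteSS -[n.+2%:R]natr1; ring.
Qed.

Lemma continuous_hg n : continuous (hermite n).
Proof.
move=> x; have [h _] := is_derive_hg n x.
by apply: differentiable_continuous; apply/derivable1_diffP.
Qed.

(** The polynomial factor is absorbed by lowering the Gaussian exponent from 1/2 to 1/4. The
    recursion has two terms, so the induction carries two consecutive indices. *)
Lemma hermite_bound n : exists2 C, 0 <= C & forall x, `|hermite n x| <= C * gauss (1 / 4) x.
Proof.
have [C C0 hC] : exists2 C, 0 <= C &
    forall x, `|hermite n x| <= C * ((1 + `|x|) ^+ n * gauss (1 / 2) x).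
  suff [] : (exists2 C, 0 <= C &
    forall x, `|hermite n x| <= C * ((1 + `|x|) ^+ n * gauss (1 / 2) x)) /\
    (exists2 C, 0 <= C &
    forall x, `|hermite n.+1 x| <= C * ((1 + `|x|) ^+ n.+1 * gauss (1 / 2) x)) by [].
  elim: n => [|n [[C C0 hC] [D D0 hD]]].
    have g0 x : 0 <= gauss (1 / 2) x :> R by exact: expR_ge0.
    split; exists 1 => // x; first by rewrite mul1r expr0 mul1r /hermite ger0_norm.
    by rewrite mul1r /hermite normrN normrM (ger0_norm (g0 _)) ler_wpM2r// expr1 lerDr.
  split; first by exists D.
  exists (D + n.+1%:R * C) => [|x]; first by rewrite addr_ge0// mulr_ge0.
  rewrite hermiteSS normrN (le_trans (ler_normD _ _))// !normrM normr_nat mulrDl lerD//.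
    rewrite exprS [leRHS](_ : _ =
      (1 + `|x|) * (D * ((1 + `|x|) ^+ n.+1 * gauss (1 / 2) x))); last by ring.
    by rewrite ler_pM// lerDr.
  rewrite -mulrA ler_wpM2l// (le_trans (hC x))// ler_wpM2l//.
  rewrite ler_wpM2r ?expR_ge0// !exprS mulrA -[leLHS]mul1r ler_wpM2r ?exprn_ge0 ?addr_ge0//.
  by rewrite -[leLHS]mulr1 ler_pM// lerDl.
have [|K K0 hK] := @expX_le_exp_sqr R n (1 / 4); first by lra.
exists (C * K) => [|x]; first exact: mulr_ge0.
apply: (le_trans (hC x)); rewrite -mulrA ler_wpM2l//.
apply: (@le_trans _ _ (K * expR (1 / 4 * `|x| ^+ 2) * gauss (1 / 2) x)).
  by rewrite ler_wpM2r ?expR_ge0// hK.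
rewrite -mulrA ler_wpM2l// /gauss -expRD ler_expR real_normK ?num_real//; lra.
Qed.

(** A shift of length at most 1 is absorbed by halving the exponent, since y^2 <= 2 x^2 + 2 (x -
    y)^2. *)
Lemma gauss_shift (x y : R) : `|x - y| <= 1 ->
  gauss (1 / 4) x <= expR (1 / 4) * gauss (1 / 8) y.
Proof.
move=> xy; rewrite /gauss -expRD ler_expR.
have : (x - y) ^+ 2 <= 1 by rewrite -real_normK ?num_real// expr_le1.
have : 0 <= (2 * x - y) ^+ 2 by exact: sqr_ge0.
rewrite !sqrrB !exprMn; lra.
Qed.

(** The remainder keeps a Gaussian factor at the unshifted point, hence can be integrated over the
    whole space; this is what makes difference quotients of the weights usable in [J_IBP]. *)
Lemma hermite_taylor n : exists2 C, 0 <= C & forall x s, `|s| <= 1 ->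
  `|hermite n (x + s) - hermite n x - s * hermite n.+1 x| <= C * s ^+ 2 * gauss (1 / 8) x.
Proof.
have [C C0 hC] := hermite_bound n.+2.
have mvt m (x s : R) : exists2 r, `|r| <= `|s| & hermite m (x + s) - hermite m x = s * hermite m.+1 (x + r).
  have [s0|s0|<-] := ltgtP 0 s; last by exists 0; rewrite ?addr0 ?subrr ?mul0r.
  - have [|||r] := @MVT R (hermite m) (hermite m.+1) x (x + s).
    + by rewrite ltrDl.
    + by move=> y _; exact: is_derive_hg.
    + by apply: continuous_subspaceT; exact: continuous_hg.
    rewrite in_itv/= => /andP[h1 h2 h3]; exists (r - x).
      by rewrite (gtr0_norm s0) ger0_norm; lra.
    have -> : x + (r - x) = r by ring.
    by rewrite h3; move: (hermite m.+1 r) => w; ring.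
  - have [|||r] := @MVT R (hermite m) (hermite m.+1) (x + s) x.
    + by rewrite gtrDl.
    + by move=> y _; exact: is_derive_hg.
    + by apply: continuous_subspaceT; exact: continuous_hg.
    rewrite in_itv/= => /andP[h1 h2 h3]; exists (r - x).
      by rewrite ltr0_norm ?subr_lt0// (ltr0_norm s0); lra.
    have -> : x + (r - x) = r by ring.
    by rewrite -opprB h3; move: (hermite m.+1 r) => w; ring.
exists (C * expR (1 / 4)) => [|x s s1]; first by rewrite mulr_ge0 ?expR_ge0.
have [r rs ->] := mvt n x s.
have [r' rr'] := mvt n.+1 x r.
rewrite -mulrBr => ->.
rewrite !normrM.
apply: (@le_trans _ _ (`|s| * (`|s| * (C * (expR (1/4) * gauss (1 / 8) x))))).
  rewrite ler_wpM2l// ler_pM//.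
  apply: (le_trans (hC _)); rewrite ler_wpM2l// gauss_shift//.
  rewrite addrC addKr; exact: (le_trans rr' (le_trans rs s1)).
by rewrite -(real_normK (num_real s)) expr2 !mulrA le_eqVlt; apply/orP; left; apply/eqP; ring.
Qed.
End hermite_functions.

(** * Derivatives of the Gaussian on R^3 as weights *)

Section weights.
Context (R : realType).
Notation V := 'rV[R]_3.
Implicit Types (s : seq 'I_3) (v : V) (F : V -> R).

(* The derivative of [exp(-|v|^2/2)] along the directions listed in [s]. *)
Definition W s v : R := \prod_i hermite (count_mem i s) (v 0 i).

Lemma W_perm s s' : perm_eq s s' -> W s =1 W s'.
Proof. by move=> /permP p v; apply: eq_bigr => i _; rewrite p. Qed.

Lemma continuous_W s : continuous (W s).
Proof.
apply: (@continuous_prod R V 3 (fun i v => hermite (count_mem i s) (v 0 i))) => i v.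
apply: (@continuous_comp _ _ _ (fun v : V => v 0 i) (hermite _)); first exact: continuous_coord.
exact: continuous_hg.
Qed.

Lemma gauss3_prod (a : R) v : gauss3 a v = \prod_i gauss a (v 0 i).
Proof. by rewrite /gauss3 /gauss -expR_sum mulr_sumr. Qed.

Lemma hermite_bounds : exists C : nat -> R, forall n, 0 <= C n /\
  (forall x, `|hermite n x| <= C n * gauss (1 / 4) x) /\
  (forall x r, `|r| <= 1 ->
     `|hermite n (x + r) - hermite n x - r * hermite n.+1 x| <= C n * r ^+ 2 * gauss (1 / 8) x).
Proof.
suff /choice[C hC] : forall n, exists c : R, 0 <= c /\
    (forall x, `|hermite n x| <= c * gauss (1 / 4) x) /\
    (forall x r, `|r| <= 1 ->
     `|hermite n (x + r) - hermite n x - r * hermite n.+1 x| <= c * r ^+ 2 * gauss (1 / 8) x).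
  by exists C.
move=> n; have [C C0 hC] := hermite_bound R n; have [D D0 hD] := hermite_taylor R n.
exists (C + D); split; first exact: addr_ge0.
split=> [x|x r r1]; first by rewrite (le_trans (hC x))// ler_wpM2r ?expR_ge0// lerDl.
rewrite (le_trans (hD x r r1))// ler_wpM2r ?expR_ge0// ler_wpM2r ?sqr_ge0//.
by rewrite lerDr.
Qed.

Lemma W_bound s : exists2 C, 0 <= C & forall v, `|W s v| <= C * gauss3 (1 / 4) v.
Proof.
have [C hC] := hermite_bounds; exists (\prod_(i < 3) C (count_mem i s)).
  by apply: prodr_ge0 => i _; have [] := hC (count_mem i s).
move=> v; rewrite gauss3_prod -big_split/= normr_prod; apply: ler_prod => i _.
by rewrite normr_ge0/=; have [_ []] := hC (count_mem i s).
Qed.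

Lemma shift_coord v (r : R) (i j : 'I_3) :
  (v + r *: delta_mx 0 i) 0 j = v 0 j + (if j == i then r else 0).
Proof.
by rewrite !mxE eqxx /=; case: eqP => _ /=; rewrite ?mulr1 ?mulr0.
Qed.

Lemma prod_split (f : 'I_3 -> R) (i : 'I_3) :
  \prod_j f j = f i * \prod_(j < 3 | j != i) f j.
Proof. by rewrite (bigD1 i). Qed.

Lemma W_split s i v :
  W s v = hermite (count_mem i s) (v 0 i) * \prod_(j < 3 | j != i) hermite (count_mem j s) (v 0 j).
Proof. exact: prod_split. Qed.

(** Only the factor in the direction [i] changes; the other factors are bounded with the exponent
    lowered to 1/8 to match it. *)
Lemma W_taylor s (i : 'I_3) : exists2 C, 0 <= C & forall v r, `|r| <= 1 ->
  `|W s (v + r *: delta_mx 0 i) - W s v - r * W (i :: s) v| <= C * r ^+ 2 * gauss3 (1 / 8) v.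
Proof.
have [C hC] := hermite_bounds; exists (\prod_(j < 3) C (count_mem j s)).
  by apply: prodr_ge0 => j _; have [] := hC (count_mem j s).
move=> v r r1; rewrite !(W_split _ i) gauss3_prod !(prod_split _ i) /= eqxx add1n.
set P := \prod_(j < 3 | j != i) hermite (count_mem j s) (v 0 j).
have -> : \prod_(j < 3 | j != i) hermite (count_mem j s) ((v + r *: delta_mx 0 i) 0 j) = P.
  by apply: eq_bigr => j /negPf ji; rewrite shift_coord ji addr0.
have -> : \prod_(j < 3 | j != i) hermite ((i == j) + count_mem j s) (v 0 j) = P.
  by apply: eq_bigr => j /negPf ji; rewrite eq_sym ji.
rewrite shift_coord eqxx mulrA -!mulrBl normrM.
rewrite [leRHS](_ : _ = (C (count_mem i s) * r ^+ 2 * gauss (1 / 8) (v 0 i)) *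
  (\prod_(j < 3 | j != i) (C (count_mem j s)) *
   \prod_(j < 3 | j != i) (gauss (1 / 8) (v 0 j)))); last by ring.
rewrite -big_split/= ler_pM//.
  by have [_ [_]] := hC (count_mem i s); exact.
rewrite normr_prod; apply: ler_prod => j _; rewrite normr_ge0/=.
have [C0 [h _]] := hC (count_mem j s); rewrite (le_trans (h _))// ler_wpM2l//.
by rewrite ler_expR; have := sqr_ge0 (v 0 j); lra.
Qed.

Lemma count_rem (T : eqType) (x y : T) (s : seq T) :
  count_mem y (rem x s) = (count_mem y s - ((x == y) && (x \in s)))%N.
Proof.
elim: s => [|z s ih] /=; first by rewrite andbF.
have [->|zx] := eqVneq z x.
  by rewrite inE eqxx andbT addKn.
rewrite /= ih inE (eq_sym x z) (negPf zx) /=.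
by case: (eqVneq x y) => [<-|_]; rewrite ?(negPf zx) ?add0n //= !subn0.
Qed.

(** The Hermite recursion in the i-th variable. When [i] does not occur in [s] its multiplicity is
    0, so that the value of [rem i s] is irrelevant. *)
Lemma W_mulx s (i : 'I_3) v :
  v 0 i * W s v = - (W (i :: s) v + (count_mem i s)%:R * W (rem i s) v).
Proof.
rewrite !(W_split _ i) /= eqxx add1n mulrA hermite_mulx.
set P := \prod_(j < 3 | j != i) hermite (count_mem j s) (v 0 j).
have -> : \prod_(j < 3 | j != i) hermite ((i == j) + count_mem j s) (v 0 j) = P.
  by apply: eq_bigr => j /negPf ji; rewrite eq_sym ji.
have -> : \prod_(j < 3 | j != i) hermite (count_mem j (rem i s)) (v 0 j) = P.
  by apply: eq_bigr => j /negPf ji; rewrite count_rem eq_sym ji subn0.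
rewrite count_rem eqxx /=.
have [is_|/count_memPn ->] := boolP (i \in s); last by rewrite !mul0r !addr0 mulNr.
by rewrite subn1 mulrA -mulrDl mulNr.
Qed.

Lemma integrable3W s k F (B : R) : continuous F -> (forall v, `|F v| <= B * (1 + `|v|) ^+ k) ->
  integrable3 (fun v => W s v * F v).
Proof.
move=> cF hF.
have [C C0 hC] := W_bound s.
have [|D D0 hD] := @expX_gauss3 R k (1 / 4); first by lra.
have B0 : 0 <= B.
  have := hF 0; rewrite normr0 addr0 expr1n mulr1; apply: le_trans; exact: normr_ge0.
apply: (@integrable3_gdom R _ (1 / 4 / 2) (C * B * D)) => [|v|v].
- by lra.
- by apply: continuousM; [exact: continuous_W|exact: cF].
rewrite normrM; apply: (@le_trans _ _ ((C * gauss3 (1 / 4) v) * (B * (1 + `|v|) ^+ k))).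
  by rewrite ler_pM.
rewrite [leLHS](_ : _ = C * B * ((1 + `|v|) ^+ k * gauss3 (1 / 4) v)); last by ring.
by rewrite -[leRHS]mulrA ler_wpM2l ?mulr_ge0.
Qed.

(** A weighted L^1 norm of [W s]. It controls averages of bounded functions for k = 0, their
    continuity in the width for k = 1, and the quadratic remainder in the width for k = 2. *)
Definition wint s k : R := int3 (fun v => `|W s v| * (1 + `|v|) ^+ k).

Lemma wint_ge0 s k : 0 <= wint s k.
Proof. by apply: int3_ge0 => v; rewrite mulr_ge0// exprn_ge0// addr_ge0. Qed.

Lemma continuous_weight k : continuous (fun v : V => (1 + `|v|) ^+ k).
Proof.
move=> v; apply: (@continuous_comp _ _ _ (fun v : V => 1 + `|v|) (fun y : R => y ^+ k));
  last exact: exprn_continuous.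
by apply: (@continuousD R R V (cst 1) (fun v : V => `|v|)); [exact: cst_continuous|exact: norm_continuous].
Qed.

Lemma int3W_le s k F (B : R) : continuous F -> (forall v, `|F v| <= B * (1 + `|v|) ^+ k) ->
  `|int3 (fun v => W s v * F v)| <= B * wint s k.
Proof.
move=> cF hF.
have w0 v : 0 <= (1 + `|v|) ^+ k :> R by rewrite exprn_ge0// addr_ge0.
have okw : integrable3 (fun v => `|W s v| * (1 + `|v|) ^+ k).
  have := @integrable3_norm R _ (@integrable3W s k (fun v => (1 + `|v|) ^+ k) 1 (@continuous_weight k) _).
  have -> : (fun v => `|W s v| * (1 + `|v|) ^+ k) = (fun v => `|W s v * (1 + `|v|) ^+ k|).
    by apply/funext => v; rewrite normrM (ger0_norm (w0 v)).
  by apply=> v; rewrite mul1r ger0_norm.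
rewrite -int3Z//; apply: ler_norm_int3.
- exact: integrable3W hF.
- exact: integrable3Z.
- by move=> v; rewrite normrM mulrCA ler_wpM2l.
Qed.

End weights.

(** * Gaussian averages *)

Section derive_tools.
Context (R : realType).

Lemma is_derive_eps (f : R -> R) (c K : R) :
  (forall e, 0 < e -> exists2 d, 0 < d & forall r, `|r| <= d ->
    `|f (c + r) - f c - r * K| <= e * `|r|) -> is_derive c 1 f K.
Proof.
move=> h.
have H : h^-1 *: ((f \o shift c) (h *: (1 : R)) - f c) @[h --> 0^'] --> K.
  apply/cvgrPdist_le => e e0; have [d d0 hd] := h e e0.
  near=> r.
  have r0 : r != 0 by near: r; exact: nbhs_dnbhs_neq.
  have rd : `|r| <= d.
    near: r; apply: dnbhs0_le; exact: d0.
  rewrite /= /GRing.scale/= mulr1 (addrC r c).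
  have -> : K - r^-1 * (f (c + r) - f c) = - (r^-1 * (f (c + r) - f c - r * K)).
    by field.
  rewrite normrN normrM normfV ler_pdivrMl ?normr_gt0// [leRHS]mulrC; exact: hd.
apply: DeriveDef; first exact: (cvgP _ H).
exact: (cvg_lim _ H).
Unshelve. all: by end_near. Qed.

Lemma is_derive_quad (f : R -> R) (c K M : R) :
  (forall r, `|f (c + r) - f c - r * K| <= M * r ^+ 2) -> is_derive c 1 f K.
Proof.
move=> h; apply: is_derive_eps => e e0.
have M0 : 0 < `|M| + 1 by rewrite ltr_pwDr.
exists (e / (`|M| + 1)) => [|r hr]; first by rewrite divr_gt0.
apply: (le_trans (h r)); rewrite -real_normK ?num_real// expr2 mulrA ler_wpM2r//.
apply: (@le_trans _ _ ((`|M| + 1) * `|r|)).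
  by rewrite ler_wpM2r// (le_trans (ler_norm _))// lerDl.
by rewrite mulrC -ler_pdivlMr.
Qed.
End derive_tools.

(** * Uniform notions of continuity and differentiability *)

Section classes.
Context (R : realType).
Notation V := 'rV[R]_3.
Notation e_ i := (delta_mx 0 i : V).
Implicit Types (s : seq 'I_3) (h : V -> R) (x v : V).

(* For bounded [h] this says that [h] is uniformly continuous. *)
Definition almost_lip h := forall e, 0 < e -> exists2 L, 0 <= L &
  forall y v, `|h (y + v) - h y| <= e + L * `|v|.

(** The difference quotients converge uniformly in the base point. Being a sup bound on a linear
    expression in translates of [h] and [h'], this is inherited under bounded translation-invariant
    operators; the same holds for [quad]. *)
Definition uderiv (i : 'I_3) h h' := forall e, 0 < e -> exists2 d, 0 < d &
  forall y r, `|r| <= d -> `|h (y + r *: e_ i) - h y - r * h' y| <= e * `|r|.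

(** A Taylor bound for increments of every size: differentiation in the width uses the increment r
    v, which is unbounded in v even for small r. *)
Definition quad h (hd : 'I_3 -> V -> R) (M : R) := forall y v,
  `|h (y + v) - h y - \sum_j v 0 j * hd j y| <= M * `|v| ^+ 2.

Definition bdd h := exists B, forall x, `|h x| <= B.

Definition reg h := bdd h /\ almost_lip h.

Lemma almost_lip_continuous h : almost_lip h -> continuous h.
Proof.
move=> ah x; apply/(@cvgrPdist_le _ _ _ (nbhs x) (nbhs_filter x) h (h x)) => e e0.
have [|L L0 hL] := ah (e / 2); first by rewrite divr_gt0.
have L1 : 0 < L + 1 by rewrite ltr_pwDr.
near=> y.
have := hL x (y - x); rewrite (addrC x) subrK distrC => /le_trans; apply.
rewrite [leRHS](splitr e) lerD2l; apply: (@le_trans _ _ ((L + 1) * `|y - x|)).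
  by rewrite ler_wpM2r// lerDl.
rewrite mulrC -ler_pdivlMr// distrC; near: y.
have /(@cvgrPdist_le _ _ _ (nbhs x) (nbhs_filter x) id x) : y @[y --> x] --> x.
  exact: cvg_id.
by apply; rewrite divr_gt0// divr_gt0.
Unshelve. all: by end_near. Qed.

Lemma continuous_aff h x (c : R) : continuous h -> continuous (fun v => h (x + c *: v)).
Proof.
move=> ch v; apply: (@continuous_comp _ _ _ (fun v : V => x + c *: v) h); last exact: ch.
apply: (@continuousD R V V (cst x) (fun v : V => c *: v)); first exact: cst_continuous.
by apply: continuousZr; exact: cvg_id.
Qed.

End classes.

Section weighted_average.
Context (R : realType).
Notation V := 'rV[R]_3.
Notation e_ i := (delta_mx 0 i : V).
Implicit Types (s : seq 'I_3) (h : V -> R) (x v : V) (B : R).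

(** The width scales the argument of [h] and not the weight, so that one weight dominates for all
    widths and c = 0 makes sense. *)
Definition J s (c : R) h x := int3 (fun v => W s v * h (x + c *: v)).

Lemma bound0 h B : (forall x, `|h x| <= B) -> forall x (c : R) v,
  `|h (x + c *: v)| <= B * (1 + `|v|) ^+ 0.
Proof. by move=> hB x c v; rewrite mulr1. Qed.

Lemma J_le s c h x B : continuous h -> (forall x, `|h x| <= B) ->
  `|J s c h x| <= B * wint R s 0.
Proof. by move=> ch hB; apply: int3W_le; [exact: continuous_aff|exact: bound0]. Qed.

Lemma integrable3J s c h x : continuous h -> bdd h -> integrable3 (fun v => W s v * h (x + c *: v)).
Proof.
move=> ch [B hB]; apply: integrable3W; first exact: continuous_aff.
exact: bound0 hB _ _.
Qed.

Lemma JD s c h h' x : continuous h -> bdd h -> continuous h' -> bdd h' ->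
  J s c (fun y => h y + h' y) x = J s c h x + J s c h' x.
Proof.
move=> ch bh ch' bh'; rewrite /J -int3D; [|exact: integrable3J|exact: integrable3J].
by apply: eq_int3 => v; rewrite mulrDr.
Qed.

Lemma JZ s c a h x : continuous h -> bdd h ->
  J s c (fun y => a * h y) x = a * J s c h x.
Proof.
move=> ch bh; rewrite /J -int3Z; last exact: integrable3J.
by apply: eq_int3 => v; rewrite mulrCA.
Qed.

Lemma J_perm s s' c h x : perm_eq s s' -> J s c h x = J s' c h x.
Proof. by move=> p; apply: eq_int3 => v; rewrite (W_perm p). Qed.

Lemma continuous_addv h (a : V) : continuous h -> continuous (fun v => h (v + a)).
Proof.
move=> ch; under eq_fun do rewrite addrC -[X in _ + X]scale1r.
exact: continuous_aff.
Qed.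

(** Integration by parts through translation invariance: a difference quotient of the weight with
    step r is moved by a change of variable to [h], where the step is - c r. Both quotients are
    compared with their limits at one small positive r. *)
Lemma J_IBP s (i : 'I_3) c h h' x : continuous h -> bdd h -> continuous h' -> bdd h' ->
  uderiv i h h' -> J (i :: s) c h x = - c * J s c h' x.
Proof.
move=> ch bh ch' bh' du.
suff H : forall e, 0 < e -> `|J (i :: s) c h x + c * J s c h' x| <= e.
  apply/eqP; rewrite mulNr -subr_eq0 opprK -normr_le0; apply/ler_addgt0Pl => e e0.
  by rewrite addr0; exact: H.
have [B hB] := bh; have [D D0 hD] := W_taylor R s i.
set G := int3 (@gauss3 R (1 / 8)).
have G0 : 0 <= G by apply: int3_ge0 => v; exact: expR_ge0.
have B0 : 0 <= B by exact: le_trans (hB 0).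
set N := wint R s 0; have N0 : 0 <= N by exact: wint_ge0.
move=> e e0.
pose e1 := e / (2 * (`|c| * N + 1)).
have cN0 : 0 < `|c| * N + 1 by rewrite ltr_pwDr// mulr_ge0.
have e10 : 0 < e1 by rewrite divr_gt0// mulr_gt0.
have [d d0 hd] := du _ e10.
(* The three bounds serve, in order, [W_taylor], the uniform derivative of [h] at the step c r with
   error [e1], and the Taylor error r (D B G) <= e / 2. *)
pose r := Num.min 1 (Num.min (d / (`|c| + 1)) (e / (2 * (D * B * G + 1)))).
have c10 : 0 < `|c| + 1 by rewrite ltr_pwDr.
have DBG : 0 <= D * B * G by rewrite !mulr_ge0.
have r0 : 0 < r.
  by rewrite !lt_min ltr01 !divr_gt0// mulr_gt0// ltr_pwDr.
have r1 : r <= 1 by rewrite ge_min lexx.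
have rd : `|- (c * r)| <= d.
  rewrite normrN normrM (gtr0_norm r0).
  have : r <= d / (`|c| + 1) by rewrite !ge_min lexx orbT.
  rewrite ler_pdivlMr// => h1; apply: le_trans h1.
  by rewrite [leLHS]mulrC ler_wpM2l ?(ltW r0)// lerDl.
have re : r * (D * B * G) <= e / 2.
  have : r <= e / (2 * (D * B * G + 1)) by rewrite !ge_min lexx !orbT.
  rewrite ler_pdivlMr ?mulr_gt0 ?ltr_pwDr// => h1.
  have : 0 <= r by exact: ltW.
  lra.
pose H v := h (x + c *: v).
have cH : continuous H by exact: continuous_aff.
have ok1 : integrable3 (fun v => W s v * H (v - r *: e_ i)).
  apply: (@integrable3W _ _ 0 _ B); first exact: (@continuous_addv H).
  by move=> v; rewrite mulr1; exact: hB.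
have okWH : integrable3 (fun v => W s v * H v) by exact: integrable3J.
have okWH' : integrable3 (fun v => W s v * h' (x + c *: v)) by exact: integrable3J.
have okiH : integrable3 (fun v => W (i :: s) v * H v) by exact: integrable3J.
have ok2 : integrable3 (fun v => W s (v + r *: e_ i) * H v).
  have := integrable3_shift (r *: e_ i) ok1; rewrite /integrable3; apply: eq_integrable => // z _.
  by rewrite /= addrK.
have E : int3 (fun v => W s (v + r *: e_ i) * H v) =
    int3 (fun v => W s v * H (v - r *: e_ i)).
  rewrite -(int3_shift (r *: e_ i) ok1); apply: eq_int3 => v.
  by rewrite addrK.
have A1 : `|int3 (fun v => W s (v + r *: e_ i) * H v) - J s c h x - r * J (i :: s) c h x|
    <= D * r ^+ 2 * B * G.
  rewrite /J -int3B// -int3Z// -int3B; [|exact: integrable3B|exact: integrable3Z].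
  rewrite /G -int3Z; last by apply: integrable3_gauss3; lra.
  apply: ler_norm_int3.
  - by apply: integrable3B; [exact: integrable3B|exact: integrable3Z].
  - by apply: integrable3Z; apply: integrable3_gauss3; lra.
  - move=> v; rewrite mulrA -!mulrBl normrM.
    rewrite [leRHS](_ : _ = (D * r ^+ 2 * gauss3 (1 / 8) v) * B); last by ring.
    by rewrite ler_pM//; [apply: hD; rewrite gtr0_norm|exact: hB].
have A2 : `|int3 (fun v => W s v * H (v - r *: e_ i)) - J s c h x + (c * r) * J s c h' x|
    <= (e1 * (`|c| * r)) * N.
  rewrite /J -int3B// -int3Z// -int3D; [|exact: integrable3B|exact: integrable3Z].
  rewrite [X in `|X|](_ : _ = int3 (fun v => W s v *
    (H (v - r *: e_ i) - H v + c * r * h' (x + c *: v)))); last first.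
    by apply: eq_int3 => v; rewrite /H; ring.
  apply: int3W_le.
    move=> v; apply: (@continuousD R R V (fun v => H (v - r *: e_ i) - H v)
      (fun v => c * r * h' (x + c *: v))).
      apply: continuousB; [exact: (@continuous_addv H)|exact: cH].
    by apply: (@continuousM R V (cst (c * r))); [exact: cst_continuous|exact: continuous_aff].
  move=> v; rewrite mulr1 /H scalerBr scalerA.
  have := hd (x + c *: v) (- (c * r)) rd.
  rewrite normrN normrM (gtr0_norm r0) scaleNr mulNr opprK addrA.
  by apply.
set X := J s c h x in A1 A2; set Y := J (i :: s) c h x in A1 *.
set Z := J s c h' x in A2 *; rewrite E in A1.
set Q := int3 _ in A1 A2.
have A3 : r * `|Y + c * Z| <= r * e.
  rewrite -{1}(gtr0_norm r0) -normrM.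
  have -> : r * (Y + c * Z) = (Q - X + c * r * Z) - (Q - X - r * Y) by ring.
  apply: (le_trans (ler_normB _ _)); apply: (le_trans (lerD A2 A1)).
  rewrite [leLHS](_ : _ = r * (e1 * (`|c| * N) + r * (D * B * G))); last by ring.
  rewrite ler_wpM2l ?(ltW r0)//.
  have : e1 * (`|c| * N) <= e / 2.
    apply: (@le_trans _ _ (e1 * (`|c| * N + 1))); first by rewrite ler_wpM2l ?(ltW e10)// lerDl.
    by rewrite /e1 invfM mulrA mulfVK// gt_eqF.
  lra.
by rewrite ler_pM2l in A3.
Qed.
End weighted_average.

(** * Dependence of the averages on the width *)

Section derivative_average.
Context (R : realType).
Notation V := 'rV[R]_3.
Implicit Types (s : seq 'I_3) (h : V -> R) (x v : V) (B : R).

Lemma integrable3_sum n (F : 'I_n -> V -> R) : (forall i, integrable3 (F i)) ->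
  integrable3 (fun v => \sum_i F i v).
Proof.
elim: n F => [|n ih] F okF.
  have h := integrable3Z 0 (@integrable3_gauss3 R 1 ltr01).
  rewrite /integrable3; apply: eq_integrable h => // z _.
  by rewrite big_ord0 mul0r.
have h := integrable3D (ih _ (fun i => okF (widen_ord (leqnSn n) i))) (okF ord_max).
rewrite /integrable3; apply: eq_integrable h => // z _.
by rewrite big_ord_recr.
Qed.

Lemma int3_sum n (F : 'I_n -> V -> R) : (forall i, integrable3 (F i)) ->
  int3 (fun v => \sum_i F i v) = \sum_i int3 (F i).
Proof.
elim: n F => [|n ih] F okF.
  rewrite big_ord0 -[RHS](mul0r (int3 (@gauss3 R 1))) -int3Z; last exact: integrable3_gauss3.
  by apply: eq_int3 => v; rewrite big_ord0 mul0r.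
rewrite big_ord_recr/= -ih // -int3D; [|by apply: integrable3_sum|exact: okF].
by apply: eq_int3 => v; rewrite big_ord_recr.
Qed.

Lemma size_count s : (\sum_(i < 3) count_mem i s)%N = size s.
Proof.
elim: s => [|j s ih] /=; first by rewrite big1.
rewrite big_split/= ih -[RHS]add1n; congr (_ + _)%N.
by rewrite (bigD1 j)//= eqxx big1// => i /negPf; rewrite eq_sym => ->.
Qed.

Section with_gradient.
Variables (h : V -> R) (hd : 'I_3 -> V -> R) (M : R).
Hypotheses (ch : continuous h) (bh : bdd h) (chd : forall i, continuous (hd i))
  (bhd : forall i, bdd (hd i)) (qh : quad h hd M)
  (uh : forall i, uderiv i h (hd i)).

Let integrable3_grad s (i : 'I_3) x c : integrable3 (fun v => W s v * (v 0 i * hd i (x + c *: v))).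
Proof.
have [B hB] := bhd i.
apply: (@integrable3W _ _ 1 _ B) => [v|v].
  apply: (@continuousM R V (fun v => v 0 i)); first exact: continuous_coord.
  exact: continuous_aff.
rewrite normrM mulrC ler_pM//; rewrite expr1 (le_trans (rV_norm_le v i))//.
by rewrite lerDr.
Qed.

(** By [W_mulx] the factor v_i either adds the direction i to the weight or removes one occurrence
    of it. A removed occurrence, after integration by parts, returns the original average divided by
    c, and there are [size s] occurrences in all. *)
Lemma int3_grad s x (c : R) : 0 < c ->
  int3 (fun v => W s v * \sum_i v 0 i * hd i (x + c *: v)) =
  - (\sum_i J (i :: s) c (hd i) x) + (size s)%:R / c * J s c h x.
Proof.
move=> c0; under eq_int3 do rewrite mulr_sumr.
rewrite int3_sum//.
have E i : int3 (fun v => W s v * (v 0 i * hd i (x + c *: v))) =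
    - J (i :: s) c (hd i) x + (count_mem i s)%:R / c * J s c h x.
  have -> : int3 (fun v => W s v * (v 0 i * hd i (x + c *: v))) =
      int3 (fun v => (-1) * (W (i :: s) v * hd i (x + c *: v)) +
        (- (count_mem i s)%:R) * (W (rem i s) v * hd i (x + c *: v))).
    by apply: eq_int3 => v; rewrite mulrCA mulrA W_mulx; ring.
  have ok1 t : integrable3 (fun v => W t v * hd i (x + c *: v)) by apply: integrable3J => //; exact: chd.
  rewrite int3D; [|exact: integrable3Z|exact: integrable3Z].
  rewrite !int3Z// -/(J _ _ _ _) -/(J _ _ _ _) mulN1r; congr (_ + _).
  have [is_|/count_memPn ->] := boolP (i \in s); last by rewrite oppr0 !mul0r.
  rewrite (J_perm _ _ _ (perm_to_rem is_)).
  rewrite (@J_IBP _ _ i _ h (hd i))//.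
  by field; rewrite gt_eqF.
under eq_bigr do rewrite E.
by rewrite big_split/= sumrN -!mulr_suml -natr_sum size_count.
Qed.

Lemma is_derive_J s x (c : R) : 0 < c -> is_derive c 1 (fun c => J s c h x)
  (- (\sum_i J (i :: s) c (hd i) x) + (size s)%:R / c * J s c h x).
Proof.
move=> c0; rewrite -int3_grad//.
apply: (@is_derive_quad _ _ _ _ (M * wint R s 2)) => r.
have ok1 := @integrable3J R s c h x ch bh.
have ok2 := @integrable3J R s (c + r) h x ch bh.
have okg : integrable3 (fun v => W s v * \sum_i v 0 i * hd i (x + c *: v)).
  by under eq_fun do rewrite mulr_sumr; exact: integrable3_sum.
rewrite /J -int3B// -int3Z// -int3B; [|exact: integrable3B|exact: integrable3Z].
rewrite [X in `|X|](_ : _ = int3 (fun v => W s v * (h (x + (c + r) *: v) - h (x + c *: v) -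
   r * \sum_i v 0 i * hd i (x + c *: v)))); last first.
  by apply: eq_int3 => v; ring.
rewrite mulrAC; apply: int3W_le.
  move=> v; apply: (@continuousB R R V (fun v => h (x + (c + r) *: v) - h (x + c *: v))
      (fun v => r * \sum_i v 0 i * hd i (x + c *: v))).
    by apply: continuousB; exact: continuous_aff.
  apply: (@continuousM R V (cst r)); first exact: cst_continuous.
  apply: (@continuous_sum R V 3 (fun i (v : V) => v 0 i * hd i (x + c *: v))) => i w.
  by apply: (@continuousM R V (fun v => v 0 i)); [exact: continuous_coord|exact: continuous_aff].
move=> v; have := qh (x + c *: v) (r *: v).
rewrite scalerDl addrA mulr_sumr.
under eq_bigr do rewrite mxE -mulrA.
move/le_trans; apply; rewrite normrZ exprMn real_normK ?num_real// mulrA.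
have M0 : 0 <= M.
  have := qh 0 (const_mx 1); rewrite -[leLHS]normr_id.
  have [//|M0] := lerP 0 M; move=> h1.
  have : M * `|const_mx 1 : V| ^+ 2 <= 0 by rewrite mulr_le0_ge0 ?sqr_ge0// ltW.
  move=> /(le_trans h1); rewrite normr_le0 normr_eq0 => /eqP h2.
  have n1 : (1 : R) <= `|const_mx 1 : V|.
    by have := rV_norm_le (const_mx 1 : V) 0; rewrite mxE normr1.
  move: h1; rewrite h2 !normr0 leNgt => /negP; case.
  by rewrite nmulr_rlt0// exprn_gt0// (lt_le_trans ltr01).
rewrite ler_wpM2l//; first by rewrite mulr_ge0// sqr_ge0.
by rewrite lerXn2r// ?nnegrE ?addr_ge0// lerDr.
Qed.
End with_gradient.

(* The average of the [s]-derivative of [h] over a Gaussian of width [c]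
   centred at [x] (up to a constant factor), all derivatives being carried by the
   weight. *)
Definition T s (c : R) h x := (- c^-1) ^+ size s * J s c h x.

Lemma T_cons s (i : 'I_3) c h h' x : c != 0 -> continuous h -> bdd h -> continuous h' ->
  bdd h' -> uderiv i h h' -> T (i :: s) c h x = T s c h' x.
Proof.
move=> c0 ch bh ch' bh' u; rewrite /T/= (J_IBP _ _ _ ch bh ch' bh' u) exprSr.
by rewrite mulrA; congr (_ * _); rewrite -mulrA mulrNN mulVf// mulr1.
Qed.

Lemma T_perm s s' c h x : perm_eq s s' -> T s c h x = T s' c h x.
Proof. by move=> p; rewrite /T (J_perm _ _ _ p) (perm_size p). Qed.

Lemma T_le s (c : R) h x B : 0 < c -> continuous h -> (forall x, `|h x| <= B) ->
  `|T s c h x| <= (c^-1) ^+ size s * (B * wint R s 0).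
Proof.
move=> c0 ch hB; rewrite /T normrM normrX normrN (@gtr0_norm _ c^-1) ?invr_gt0//.
rewrite ler_wpM2l//; last exact: J_le.
by rewrite exprn_ge0// invr_ge0 ltW.
Qed.

Lemma TD s c h h' x : continuous h -> bdd h -> continuous h' -> bdd h' ->
  T s c (fun y => h y + h' y) x = T s c h x + T s c h' x.
Proof. by move=> *; rewrite /T JD// mulrDr. Qed.

Lemma TZ s c a h x : continuous h -> bdd h ->
  T s c (fun y => a * h y) x = a * T s c h x.
Proof. by move=> *; rewrite /T JZ// mulrCA. Qed.

Lemma eq_T s c h h' x : h =1 h' -> T s c h x = T s c h' x.
Proof. by move=> /funext ->. Qed.

(** The power of -1/c in [T] cancels exactly the term with [size s] in [is_derive_J]. What remains
    is the heat equation for Gaussian averages: formally, c times the average of the Laplacian. *)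
Lemma is_derive_T s x (c : R) h hd M : 0 < c ->
  continuous h -> bdd h -> (forall i, continuous (hd i)) ->
  (forall i, bdd (hd i)) -> quad h hd M -> (forall i, uderiv i h (hd i)) ->
  is_derive c 1 (fun c => T s c h x) (c * \sum_i T (i :: s) c (hd i) x).
Proof.
move=> c0 ch bh chd bhd qh uh.
have dJ := is_derive_J ch bh chd bhd qh uh s x c0.
have dV : is_derive c 1 (fun c : R => - c^-1) (c ^- 2).
  have : is_derive c 1 (fun y : R => y^-1) (- (c ^- 2) *: (1 : R)).
    by apply: is_deriveV; rewrite gt_eqF.
  move=> d1; apply: is_derive_eq; rewrite /GRing.scale/=; ring.
have -> : c * \sum_i T (i :: s) c (hd i) x =
    - ((- c^-1) ^+ size s * \sum_i J (i :: s) c (hd i) x).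
  rewrite /T /= -mulr_sumr exprS; set p := _ ^+ _; set S := \sum_i _.
  by field; rewrite gt_eqF.
rewrite (_ : (fun y => _) = ((fun y : R => - y^-1) ^+ size s) * (fun y : R => J s y h x));
  last by apply/funext => y; rewrite !fctE.
apply: (is_derive_eq (is_deriveM (is_deriveX (size s) dV) dJ)).
rewrite /GRing.scale/=.
set S := \sum_i _; set Y := J s c h x.
rewrite !fctE; case: (size s) => [|n] /=; first by rewrite !expr0; field; rewrite gt_eqF.
rewrite /= exprS; set p := (- c^-1) ^+ n.
by field; rewrite gt_eqF.
Qed.

(** It covers c = 0 as well, which is how pointwise values are recovered from averages. *)
Lemma J_cvg_c s (c : R) h x : almost_lip h -> bdd h -> forall e, 0 < e ->
  exists2 d, 0 < d & forall r, `|r| <= d -> `|J s (c + r) h x - J s c h x| <= e.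
Proof.
move=> ah bh e e0; have ch := almost_lip_continuous ah.
set N := wint R s 1; have N0 : 0 <= N by exact: wint_ge0.
have N1 : 0 < N + 1 by rewrite ltr_pwDr.
have [|L L0 hL] := ah (e / (2 * (N + 1))); first by rewrite divr_gt0// mulr_gt0.
have L1 : 0 < L + 1 by rewrite ltr_pwDr.
exists (e / (2 * (N + 1)) / (L + 1)) => [|r hr]; first by rewrite !divr_gt0// mulr_gt0.
rewrite /J -int3B; [|exact: integrable3J|exact: integrable3J].
rewrite [X in `|X|](_ : _ = int3 (fun v => W s v *
  (h (x + (c + r) *: v) - h (x + c *: v)))); last by apply: eq_int3 => v; ring.
apply: (@le_trans _ _ ((e / (2 * (N + 1)) * 2) * N)).
  apply: int3W_le => [|v].
    by move=> v; apply: (@continuousB R R V (fun v => h (x + (c + r) *: v))); exact: continuous_aff.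
  rewrite scalerDl addrA (le_trans (hL _ _))// expr1 normrZ.
  have : L * (`|r| * `|v|) <= e / (2 * (N + 1)) * `|v|.
    rewrite mulrA ler_wpM2r//; move: hr; rewrite ler_pdivlMr// => /le_trans h1.
    by rewrite mulrC (le_trans _ (h1 _ (lexx _)))// ler_wpM2l// lerDl.
  have : 0 <= e / (2 * (N + 1)) by rewrite divr_ge0 ?mulr_ge0 ?ltW.
  set E := e / _ => E0; have : 0 <= `|v| by [].
  have : 0 <= E * `|v| by rewrite mulr_ge0.
  lra.
have -> : e / (2 * (N + 1)) * 2 * N = e * (N / (N + 1)) by field; rewrite gt_eqF.
by rewrite -[leRHS]mulr1 ler_wpM2l ?(ltW e0)// ler_pdivrMr// mul1r lerDl.
Qed.

Lemma int3_W0_gt0 : 0 < int3 (W (R := R) [::]).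
Proof.
have E : W (R := R) [::] =1 @gauss3 R (1 / 2).
  by move=> v; rewrite gauss3_prod.
rewrite (eq_int3 E) /int3 /Rintegral fine_gt0//.
rewrite integral_gauss3_gt0/=; last by lra.
have /integrableP[_] := @integrable3_gauss3 R (1 / 2) ltac:(lra).
by under eq_integral do rewrite gee0_abs ?lee_fin ?expR_ge0//.
Qed.

Lemma J_nil0 h x : J [::] 0 h x = int3 (W (R := R) [::]) * h x.
Proof.
rewrite mulrC /J -int3Z.
  by apply: eq_int3 => v; rewrite scale0r addr0 mulrC.
have := @integrable3W R [::] 0 (cst 1) 1 (@cst_continuous _ _ _) _.
have -> : (fun v => W [::] v * cst 1 v) = W (R := R) [::].
  by apply/funext => v; rewrite mulr1.
by apply => v; rewrite normr1 mulr1.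
Qed.
End derivative_average.

(** * The linearized system *)

Section mvt.
Context (R : realType).

(** Both B - f and B + f are nondecreasing. With a nonlinear majorant [B] this takes the place of
    integrating a bound on the derivative. *)
Lemma mvt_le (f B f' B' : R -> R) (a b : R) : a <= b ->
  (forall x, a <= x <= b -> is_derive x 1 f (f' x)) ->
  (forall x, a <= x <= b -> is_derive x 1 B (B' x)) ->
  (forall x, a <= x <= b -> `|f' x| <= B' x) -> `|f b - f a| <= B b - B a.
Proof.
rewrite le_eqVlt => /predU1P[->|ab] df dB h; first by rewrite !subrr normr0.
have key (g g' : R -> R) : (forall x, a <= x <= b -> is_derive x 1 g (g' x)) ->
    (forall x, a <= x <= b -> 0 <= g' x) -> g a <= g b.
  move=> dg g0; have [|||r] := @MVT R g g' a b => //.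
  - by move=> x; rewrite in_itv/= => /andP[/ltW ? /ltW ?]; apply: dg; apply/andP.
  - apply: derivable_within_continuous => x; rewrite in_itv/= => xab.
    by have [] := dg _ xab.
  - rewrite in_itv/= => /andP[/ltW ar /ltW rb] e.
    by rewrite -subr_ge0 e mulr_ge0 ?subr_ge0 ?(ltW ab)// g0// ar.
have h1 : B a - f a <= B b - f b.
  apply: (key (fun x => B x - f x) (fun x => B' x - f' x)) => x xab.
    have := df _ xab; have := dB _ xab => d1 d2; exact: is_deriveB.
  by rewrite subr_ge0 (le_trans (ler_norm _))// h.
have h2 : B a + f a <= B b + f b.
  apply: (key (fun x => B x + f x) (fun x => B' x + f' x)) => x xab.
    have := df _ xab; have := dB _ xab => d1 d2; exact: is_deriveD.
  by have := h _ xab; rewrite ler_norml => /andP[+ _]; lra.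
rewrite ler_norml; lra.
Qed.

Lemma is_derive_near (f : R -> R) (c K : R) :
  (forall e, 0 < e -> \forall r \near (0 : R),
    `|f (c + r) - f c - r * K| <= e * `|r|) -> is_derive c 1 f K.
Proof.
move=> h; apply: is_derive_eps => e /h /nbhs_ballP[d /= d0 hd].
exists (d / 2) => [|r hr]; first by rewrite divr_gt0.
apply: hd; rewrite /ball/= sub0r normrN; apply: (le_lt_trans hr); lra.
Qed.

Lemma near0_itv (a b t : R) : a < t < b -> \forall r \near (0 : R), a < t + r < b.
Proof.
move=> tab; have : t + r @[r --> (0 : R)] --> t.
  by rewrite -[X in _ --> X]addr0; apply: cvgD; [exact: cvg_cst|exact: cvg_id].
move=> /(_ [set y | a < y < b]); apply.
have : \forall y \near t, y \in `]a, b[ by apply: near_in_itvoo; rewrite in_itv/=.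
by apply: filterS => y; rewrite in_itv.
Qed.
End mvt.

Section stokes.
Context (R : realType).
Notation V := 'rV[R]_3.
Notation e_ i := (delta_mx 0 i : V).
Implicit Types (s : seq 'I_3) (h : V -> R) (x v : V) (B : R).

Lemma quad_uderiv h hd M i : quad h hd M -> uderiv i h (hd i).
Proof.
move=> q e e0.
have M1 : 0 < `|M| + 1 by rewrite ltr_pwDr.
exists (e / (`|M| + 1)) => [|y r hr]; first by rewrite divr_gt0.
have := q y (r *: e_ i).
rewrite (bigD1 i)//= big1 => [|j /negPf ji]; last first.
  by rewrite !mxE ji mulr0 mul0r.
rewrite addr0 !mxE !eqxx mulr1 => /le_trans; apply.
have n1 : `|r *: e_ i| <= `|r|.
  apply: rV_norm_leP => // j; rewrite !mxE eqxx /= normrM.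
  by case: (j == i); rewrite ?normr1 ?mulr1// normr0 mulr0.
apply: (@le_trans _ _ ((`|M| + 1) * `|r| ^+ 2)).
  apply: (@le_trans _ _ (`|M| * `|r *: e_ i| ^+ 2)).
    by rewrite ler_wpM2r ?sqr_ge0// ler_norm.
  by rewrite ler_pM ?sqr_ge0// ?lerDl// lerXn2r// nnegrE.
by rewrite expr2 mulrA ler_wpM2r// mulrC -ler_pdivlMr.
Qed.

Lemma reg_continuous h : reg h -> continuous h.
Proof. by case=> _; exact: almost_lip_continuous. Qed.

Lemma reg_bdd h : reg h -> bdd h.
Proof. by case. Qed.

Lemma continuous_mull (c : R) h : continuous h -> continuous (fun y => c * h y).
Proof.
by move=> ch y; apply: (@continuousM R V (cst c)); [exact: cst_continuous|exact: ch].
Qed.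

Lemma continuous_add h h' : continuous h -> continuous h' ->
  continuous (fun y => h y + h' y).
Proof. by move=> ch ch' y; apply: continuousD; [exact: ch|exact: ch']. Qed.

Lemma bdd_mull (c : R) h : bdd h -> bdd (fun y => c * h y).
Proof. by move=> [B hB]; exists (`|c| * B) => y; rewrite normrM ler_wpM2l. Qed.

Lemma bdd_add h h' : bdd h -> bdd h' -> bdd (fun y => h y + h' y).
Proof.
move=> [B hB] [B' hB']; exists (B + B') => y.
by rewrite (le_trans (ler_normD _ _))// lerD.
Qed.

(* [u2 t i j] stands for the pure second derivative of [u_i] in the direction [j]
   and [P1] for the gradient of the pressure [P]. *)
Record stokes (a b : R) (u : R -> 'I_3 -> V -> R) (u1 u2 : R -> 'I_3 -> 'I_3 -> V -> R)
    (ut G : R -> 'I_3 -> V -> R) (P : R -> V -> R) (P1 : R -> 'I_3 -> V -> R) : Prop := {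
  st_u : forall t i, a < t < b -> reg (u t i);
  st_u1 : forall t i j, a < t < b -> reg (u1 t i j);
  st_u2 : forall t i j, a < t < b -> reg (u2 t i j);
  st_ut : forall t i, a < t < b -> reg (ut t i);
  st_G : forall t i, a < t < b -> reg (G t i);
  st_P : forall t, a < t < b -> reg (P t);
  st_P1 : forall t i, a < t < b -> reg (P1 t i);
  st_quad : forall t i, a < t < b -> exists M, quad (u t i) (u1 t i) M;
  st_d2 : forall t i j, a < t < b -> uderiv j (u1 t i j) (u2 t i j);
  st_dP : forall t i, a < t < b -> uderiv i (P t) (P1 t i);
  st_dt : forall t i, a < t < b -> forall e, 0 < e -> \forall r \near (0 : R),
    forall x, `|u (t + r) i x - u t i x - r * ut t i x| <= e * `|r|;
  st_eq : forall t i x, a < t < b ->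
    ut t i x = \sum_j u2 t i j x - G t i x - P1 t i x;
  st_div : forall t x, a < t < b -> \sum_i u1 t i i x = 0 }.

(** There are finitely many lists of each length over three directions, so their constants can be
    added up. *)
Lemma wint_uniform n : exists2 C : R, 0 <= C & forall s, (size s <= n)%N -> wint R s 0 <= C.
Proof.
elim: n => [|n [C C0 hC]].
  by exists (wint R [::] 0) => [|[]//]; exact: wint_ge0.
exists (C + \sum_(s : n.+1.-tuple 'I_3) wint R s 0) => [|s].
  by rewrite addr_ge0// sumr_ge0// => *; exact: wint_ge0.
rewrite leq_eqVlt => /predU1P[sn|sn].
  have ts : size s == n.+1 by apply/eqP.
  rewrite (bigD1 (Tuple ts))//= addrCA lerDl addr_ge0// sumr_ge0// => *.
  exact: wint_ge0.
by rewrite (le_trans (hC _ sn))// lerDl sumr_ge0// => *; exact: wint_ge0.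
Qed.

Lemma continuous_T s (c : R) h x : c != 0 -> reg h -> {for c, continuous (fun c => T s c h x)}.
Proof.
move=> c0 [bh ah].
have h1 : {for c, continuous (fun c : R => (- c^-1) ^+ size s)}.
  apply: (@continuous_comp _ _ _ (fun c : R => - c^-1) (fun y : R => y ^+ size s));
    last exact: exprn_continuous.
  by apply: continuousN; exact: inv_continuous.
apply: continuousM => //.
apply/cvgrPdist_le => e e0; have [d d0 hd] := J_cvg_c s c x ah bh e0.
near=> c'.
have -> : J s c' h x = J s (c + (c' - c)) h x by rewrite addrC subrK.
rewrite distrC; apply: hd.
rewrite distrC; near: c'.
have /cvgrPdist_le : y @[y --> c] --> c by exact: cvg_id.
by apply.
Unshelve. all: by end_near. Qed.

Section time_derivative.
Variables (a b : R) (u : R -> 'I_3 -> V -> R) (u1 u2 : R -> 'I_3 -> 'I_3 -> V -> R)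
    (ut G : R -> 'I_3 -> V -> R) (P : R -> V -> R) (P1 : R -> 'I_3 -> V -> R).
Hypothesis S : stokes a b u u1 u2 ut G P P1.

(** Two effects are separated: the width moves while the function is frozen at time [t], which is
    the chain rule, and the increment of the function is averaged at the current width. The second
    part rests on the uniformity in x of [st_dt] and on the continuity of [T] in the width. *)
Lemma is_derive_T_time s (q : R -> R) (q' t : R) i x : a < t < b -> 0 < q t ->
  is_derive t 1 q q' ->
  is_derive t 1 (fun t => T s (q t) (u t i) x)
   (T s (q t) (ut t i) x + q' * (q t * \sum_n T (n :: s) (q t) (u1 t i n) x)).
Proof.
move=> tab q0 dq.
have [M qM] := st_quad S i tab.
have ru := st_u S i tab; have rut := st_ut S i tab.
have cq : {for t, continuous q}.
  by apply: differentiable_continuous; apply/derivable1_diffP; case: dq.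
have d1 : is_derive t 1 (fun t' => T s (q t') (u t i) x)
    (q' * (q t * \sum_n T (n :: s) (q t) (u1 t i n) x)).
  rewrite mulrC.
  apply: (@is_derive1_comp _ (fun c => T s c (u t i) x) q) => //.
  apply: (is_derive_T s x q0 (reg_continuous ru) (reg_bdd ru) _ _ qM) => j.
  - exact: (reg_continuous (st_u1 S i j tab)).
  - exact: (reg_bdd (st_u1 S i j tab)).
  - exact: quad_uderiv qM.
have d2 : is_derive t 1 (fun t' => T s (q t') (fun y => u t' i y + (-1) * u t i y) x)
    (T s (q t) (ut t i) x).
  apply: is_derive_near => e e0.
  have z0 : T s (q t) (fun y => u t i y + (-1) * u t i y) x = 0.
    rewrite (@eq_T _ _ _ _ (fun y => 0 * u t i y)) => [|y]; last by ring.
    by rewrite TZ ?mul0r//; [exact: reg_continuous|exact: reg_bdd].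
  rewrite z0.
  set w := wint R s 0; have w0 : 0 <= w by exact: wint_ge0.
  (* [k] bounds the prefactor of [T] at nearby times; [e1] then reserves half of [e] for the
     increment of [u] and half for the change of width in the average of [ut]. *)
  pose k := (q t)^-1 ^+ size s + 1.
  have k0 : 0 < k by rewrite ltr_pwDr// exprn_ge0// invr_ge0 ltW.
  pose e1 := e / 2 / (k * w + 1).
  have kw : 0 < k * w + 1 by rewrite ltr_pwDr// mulr_ge0// ltW.
  have e10 : 0 < e1 by rewrite !divr_gt0.
  have cqr : q (t + r) @[r --> (0 : R)] --> q t.
    have -> : q t = q (t + 0) by rewrite addr0.
    apply: (@continuous_comp _ _ _ (fun r : R => t + r) q).
      by apply: cvgD; [exact: cvg_cst|exact: cvg_id].
    by rewrite /= addr0.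
  have N1 := near0_itv tab.
  have N2 : \forall r \near (0 : R), 0 < q (t + r) by exact: (cvgr_gt _ cqr).
  have N3 : \forall r \near (0 : R), (q (t + r))^-1 ^+ size s <= k.
    have h1 : (q (t + r))^-1 ^+ size s @[r --> (0 : R)] --> (q t)^-1 ^+ size s.
      apply: (@cvg_comp _ _ _ (fun r : R => q (t + r)) (fun y : R => y^-1 ^+ size s) _ _ _ cqr).
      apply: (@continuous_comp _ _ _ (fun y : R => y^-1) (fun y : R => y ^+ size s));
        last exact: exprn_continuous.
      by apply: inv_continuous; rewrite gt_eqF.
    by apply: (cvgr_le _ h1); rewrite /k ltrDl.
  have N4 : \forall r \near (0 : R), `|T s (q t) (ut t i) x - T s (q (t + r)) (ut t i) x| <= e / 2.
    have h1 : T s (q (t + r)) (ut t i) x @[r --> (0 : R)] --> T s (q t) (ut t i) x.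
      apply: (@cvg_comp _ _ _ (fun r : R => q (t + r)) (fun y : R => T s y (ut t i) x) _ _ _ cqr).
      by apply: continuous_T => //; rewrite gt_eqF.
    by move/cvgrPdist_le : h1; apply; exact: divr_gt0.
  near=> r.
  have rab : a < t + r < b by near: r.
  have ru' := st_u S i rab.
  have qr0 : 0 < q (t + r) by near: r.
  have qk : (q (t + r))^-1 ^+ size s <= k by near: r.
  have A1 : `|T s (q (t + r)) (ut t i) x - T s (q t) (ut t i) x| <= e / 2.
    by rewrite distrC; near: r.
  have A2 : forall y, `|u (t + r) i y - u t i y - r * ut t i y| <= e1 * `|r|.
    by near: r; exact: (st_dt S i tab e10).
  have cru := reg_continuous ru; have bru := reg_bdd ru.
  have cru' := reg_continuous ru'; have bru' := reg_bdd ru'.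
  have crt := reg_continuous rut; have brt := reg_bdd rut.
  have A3 : `|T s (q (t + r)) (fun y => (u (t + r) i y + (-1) * u t i y) +
       (- r) * ut t i y) x| <= k * ((e1 * `|r|) * w).
    apply: (@le_trans _ _ ((q (t + r))^-1 ^+ size s * ((e1 * `|r|) * w))).
      apply: T_le => // [|y]; first by do 2?[apply: continuous_add]=> //; exact: continuous_mull.
      by rewrite mulN1r mulNr; exact: A2.
    by rewrite ler_wpM2r// mulr_ge0// mulr_ge0// (ltW e10).
  rewrite TD in A3; [|by apply: continuous_add => //; exact: continuous_mull|by apply: bdd_add => //; exact: bdd_mull|exact: continuous_mull|exact: bdd_mull].
  rewrite TZ// in A3.
  set X := T s (q (t + r)) (fun y => _) x in A3 *.
  set Y := T s (q (t + r)) (ut t i) x in A1 A3.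
  set Z := T s (q t) (ut t i) x in A1 *.
  have -> : X - 0 - r * Z = (X + (- r) * Y) + r * (Y - Z) by ring.
  rewrite (le_trans (ler_normD _ _))// [in leRHS](splitr e) mulrDl lerD//.
    apply: (le_trans A3).
    rewrite [leLHS](_ : _ = `|r| * (e1 * (k * w))); last by ring.
    rewrite mulrC ler_wpM2r//.
    apply: (@le_trans _ _ (e1 * (k * w + 1))); first by rewrite ler_wpM2l ?(ltW e10)// lerDl.
    by rewrite /e1 divfK// gt_eqF.
  by rewrite normrM mulrC ler_wpM2r.
have E : \forall t' \near t, T s (q t') (u t i) x +
     T s (q t') (fun y => u t' i y + (-1) * u t i y) x = T s (q t') (u t' i) x.
  near=> t'.
  have rab : a < t' < b.
    have : t' \in `]a, b[ by near: t'; apply: near_in_itvoo; rewrite in_itv.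
    by rewrite in_itv.
  have ru' := st_u S i rab.
  have cru := reg_continuous ru; have bru := reg_bdd ru.
  have cru' := reg_continuous ru'; have bru' := reg_bdd ru'.
  rewrite TD ?TZ//; first by ring.
  - by move=> y; apply: (@continuousM R V (cst (-1))); [exact: cst_continuous|exact: cru].
  - by have [B hB] := bru; exists B => y; rewrite mulN1r normrN.
apply: (near_eq_is_derive E).
rewrite addrC; exact: is_deriveD.
Unshelve. all: by end_near. Qed.
End time_derivative.
End stokes.

(** * The gradient estimate in the sup norm *)

Section stokes_gradient.
Context (R : realType).
Notation V := 'rV[R]_3.
Implicit Types (s : seq 'I_3) (h : V -> R) (x v : V) (B : R).

Lemma reg_add h h' : reg h -> reg h' -> reg (fun y => h y + h' y).
Proof.
move=> [bh ah] [bh' ah']; split; first exact: bdd_add.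
move=> e e0; have e20 : 0 < e / 2 by rewrite divr_gt0.
have [L L0 hL] := ah _ e20; have [L' L0' hL'] := ah' _ e20.
exists (L + L') => [|y v]; first exact: addr_ge0.
rewrite opprD addrACA (le_trans (ler_normD _ _))//.
by have := hL y v; have := hL' y v; lra.
Qed.

Lemma reg_mull c h : reg h -> reg (fun y => c * h y).
Proof.
move=> [bh ah]; split; first exact: bdd_mull.
move=> e e0; have c1 : 0 < `|c| + 1 by rewrite ltr_pwDr.
have [|L L0 hL] := ah (e / (`|c| + 1)); first exact: divr_gt0.
exists ((`|c| + 1) * L) => [|y v]; first by rewrite mulr_ge0// ltW.
rewrite -mulrBr normrM.
apply: (@le_trans _ _ ((`|c| + 1) * (e / (`|c| + 1) + L * `|v|))).
  by rewrite ler_pM// lerDl.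
rewrite le_eqVlt; apply/orP; left; apply/eqP; field; by rewrite gt_eqF.
Qed.

Lemma TD_reg s c h h' x : reg h -> reg h' ->
  T s c (fun y => h y + h' y) x = T s c h x + T s c h' x.
Proof.
move=> r r'; apply: TD; [exact: reg_continuous|exact: reg_bdd|
  exact: reg_continuous|exact: reg_bdd].
Qed.

Lemma TZ_reg s c a h x : reg h -> T s c (fun y => a * h y) x = a * T s c h x.
Proof. by move=> r; apply: TZ; [exact: reg_continuous|exact: reg_bdd]. Qed.

Lemma sum_ord3 (f : 'I_3 -> R) : \sum_j f j = f ord0 + f (inord 1) + f (inord 2).
Proof.
rewrite !big_ord_recr big_ord0/= add0r; congr (_ + _ + _); congr f; apply/val_inj => //=;
  by rewrite inordK.
Qed.

Lemma perm_swap2 (i j : 'I_3) s : perm_eq (i :: j :: s) (j :: i :: s).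
Proof. by rewrite -[i :: j :: s]/([:: i] ++ [:: j] ++ s) perm_catCA. Qed.

Section estimate.
Variables (a b : R) (u : R -> 'I_3 -> V -> R) (u1 u2 : R -> 'I_3 -> 'I_3 -> V -> R)
    (ut G : R -> 'I_3 -> V -> R) (P : R -> V -> R) (P1 : R -> 'I_3 -> V -> R).
Hypothesis S : stokes a b u u1 u2 ut G P P1.

Lemma T_cons_u s c t i n x : a < t < b -> c != 0 ->
  T (n :: s) c (u t i) x = T s c (u1 t i n) x.
Proof.
move=> tab c0; have [M qM] := st_quad S i tab.
have ru := st_u S i tab; have ru1 := st_u1 S i n tab.
exact: (T_cons _ _ c0 (reg_continuous ru) (reg_bdd ru) (reg_continuous ru1)
  (reg_bdd ru1) (quad_uderiv n qM)).
Qed.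

Lemma T_cons_P s c t n x : a < t < b -> c != 0 ->
  T (n :: s) c (P t) x = T s c (P1 t n) x.
Proof.
move=> tab c0; have rP := st_P S tab; have rP1 := st_P1 S n tab.
exact: (T_cons _ _ c0 (reg_continuous rP) (reg_bdd rP) (reg_continuous rP1)
  (reg_bdd rP1) (st_dP S n tab)).
Qed.

(** Integration by parts puts the direction [n] back on [u1]; the sum becomes the averaged
    Laplacian, which the equation eliminates. *)
Lemma T_heat s c t i x : a < t < b -> c != 0 ->
  T s c (ut t i) x - \sum_n T (n :: s) c (u1 t i n) x =
  - T s c (G t i) x - T s c (P1 t i) x.
Proof.
move=> tab c0.
have E n : T (n :: s) c (u1 t i n) x = T s c (u2 t i n) x.
  have r1 := st_u1 S i n tab; have r2 := st_u2 S i n tab.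
  exact: (T_cons _ _ c0 (reg_continuous r1) (reg_bdd r1) (reg_continuous r2)
    (reg_bdd r2) (st_d2 S i n tab)).
under eq_bigr do rewrite E.
have r2 n := st_u2 S i n tab.
have rG := reg_mull (-1) (st_G S i tab); have rP := reg_mull (-1) (st_P1 S i tab).
have r3 := reg_add rG rP; have r4 := reg_add (r2 (inord 2)) r3.
have r5 := reg_add (r2 (inord 1)) r4.
have -> : T s c (ut t i) x = T s c (fun y => u2 t i ord0 y + (u2 t i (inord 1) y +
    (u2 t i (inord 2) y + ((-1) * G t i y + (-1) * P1 t i y)))) x.
  apply: eq_T => y; rewrite (st_eq S i y tab) sum_ord3.
  ring.
rewrite (TD_reg _ _ _ (r2 _) r5) (TD_reg _ _ _ (r2 _) r4) (TD_reg _ _ _ (r2 _) r3).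
rewrite (TD_reg _ _ _ rG rP) (TZ_reg _ _ _ _ (st_G S i tab)) (TZ_reg _ _ _ _ (st_P1 S i tab)).
rewrite sum_ord3.
ring.
Qed.

Variables (t0 t A K C0 : R).
Hypotheses (at0 : a < t0) (t0t : t0 < t) (tb : t < b).
Hypotheses (hA : forall i x, `|u t i x| <= A) (hA0 : forall i x, `|u t0 i x| <= A)
  (hK : forall r i x, t0 <= r <= t -> `|G r i x| <= K)
  (hC0 : forall s, (size s <= 3)%N -> wint R s 0 <= C0).

Let A0 : 0 <= A. Proof. exact: le_trans (hA 0 0). Qed.
Let K0 : 0 <= K.
Proof. by apply: le_trans (hK 0 0 (r := t) _) => //; rewrite lexx ltW. Qed.
Let C00 : 0 <= C0. Proof. by apply: le_trans (hC0 (s := [::]) _) => //; exact: wint_ge0. Qed.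

(* Along this width the average of a solution of the heat equation is constant
   in time. *)
Let q (c r : R) := Num.sqrt (c ^+ 2 + 2 * (t - r)).

Let q_gt0 c r : 0 < c -> r <= t -> 0 < q c r.
Proof.
move=> c0 rt; rewrite sqrtr_gt0.
have : 0 < c ^+ 2 by exact: exprn_gt0.
lra.
Qed.

Let dq c r : 0 < c -> r <= t -> is_derive r 1 (q c) (- (q c r)^-1).
Proof.
move=> c0 rt; have q0 := q_gt0 c0 rt.
have d1 : is_derive r 1 (fun r : R => c ^+ 2 + 2 * (t - r)) (-2).
  by apply: is_derive_eq; rewrite /GRing.scale/=; ring.
have s0 : 0 < c ^+ 2 + 2 * (t - r) by rewrite -sqrtr_gt0.
have d2 := is_derive1_sqrt s0.
have := @is_derive1_comp R Num.sqrt (fun r : R => c ^+ 2 + 2 * (t - r)) r _ _ d2 d1; rewrite /comp -/(q c) => d3.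
apply: (is_derive_eq d3); rewrite -/(q c r); field; by rewrite gt_eqF.
Qed.

(* In the difference of the two averages, an average of the derivative along [m; l] of
   a component of the vorticity, the pressure cancels. *)
Lemma vorticity_estimate l i m c x : 0 < c ->
  `|T [:: m; m; l] c (u t i) x - T [:: i; m; l] c (u t m) x| <=
   2 * C0 * (A * (Num.sqrt (t - t0))^-1 ^+ 3 + K / c).
Proof.
move=> c0; have tt0 : 0 < t - t0 by rewrite subr_gt0.
pose Y r := T [:: m; m; l] (q c r) (u r i) x - T [:: i; m; l] (q c r) (u r m) x.
have qt : q c t = c by rewrite /q subrr mulr0 addr0 sqrtr_sqr gtr0_norm.
have -> : T [:: m; m; l] c (u t i) x - T [:: i; m; l] c (u t m) x = Y t by rewrite /Y qt.
have Tle s r h B : r <= t -> (size s <= 3)%N -> continuous h -> (forall y, `|h y| <= B) ->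
    `|T s (q c r) h x| <= (q c r)^-1 ^+ size s * (B * C0).
  move=> rt s3 ch hB; have q0 := q_gt0 c0 rt.
  apply: (le_trans (T_le s x q0 ch hB)); apply: ler_wpM2l.
    by rewrite exprn_ge0// invr_ge0 ltW.
  by rewrite ler_wpM2l ?hC0// (le_trans _ (hB 0)).
have rng r : t0 <= r <= t -> a < r < b.
  by move=> /andP[h1 h2]; rewrite (lt_le_trans at0 h1) (le_lt_trans h2 tb).
have t0ab : a < t0 < b by apply: rng; rewrite lexx ltW.
have tab : a < t < b by apply: rng; rewrite lexx ltW.
have h0 : `|Y t0| <= 2 * C0 * (A * (Num.sqrt (t - t0))^-1 ^+ 3).
  have q0 := q_gt0 c0 (ltW t0t).
  have qle : (q c t0)^-1 ^+ 3 <= (Num.sqrt (t - t0))^-1 ^+ 3.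
    rewrite lerXn2r ?nnegrE ?invr_ge0 ?sqrtr_ge0// lef_pV2 ?posrE ?sqrtr_gt0//; last first.
      by have := exprn_gt0 2 c0; lra.
    rewrite ler_wsqrtr//; have := sqr_ge0 c; lra.
  apply: (@le_trans _ _ (2 * ((q c t0)^-1 ^+ 3 * (A * C0)))).
    rewrite (le_trans (ler_normB _ _))// mulr_natl mulr2n lerD//;
      apply: Tle => //; [exact: ltW| |exact: ltW|].
    - exact: (reg_continuous (st_u S i t0ab)).
    - exact: (reg_continuous (st_u S m t0ab)).
  rewrite [leRHS](_ : _ = 2 * ((Num.sqrt (t - t0))^-1 ^+ 3 * (A * C0))); last by ring.
  by rewrite ler_wpM2l// ler_wpM2r// mulr_ge0.
have h1 : `|Y t - Y t0| <= 2 * K * C0 * (q c t)^-1 - 2 * K * C0 * (q c t0)^-1.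
  (* From q' = -1/q follows (1/q)' = q^(-3), so this majorant integrates the bound 2 K C0 q^(-3)
     exactly. *)
  apply: (@mvt_le _ Y (fun r => 2 * K * C0 * (q c r)^-1)
    (fun r => - T [:: m; m; l] (q c r) (G r i) x + T [:: i; m; l] (q c r) (G r m) x)
    (fun r => 2 * K * C0 * (q c r)^-1 ^+ 3)).
  - exact: ltW.
  - move=> r tr; have rab := rng _ tr; have /andP[_ rt] := tr.
    have q0 := q_gt0 c0 rt; have q1 : q c r != 0 by rewrite gt_eqF.
    have d1 := is_derive_T_time S [:: m; m; l] i x rab q0 (dq c0 rt).
    have d2 := is_derive_T_time S [:: i; m; l] m x rab q0 (dq c0 rt).
    have e1 s j : T s (q c r) (ut r j) x + - (q c r)^-1 *
        (q c r * \sum_n T (n :: s) (q c r) (u1 r j n) x) =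
        - T s (q c r) (G r j) x - T s (q c r) (P1 r j) x.
      by rewrite mulNr mulrA mulVf// mul1r T_heat.
    rewrite e1 in d1; rewrite e1 in d2.
    apply: (is_derive_eq (is_deriveB d1 d2)).
    (* Both sides average the same fourth derivative of [P], with its directions listed in two
       orders. *)
    have -> : T [:: m; m; l] (q c r) (P1 r i) x = T [:: i; m; l] (q c r) (P1 r m) x.
      by rewrite -!T_cons_P//; apply: T_perm; exact: perm_swap2.
    ring.
  - move=> r /andP[_ rt]; have q0 := q_gt0 c0 rt; have q1 : q c r != 0 by rewrite gt_eqF.
    have d1 := is_deriveV q1 (dq c0 rt).
    have d2 := is_deriveZ (2 * K * C0) d1.
    by apply: (is_derive_eq d2); rewrite /GRing.scale/=; field.
  - move=> r tr; have rab := rng _ tr; have /andP[_ rt] := tr.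
    rewrite (le_trans (ler_normD _ _))// normrN.
    rewrite [leRHS](_ : _ = (q c r)^-1 ^+ 3 * (K * C0) + (q c r)^-1 ^+ 3 * (K * C0)); last by ring.
    have a1 := Tle [:: m; m; l] r _ _ rt isT (reg_continuous (st_G S i rab)) (fun y => hK i y tr).
    have a2 := Tle [:: i; m; l] r _ _ rt isT (reg_continuous (st_G S m rab)) (fun y => hK m y tr).
    exact: lerD.
have : `|Y t| <= `|Y t - Y t0| + `|Y t0| by rewrite -{1}(subrK (Y t0) (Y t)) ler_normD.
have : 0 <= 2 * K * C0 * (q c t0)^-1 by rewrite !mulr_ge0// invr_ge0 sqrtr_ge0.
move: h0 h1; rewrite qt; set w := A * _; move: (q c t0)^-1 => z.
rewrite mulrDr (_ : 2 * C0 * (K / c) = 2 * K * C0 * c^-1); last by ring.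
lra.
Qed.

(** [E] is followed as the width decreases from [rho] to 0, where it tends to N times the
    derivative. Its slope at width r is r times a sum of three vorticity averages; the factor r
    offsets the singular term K / r, so [L] bounds the slope for r <= rho. With 3 times 2 C0 from
    the slope and C0 A / rho from [E rho], the constants are 6 + 1 for [A] and 6 for [K]. *)
Lemma gradient_estimate i l x :
  int3 (W (R := R) [::]) * `|u1 t i l x| <=
    7 * C0 * (A / Num.sqrt (t - t0)) + 6 * C0 * (K * Num.sqrt (t - t0)).
Proof.
have tt0 : 0 < t - t0 by rewrite subr_gt0.
set rho := Num.sqrt (t - t0); have rho0 : 0 < rho by rewrite sqrtr_gt0.
have tab : a < t < b by rewrite (lt_trans at0 t0t) tb.
have [M qM] := st_quad S i tab.
have ru := st_u S i tab; have r1 j := st_u1 S i j tab.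
set N := int3 _; have N0 : 0 < N by exact: int3_W0_gt0.
pose E c := T [:: l] c (u t i) x.
pose L := 6 * C0 * (A * rho^-1 ^+ 2 + K).
have L0 : 0 <= L by rewrite !mulr_ge0// addr_ge0// mulr_ge0// exprn_ge0// invr_ge0 ltW.
have dE (c : R) : 0 < c -> is_derive c 1 E (c * \sum_n T [:: n; l] c (u1 t i n) x).
  move=> c0; apply: (is_derive_T [:: l] x c0 (reg_continuous ru) (reg_bdd ru) _ _ qM) => j.
  - exact: (reg_continuous (r1 j)).
  - exact: (reg_bdd (r1 j)).
  - exact: quad_uderiv qM.
have E1 (c : R) : 0 < c -> c <= rho -> `|E rho - E c| <= L * rho - L * c.
  move=> c0 cr; apply: (@mvt_le _ E (fun r => L * r)
      (fun c => c * \sum_n T [:: n; l] c (u1 t i n) x) (fun=> L)) => //.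
  - by move=> r /andP[cr' _]; apply: dE; exact: lt_le_trans cr'.
  - by move=> r _; apply: is_derive_eq; rewrite /GRing.scale/= mulr1.
  - move=> r /andP[cr' rr]; have r0 : 0 < r by exact: lt_le_trans cr'.
    have rn0 : r != 0 by rewrite gt_eqF.
    (* The subtracted terms add up to an average of a second derivative of the divergence, hence to
       0; they complete the Laplacian to derivatives of the vorticity. *)
    have -> : \sum_n T [:: n; l] r (u1 t i n) x = \sum_n
       (T [:: n; n; l] r (u t i) x - T [:: i; n; l] r (u t n) x).
      rewrite big_split/= sumrN (_ : \sum_n T [:: i; n; l] r (u t n) x = 0) ?subr0.
        by apply: eq_bigr => n _; rewrite T_cons_u.
      transitivity (\sum_n T [:: i; l] r (u1 t n n) x).
        apply: eq_bigr => n _; rewrite -T_cons_u//; apply: T_perm.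
        exact: perm_swap2.
      have c1 n := reg_continuous (st_u1 S n n tab).
      have b1 n := reg_bdd (st_u1 S n n tab).
      rewrite !big_ord_recr big_ord0/= add0r -TD// -TD//; last 2 first.
      - exact: continuous_add.
      - exact: bdd_add.
      rewrite (@eq_T _ _ _ _ (fun y => 0 * u1 t l l y)) ?TZ ?mul0r// => y.
      by rewrite mul0r -(st_div S y tab) !big_ord_recr big_ord0/= add0r.
    rewrite normrM gtr0_norm//.
    apply: (@le_trans _ _ (r * (3 * (2 * C0 * (A * rho^-1 ^+ 3 + K / r))))).
      rewrite ler_wpM2l ?(ltW r0)// (le_trans (ler_norm_sum _ _ _))//.
      apply: (@le_trans _ _ (\sum_(n < 3) 2 * C0 * (A * rho^-1 ^+ 3 + K / r))).
        by apply: ler_sum => n _; exact: vorticity_estimate.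
      by rewrite sumr_const card_ord [leRHS]mulr_natl.
    have -> : r * (3 * (2 * C0 * (A * rho^-1 ^+ 3 + K / r))) =
       6 * C0 * (A * ((r / rho) * rho^-1 ^+ 2) + K) by field; rewrite rn0 gt_eqF.
    rewrite /L ler_wpM2l ?mulr_ge0// lerD2r ler_wpM2l//.
    rewrite -[leRHS]mul1r ler_wpM2r ?exprn_ge0 ?invr_ge0 ?(ltW rho0)//.
    by rewrite ler_pdivrMr// mul1r.
have Er : `|E rho| <= C0 * (A / rho).
  apply: (le_trans (T_le [:: l] x rho0 (reg_continuous ru) (hA i))).
  rewrite expr1 [leRHS](_ : _ = rho^-1 * (A * C0)); last by ring.
  by rewrite ler_wpM2l ?invr_ge0 ?(ltW rho0)// ler_wpM2l// hC0.
apply/ler_addgt0Pl => e e0.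
have [d d0 hd] := J_cvg_c [::] 0 x (r1 l).2 (r1 l).1 e0.
pose c := Num.min d rho.
have c0 : 0 < c by rewrite lt_min d0.
have cd : `|c| <= d by rewrite gtr0_norm// ge_min lexx.
have cr : c <= rho by rewrite ge_min lexx orbT.
have := hd _ cd; rewrite add0r J_nil0 -/N.
have -> : J [::] c (u1 t i l) x = E c.
  by rewrite /E T_cons_u ?gt_eqF// /T mul1r.
have h2 := E1 _ c0 cr.
have h3 : 0 <= L * c by rewrite mulr_ge0// ltW.
have h4 : L * rho = 6 * C0 * (A / rho) + 6 * C0 * (K * rho).
  by rewrite /L; field; rewrite gt_eqF.
have -> : N * `|u1 t i l x| = `|N * u1 t i l x| by rewrite normrM gtr0_norm.
move: (N * _) => X; rewrite !ler_norml in Er h2 *.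
move=> /andP[h5 h6]; move: Er h2 => /andP[h7 h8] /andP[h9 h10].
by apply/andP; split; lra.
Qed.
End estimate.

Theorem stokes_gradient : exists2 C : R, 0 < C &
  forall a b u u1 u2 ut G P P1, stokes a b u u1 u2 ut G P P1 ->
  forall t0 t A K, a < t0 -> t0 < t -> t < b ->
  (forall i x, `|u t i x| <= A) -> (forall i x, `|u t0 i x| <= A) ->
  (forall r i x, t0 <= r <= t -> `|G r i x| <= K) ->
  forall i l x, `|u1 t i l x| <= C * (A / Num.sqrt (t - t0) + K * Num.sqrt (t - t0)).
Proof.
have [C0 C00 hC0] := wint_uniform R 3.
set N := int3 (W (R := R) [::]); have N0 : 0 < N by exact: int3_W0_gt0.
(* The summand 1 makes the constant positive when only [0 <= C0] is known. *)
exists ((7 * C0 + 1) / N) => [|a b u u1 u2 ut G P P1 S t0 t A K at0 t0t tb hA hA0 hK i l x].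
  by rewrite divr_gt0// ltr_pwDr// mulr_ge0.
have := gradient_estimate S at0 t0t tb hA hA0 hK hC0 i l x.
have rho0 : 0 < Num.sqrt (t - t0) by rewrite sqrtr_gt0 subr_gt0.
have A0 : 0 <= A by exact: le_trans (hA 0 0).
have K0 : 0 <= K by apply: le_trans (hK t 0 0 _) => //; rewrite lexx ltW.
have h1 : 0 <= A / Num.sqrt (t - t0) by rewrite divr_ge0// ltW.
have h2 : 0 <= K * Num.sqrt (t - t0) by rewrite mulr_ge0// ltW.
move=> h; rewrite [leRHS]mulrAC ler_pdivlMr// [leLHS]mulrC; apply: (le_trans h).
move: (A / _) (K * _) h1 h2 => p r h1 h2.
have h3 : 0 <= C0 * r by rewrite mulr_ge0.
lra.
Qed.
End stokes_gradient.

(** * Translation-invariant operators *)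

Section tinv.
Context (R : realType).
Notation V := 'rV[R]_3.
Notation e_ i := (delta_mx 0 i : V).
Implicit Types (s : seq 'I_3) (h : V -> R) (x v : V) (B : R).

Lemma reg_shift h v : reg h -> reg (fun y => h (y + v)).
Proof.
move=> [[B hB] ah]; split; first by exists B.
by move=> e /ah[L L0 hL]; exists L => // y w; rewrite addrAC.
Qed.

Lemma reg_sum n (c : 'I_n -> R) (h : 'I_n -> V -> R) : (forall j, reg (h j)) ->
  reg (fun y => \sum_j c j * h j y).
Proof.
elim: n c h => [|n ih] c h rh.
  have -> : (fun y : V => \sum_(j < 0) c j * h j y) = cst 0.
    by apply/funext => y; rewrite big_ord0.
  split; first by exists 0 => y; rewrite normr0.
  by move=> e e0; exists 0 => // y v; rewrite subrr normr0 mul0r addr0 ltW.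
have -> : (fun y => \sum_j c j * h j y) = (fun y =>
    \sum_(j < n) c (widen_ord (leqnSn n) j) * h (widen_ord (leqnSn n) j) y +
    c ord_max * h ord_max y).
  by apply/funext => y; rewrite big_ord_recr.
by apply: reg_add; [exact: ih|exact: reg_mull].
Qed.

Lemma frac_le (N e : R) : 0 <= N -> 0 < e -> N * (e / (N + 1)) <= e.
Proof.
move=> N0 e0; have N1 : 0 < N + 1 by rewrite ltr_pwDr.
by rewrite mulrA ler_pdivrMr// mulrC ler_wpM2l ?(ltW e0)// lerDl.
Qed.

(* Such operators commute with derivatives, hence map solutions of the linear
   system to solutions; difference quotients and convolutions are the instances
   used to pass to second derivatives and to L^3. *)
Record tinv (L : (V -> R) -> V -> R) (N : R) : Prop := {
  tinv_ge0 : 0 <= N;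
  tinv_lin : forall a h h', reg h -> reg h' -> forall x,
    L (fun y => a * h y + h' y) x = a * L h x + L h' x;
  tinv_shift : forall h v x, L (fun y => h (y + v)) x = L h (x + v);
  tinv_bound : forall h B, reg h -> (forall y, `|h y| <= B) ->
    forall x, `|L h x| <= N * B }.

Section closure.
Variables (L : (V -> R) -> V -> R) (N : R).
Hypothesis TL : tinv L N.

(** [tinv_lin] covers only the form a h + h', so - h is written as (-2) h + h, and a h as (a + 1) h
    + (-1) h. *)
Lemma tinv_mull a h x : reg h -> L (fun y => a * h y) x = a * L h x.
Proof.
move=> rh; have -> : (fun y => a * h y) = (fun y => (a + 1) * h y + (-1) * h y).
  by apply/funext => y; ring.
have := tinv_lin TL (-1) rh rh x.
have h0 := tinv_lin TL 0 (reg_mull (-1) rh) rh x.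
have e1 : (fun y => 0 * (-1 * h y) + h y) = h by apply/funext => y; ring.
rewrite e1 in h0.
rewrite (tinv_lin TL (a + 1) rh (reg_mull (-1) rh)).
have -> : L (fun y => -1 * h y) x = - L h x.
  have := tinv_lin TL (-2) rh rh x.
  have -> : (fun y => -2 * h y + h y) = (fun y => -1 * h y) by apply/funext => y; ring.
  by move=> ->; ring.
by move=> _; ring.
Qed.

Lemma tinv_add h h' x : reg h -> reg h' -> L (fun y => h y + h' y) x = L h x + L h' x.
Proof.
move=> rh rh'; have := tinv_lin TL 1 rh rh' x; rewrite mul1r => <-.
by congr (L _ x); apply/funext => y; rewrite mul1r.
Qed.

Lemma tinv_sum n (c : 'I_n -> R) (h : 'I_n -> V -> R) x : (forall j, reg (h j)) ->
  L (fun y => \sum_j c j * h j y) x = \sum_j c j * L (h j) x.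
Proof.
elim: n c h => [|n ih] c h rh.
  rewrite big_ord0; have r0 : reg (cst 0 : V -> R).
    split; first by exists 0 => y; rewrite normr0.
    by move=> e e0; exists 0 => // y v; rewrite subrr normr0 mul0r addr0 ltW.
  rewrite -[RHS](mul0r (L (cst 0) x)) -tinv_mull//; congr (L _ x).
  by apply/funext => y; rewrite big_ord0 mul0r.
have -> : (fun y => \sum_j c j * h j y) = (fun y =>
    \sum_(j < n) c (widen_ord (leqnSn n) j) * h (widen_ord (leqnSn n) j) y +
    c ord_max * h ord_max y).
  by apply/funext => y; rewrite big_ord_recr.
rewrite tinv_add; [|exact: reg_sum|exact: reg_mull].
by rewrite ih// tinv_mull// big_ord_recr.
Qed.

(** The increment of [L h] is [L] applied to the increment of [h], so a uniform bound on the latter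
    passes over with the factor [N]. The next lemmas on [uderiv] and [quad] follow the same
    pattern. *)
Lemma tinv_reg h : reg h -> reg (L h).
Proof.
move=> rh; have [[B hB] ah] := rh; have N0 := tinv_ge0 TL.
split; first by exists (N * B) => x; exact: tinv_bound rh hB x.
move=> e e0; have N1 : 0 < N + 1 by rewrite ltr_pwDr.
have [|K K0 hK] := ah (e / (N + 1)); first exact: divr_gt0.
exists (N * K) => [|x v]; first exact: mulr_ge0.
have -> : L h (x + v) - L h x = L (fun y => h (y + v) + (-1) * h y) x.
  rewrite tinv_add; [|exact: reg_shift|exact: reg_mull].
  by rewrite tinv_mull// (tinv_shift TL) mulN1r.
apply: (@le_trans _ _ (N * (e / (N + 1) + K * `|v|))).
  apply: (tinv_bound TL) => [|y].
    by apply: reg_add; [exact: reg_shift|exact: reg_mull].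
  by rewrite mulN1r.
by rewrite mulrDr lerD ?frac_le// mulrA.
Qed.

Lemma tinv_uderiv i h h' : reg h -> reg h' -> uderiv i h h' -> uderiv i (L h) (L h').
Proof.
move=> rh rh' du e e0; have N0 := tinv_ge0 TL.
have N1 : 0 < N + 1 by rewrite ltr_pwDr.
have [|d d0 hd] := du (e / (N + 1)); first exact: divr_gt0.
exists d => // x r rd.
have -> : L h (x + r *: e_ i) - L h x - r * L h' x =
    L (fun y => h (y + r *: e_ i) + (-1 * h y + - r * h' y)) x.
  rewrite tinv_add; [|exact: reg_shift|by apply: reg_add; exact: reg_mull].
  rewrite tinv_add; [|exact: reg_mull|exact: reg_mull].
  by rewrite !tinv_mull// (tinv_shift TL); ring.
apply: (@le_trans _ _ (N * (e / (N + 1) * `|r|))).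
  apply: (tinv_bound TL) => [|y].
    by do 2?[apply: reg_add]; [exact: reg_shift|exact: reg_mull|exact: reg_mull].
  by rewrite mulN1r mulNr addrA; exact: hd.
by rewrite mulrA ler_wpM2r// frac_le.
Qed.

Lemma tinv_quad h hd M : reg h -> (forall j, reg (hd j)) -> quad h hd M ->
  quad (L h) (fun j => L (hd j)) (N * M).
Proof.
move=> rh rhd q x v.
have -> : L h (x + v) - L h x - \sum_j v 0 j * L (hd j) x =
    L (fun y => h (y + v) + (-1 * h y + -1 * \sum_j v 0 j * hd j y)) x.
  have rs := reg_sum (fun j => v 0 j) rhd.
  rewrite tinv_add; [|exact: reg_shift|by apply: reg_add; exact: reg_mull].
  rewrite tinv_add; [|exact: reg_mull|exact: reg_mull].
  by rewrite !tinv_mull// (tinv_shift TL) tinv_sum//; ring.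
rewrite -mulrA; apply: (tinv_bound TL) => [|y].
  do 2?[apply: reg_add]; [exact: reg_shift|exact: reg_mull|].
  by apply: reg_mull; exact: reg_sum.
by rewrite !mulN1r addrA; exact: q.
Qed.

Lemma stokes_tinv a b u u1 u2 ut G P P1 : stokes a b u u1 u2 ut G P P1 ->
  stokes a b (fun t i => L (u t i)) (fun t i j => L (u1 t i j))
   (fun t i j => L (u2 t i j)) (fun t i => L (ut t i)) (fun t i => L (G t i))
   (fun t => L (P t)) (fun t j => L (P1 t j)).
Proof.
move=> S; split=> [t i|t i j|t i j|t i|t i|t|t i|t i|t i j|t i|t i|t i x|t x] tab.
- by apply: tinv_reg; exact: (st_u S).
- by apply: tinv_reg; exact: (st_u1 S).
- by apply: tinv_reg; exact: (st_u2 S).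
- by apply: tinv_reg; exact: (st_ut S).
- by apply: tinv_reg; exact: (st_G S).
- by apply: tinv_reg; exact: (st_P S).
- by apply: tinv_reg; exact: (st_P1 S).
- have [M qM] := st_quad S i tab; exists (N * M); apply: tinv_quad => //.
    exact: (st_u S).
  by move=> j; exact: (st_u1 S).
- by apply: tinv_uderiv; [exact: (st_u1 S)|exact: (st_u2 S)|exact: (st_d2 S)].
- by apply: tinv_uderiv; [exact: (st_P S)|exact: (st_P1 S)|exact: (st_dP S)].
- move=> e e0; have N0 := tinv_ge0 TL.
  have N1 : 0 < N + 1 by rewrite ltr_pwDr.
  have e10 : 0 < e / (N + 1) by exact: divr_gt0.
  have N2 := near0_itv tab.
  have := st_dt S i tab e10; apply: filterS2 N2 => r rab hr x.
  have ru' := st_u S i rab; have ru := st_u S i tab; have rt := st_ut S i tab.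
  have -> : L (u (t + r) i) x - L (u t i) x - r * L (ut t i) x =
      L (fun y => u (t + r) i y + (-1 * u t i y + - r * ut t i y)) x.
    rewrite tinv_add; [|by []|by apply: reg_add; exact: reg_mull].
    rewrite tinv_add; [|exact: reg_mull|exact: reg_mull].
    by rewrite !tinv_mull//; ring.
  apply: (@le_trans _ _ (N * (e / (N + 1) * `|r|))).
    apply: (tinv_bound TL) => [|y].
      by do 2?[apply: reg_add]; [by []|exact: reg_mull|exact: reg_mull].
    by rewrite mulN1r mulNr addrA; exact: hr.
  by rewrite mulrA ler_wpM2r// frac_le.
- have r2 j := st_u2 S i j tab.
  have rG := st_G S i tab; have rP := st_P1 S i tab.
  have -> : ut t i = (fun y => \sum_j 1 * u2 t i j y + (-1 * G t i y + -1 * P1 t i y)).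
    apply/funext => y; rewrite (st_eq S i y tab).
    by under [in RHS]eq_bigr do rewrite mul1r; ring.
  rewrite tinv_add; [|exact: (reg_sum (fun=> 1))|by apply: reg_add; exact: reg_mull].
  rewrite tinv_add; [|exact: reg_mull|exact: reg_mull].
  rewrite !tinv_mull// (tinv_sum (fun=> 1))//.
  by under [in LHS]eq_bigr do rewrite mul1r; ring.
- have r1 j := st_u1 S j j tab.
  transitivity (L (fun y => \sum_j 1 * u1 t j j y) x).
    by rewrite (tinv_sum (fun=> 1))//; apply: eq_bigr => j _; rewrite mul1r.
  have -> : (fun y => \sum_j 1 * u1 t j j y) = (fun y => 0 * u1 t 0 0 y).
    apply/funext => y; rewrite mul0r; under eq_bigr do rewrite mul1r.
    exact: (st_div S y tab).
  by rewrite tinv_mull// mul0r.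
Qed.
End closure.

Definition dquot (k : 'I_3) (c : R) h x := c^-1 * (h (x + c *: e_ k) - h x).

Lemma tinv_dquot k c : tinv (dquot k c) (2 * `|c^-1|).
Proof.
split=> [|a h h' _ _ x|h v x|h B _ hB x].
- by rewrite mulr_ge0.
- by rewrite /dquot; ring.
- by rewrite /dquot addrAC.
- rewrite /dquot normrM mulrAC [leRHS]mulrC ler_wpM2l//.
  by rewrite (le_trans (ler_normB _ _))// mulr_natl mulr2n lerD.
Qed.

(** No reflection of the argument is made, so that the value at 0 is the pairing of [psi] with
    [h]. *)
Definition conv3 (psi : V -> R) h x := int3 (fun y => psi y * h (x + y)).

Lemma integrable3_mul_bdd psi h x : continuous psi -> integrable3 psi -> continuous h -> bdd h ->
  integrable3 (fun y => psi y * h (x + y)).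
Proof.
move=> cpsi okpsi ch [B hB].
apply: (@integrable3_dom _ _ (fun y => B * `|psi y|)); last first.
- by move=> y; rewrite normrM mulrC ler_wpM2r.
- by apply: integrable3Z; exact: integrable3_norm.
move=> y; apply: continuousM; first exact: cpsi.
have := @continuous_aff R h x 1 ch y.
by congr (continuous_at _ _); apply/funext => v; rewrite scale1r.
Qed.

Lemma tinv_conv3 psi : continuous psi -> integrable3 psi ->
  tinv (conv3 psi) (int3 (fun y => `|psi y|)).
Proof.
move=> cpsi okpsi; have ok h x : reg h -> integrable3 (fun y => psi y * h (x + y)).
  by move=> rh; apply: integrable3_mul_bdd => //; [exact: reg_continuous|exact: reg_bdd].
split=> [|a h h' rh rh' x|h v x|h B rh hB x].
- exact: int3_ge0.
- rewrite /conv3 -int3Z ?ok// -int3D ?ok//; last by apply: integrable3Z; exact: ok.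
  by apply: eq_int3 => y; ring.
- by apply: eq_int3 => y; rewrite addrAC.
- rewrite mulrC -int3Z; last exact: integrable3_norm.
  apply: ler_norm_int3; first exact: ok.
  + by apply: integrable3Z; exact: integrable3_norm.
  + by move=> y; rewrite normrM mulrC ler_wpM2r.
Qed.

Lemma uderiv_lip k h h' A : uderiv k h h' -> (forall y, `|h' y| <= A) ->
  forall y c, `|h (y + c *: e_ k) - h y| <= A * `|c|.
Proof.
move=> du hA y c.
pose f r := h (y + r *: e_ k).
have df (r : R) : is_derive r 1 f (h' (y + r *: e_ k)).
  apply: is_derive_eps => e e0; have [d d0 hd] := du e e0; exists d => // r' /hd.
  by move=> /(_ (y + r *: e_ k)); rewrite /f scalerDl addrA.
have dB (r : R) : is_derive r 1 (fun r : R => A * r) A.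
  by apply: is_derive_eq; rewrite /GRing.scale/= mulr1.
have -> : h y = f 0 by rewrite /f scale0r addr0.
have [c0|c0] := leP 0 c.
  have := @mvt_le _ f (fun r => A * r) (fun r => h' (y + r *: e_ k)) (fun=> A) 0 c c0
    (fun r _ => df r) (fun r _ => dB r) (fun r _ => hA _).
  by rewrite mulr0 subr0 (ger0_norm c0).
have := @mvt_le _ f (fun r => A * r) (fun r => h' (y + r *: e_ k)) (fun=> A) c 0 (ltW c0)
    (fun r _ => df r) (fun r _ => dB r) (fun r _ => hA _).
by rewrite mulr0 sub0r distrC (ltr0_norm c0) mulrN.
Qed.

(** A single direction [k] is differentiated, and [G] enters through its Lipschitz constant along
    it, which is what bounds the difference quotients of [G]. *)
Definition hessian_estimate (C : R) : Prop :=
  forall a b u u1 u2 ut G P P1, stokes a b u u1 u2 ut G P P1 ->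
  forall t0 t A K k, a < t0 -> t0 < t -> t < b ->
  (forall i x, `|u1 t i k x| <= A) -> (forall i x, `|u1 t0 i k x| <= A) ->
  (forall r i x c, t0 <= r <= t -> `|G r i (x + c *: e_ k) - G r i x| <= K * `|c|) ->
  forall i l w, uderiv k (u1 t i l) w ->
  forall x, `|w x| <= C * (A / Num.sqrt (t - t0) + K * Num.sqrt (t - t0)).

(** The gradient estimate for the difference quotient along [k] has bounds independent of the step,
    by the mean value theorem; the step is then chosen so that the quotient of [u1] is within [e] of
    [w]. *)
Theorem stokes_hessian : exists2 C : R, 0 < C & hessian_estimate C.
Proof.
have [C C0 hC] := stokes_gradient R; exists C => //.
move=> a b u u1 u2 ut G P P1 S t0 t A K k at0 t0t tb hA hA0 hK i l w dw x.
have t0ab : a < t0 < b by rewrite at0 (lt_trans t0t).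
have tab : a < t < b by rewrite (lt_trans at0 t0t) tb.
apply/ler_addgt0Pl => e e0; have [d d0 hd] := dw e e0.
set Z := C * _.
have h1 : `|dquot k d (u1 t i l) x| <= Z.
  have S' := stokes_tinv (tinv_dquot k d) S.
  have dle B y h : `|h (y + d *: e_ k) - h y| <= B * `|d| -> `|dquot k d h y| <= B.
    by rewrite /dquot normrM normfV ler_pdivrMl ?normr_gt0 ?gt_eqF// mulrC.
  apply: (hC _ _ _ _ _ _ _ _ _ S' t0 t A K at0 t0t tb) => [j y|j y|r j y tr]; apply: dle.
  - have [M qM] := st_quad S j tab; exact: (uderiv_lip (quad_uderiv k qM) (hA j)).
  - have [M qM] := st_quad S j t0ab; exact: (uderiv_lip (quad_uderiv k qM) (hA0 j)).
  - exact: hK.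
have := hd x d; rewrite gtr0_norm// lexx => /(_ isT) h2.
have h3 : `|w x - dquot k d (u1 t i l) x| <= e.
  have -> : w x - dquot k d (u1 t i l) x =
     - (d^-1 * (u1 t i l (x + d *: e_ k) - u1 t i l x - d * w x)).
    by rewrite /dquot; field; rewrite gt_eqF.
  have dV : 0 < d^-1 by rewrite invr_gt0.
  by rewrite normrN normrM (gtr0_norm dV) ler_pdivrMl// [leRHS]mulrC.
by rewrite -(subrK (dquot k d (u1 t i l) x) (w x)) (le_trans (ler_normD _ _))// lerD.
Qed.
End tinv.

(** * The solution as a classical solution *)

Section calculus.
Context (R : realType).
Notation V := 'rV[R]_3.
Notation e_ i := (delta_mx 0 i : V).
Implicit Types (h : V -> R) (x v y : V) (B : R).

Lemma is_derive_line k h h' : (forall y, is_derive y (e_ k) h (h' y)) ->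
  forall y (r : R), is_derive r 1 (fun r => h (y + r *: e_ k)) (h' (y + r *: e_ k)).
Proof.
move=> dh y r; have [/cvg_ex[l hl] <-] := dh (y + r *: e_ k).
have E : (fun s : R => s^-1 *: (((fun r => h (y + r *: e_ k)) \o shift r) (s *: (1 : R)) -
     h (y + r *: e_ k))) =
   (fun s : R => s^-1 *: ((h \o shift (y + r *: e_ k)) (s *: e_ k) - h (y + r *: e_ k))).
  apply/funext => s; have -> : s *: (1 : R) = s by rewrite /GRing.scale/= mulr1.
  by congr (_ *: (h _ - _)); rewrite /= scalerDl addrCA.
have hl' := hl; rewrite -E in hl'.
apply: DeriveDef; first by apply: (cvgP l).
by rewrite /derive (cvg_lim _ hl')// (cvg_lim _ hl).
Qed.

Lemma line_mvt k h h' y c d K : (forall y, is_derive y (e_ k) h (h' y)) ->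
  (forall r, `|r| <= `|c| -> `|h' (y + r *: e_ k) - d| <= K) ->
  `|h (y + c *: e_ k) - h y - c * d| <= K * `|c|.
Proof.
move=> dh hK; pose f r := h (y + r *: e_ k) - r * d.
have df (r : R) : is_derive r 1 f (h' (y + r *: e_ k) - d).
  have d1 := is_derive_line dh y r.
  have d2 : is_derive r 1 (fun r : R => r * d) d.
    by apply: is_derive_eq; rewrite /GRing.scale/=; ring.
  exact: is_deriveB.
have dB (r : R) : is_derive r 1 (fun r : R => K * r) K.
  by apply: is_derive_eq; rewrite /GRing.scale/= mulr1.
have -> : h (y + c *: e_ k) - h y - c * d = f c - f 0.
  by rewrite /f scale0r addr0; ring.
have [c0|c0] := leP 0 c.
  have := @mvt_le _ f (fun r => K * r) (fun r => h' (y + r *: e_ k) - d) (fun=> K) 0 c c0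
    (fun r _ => df r) (fun r _ => dB r).
  rewrite mulr0 subr0 (ger0_norm c0); apply => r /andP[r0 rc]; apply: hK.
  by rewrite !ger0_norm.
have := @mvt_le _ f (fun r => K * r) (fun r => h' (y + r *: e_ k) - d) (fun=> K) c 0 (ltW c0)
    (fun r _ => df r) (fun r _ => dB r).
rewrite mulr0 sub0r distrC (ltr0_norm c0) mulrN; apply => r /andP[rc r0]; apply: hK.
by rewrite !ler0_norm ?lerN2// ltW.
Qed.

Lemma norm_scale_delta (c : R) k : `|c *: e_ k| = `|c|.
Proof.
apply/eqP; rewrite eq_le; apply/andP; split.
  apply: rV_norm_leP => // j; rewrite !mxE eqxx /= normrM.
  by case: (j == k); rewrite ?normr1 ?mulr1// normr0 mulr0.
have := rV_norm_le (c *: e_ k) k.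
by rewrite !mxE !eqxx mulr1.
Qed.

(** By the mean value theorem on lines, the error of a difference quotient is at most the
    oscillation of the derivative over the step, which is uniformly small. *)
Lemma uderiv_almost_lip k h h' : (forall y, is_derive y (e_ k) h (h' y)) -> almost_lip h' ->
  uderiv k h h'.
Proof.
move=> dh ah e e0; have [|L L0 hL] := ah (e / 2); first by rewrite divr_gt0.
have L1 : 0 < L + 1 by rewrite ltr_pwDr.
exists (e / 2 / (L + 1)) => [|y r hr]; first by rewrite !divr_gt0.
apply: (line_mvt dh) => s sr; rewrite (le_trans (hL _ _))// norm_scale_delta.
rewrite [leRHS]splitr lerD2l.
apply: (@le_trans _ _ ((L + 1) * `|s|)); first by rewrite ler_wpM2r// lerDl.
by rewrite mulrC -ler_pdivlMr// (le_trans sr).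
Qed.

Lemma line_lip k h h' B : (forall y, is_derive y (e_ k) h (h' y)) ->
  (forall y, `|h' y| <= B) -> forall y c, `|h (y + c *: e_ k) - h y| <= B * `|c|.
Proof.
move=> dh hB y c; have := @line_mvt k h h' y c 0 B dh.
by rewrite mulr0 subr0; apply => r _; rewrite subr0.
Qed.

Lemma rV3_decomp v : v = v 0 ord0 *: e_ ord0 + v 0 (inord 1) *: e_ (inord 1) +
  v 0 (inord 2) *: e_ (inord 2).
Proof.
apply/rowP => j; rewrite !mxE !eqxx /=.
case: j => -[|[|[|//]]] p; rewrite -!val_eqE /= ?inordK//= ?mulr0 ?mulr1 ?addr0 ?add0r;
  by congr (v _ _); apply/val_inj; rewrite /= ?inordK.
Qed.

Lemma lip3 h (hd : 'I_3 -> V -> R) B : (forall k y, is_derive y (e_ k) h (hd k y)) ->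
  (forall k y, `|hd k y| <= B) -> forall y v, `|h (y + v) - h y| <= 3 * B * `|v|.
Proof.
move=> dh hB y v; have B0 : 0 <= B by exact: le_trans (hB 0 0).
have st k y' : `|h (y' + v 0 k *: e_ k) - h y'| <= B * `|v|.
  rewrite (le_trans (line_lip (dh k) (hB k) _ _))// ler_wpM2l//; exact: rV_norm_le.
have h0 := st ord0 y; have h1 := st (inord 1) (y + v 0 ord0 *: e_ ord0).
have h2 := st (inord 2) (y + v 0 ord0 *: e_ ord0 + v 0 (inord 1) *: e_ (inord 1)).
rewrite {1}(rV3_decomp v) !addrA.
move: h0 h1 h2; set a0 := h (_ + _); set a1 := h (_ + _); set a2 := h (_ + _).
move=> h0 h1 h2.
have -> : a2 - h y = (a2 - a1) + (a1 - a0) + (a0 - h y) by ring.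
rewrite (le_trans (ler_normD _ _))// (le_trans (lerD (ler_normD _ _) (lexx _)))//.
lra.
Qed.

Lemma lip_almost_lip h B : 0 <= B -> (forall y v, `|h (y + v) - h y| <= B * `|v|) -> almost_lip h.
Proof.
move=> B0 hB e e0; exists B => // y v.
by rewrite (le_trans (hB _ _))// lerDr ltW.
Qed.

(** The increment is split into three moves along the axes. Each starts within 2 |v| of [y] and has
    length at most |v|, so the partial derivatives met differ from those at [y] by at most 3 B |v|;
    three moves give 9 B. *)
Lemma lip3_quad h (hd : 'I_3 -> V -> R) B : 0 <= B ->
  (forall k y, is_derive y (e_ k) h (hd k y)) ->
  (forall k y v, `|hd k (y + v) - hd k y| <= B * `|v|) -> quad h hd (9 * B).
Proof.
move=> B0 dh hB y v.
have st k y' : `|y' - y| <= 2 * `|v| ->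
    `|h (y' + v 0 k *: e_ k) - h y' - v 0 k * hd k y| <= 3 * B * `|v| ^+ 2.
  move=> y'y.
  have vk := rV_norm_le v k.
  apply: (@le_trans _ _ ((3 * B * `|v|) * `|v 0 k|)).
    apply: (line_mvt (dh k)) => r hr.
    have -> : y' + r *: e_ k = y + (y' - y + r *: e_ k) by rewrite addrA addrCA subrr addr0.
    rewrite (le_trans (hB _ _ _))// (mulrC 3) -mulrA ler_wpM2l//.
    rewrite (le_trans (ler_normD _ _))// norm_scale_delta.
    by have := le_trans hr vk; lra.
  by rewrite expr2 mulrA ler_wpM2l// !mulr_ge0.
have dv k : `|v 0 k *: e_ k| <= `|v| by rewrite norm_scale_delta; exact: rV_norm_le.
have h0 := st ord0 y; have h1 := st (inord 1) (y + v 0 ord0 *: e_ ord0).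
have h2 := st (inord 2) (y + v 0 ord0 *: e_ ord0 + v 0 (inord 1) *: e_ (inord 1)).
have sb (p q : V) : p + q - p = q by rewrite addrC addKr.
have nv : 0 <= `|v| by [].
have c0 : `|y - y| <= 2 * `|v| by rewrite subrr normr0 mulr_ge0.
have c1 : `|y + v 0 ord0 *: e_ ord0 - y| <= 2 * `|v|.
  by rewrite sb; have := dv ord0; lra.
have c2 : `|y + v 0 ord0 *: e_ ord0 + v 0 (inord 1) *: e_ (inord 1) - y| <= 2 * `|v|.
  rewrite -[X in X - y]addrA sb (le_trans (ler_normD _ _))//.
  by have := dv ord0; have := dv (inord 1); lra.
move: (h0 c0) (h1 c1) (h2 c2) => {}h0 {}h1 {}h2.
rewrite {1}(rV3_decomp v) !addrA sum_ord3.
move: h0 h1 h2; set a0 := h (_ + _); set a1 := h (_ + _); set a2 := h (_ + _).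
set b0 := v 0 ord0 * _; set b1 := v 0 (inord 1) * _; set b2 := v 0 (inord 2) * _.
move=> h0 h1 h2.
have -> : a2 - h y - (b0 + b1 + b2) = (a2 - a1 - b2) + (a1 - a0 - b1) + (a0 - h y - b0) by ring.
rewrite (le_trans (ler_normD _ _))// (le_trans (lerD (ler_normD _ _) (lexx _)))//.
lra.
Qed.

Lemma hoelder_modulus (M th : R) : 0 < th -> forall e, 0 < e ->
  exists2 d, 0 < d & forall r, 0 <= r -> r <= d -> M * r `^ th <= e.
Proof.
move=> th0 e e0; have M1 : 0 < `|M| + 1 by rewrite ltr_pwDr.
have eM : 0 < e / (`|M| + 1) by exact: divr_gt0.
exists ((e / (`|M| + 1)) `^ th^-1) => [|r r0 rd]; first exact: powR_gt0.
have : r `^ th <= e / (`|M| + 1).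
  have := @ge0_ler_powR R th (ltW th0) r _ r0 (powR_ge0 _ _) rd.
  by rewrite -powRrM mulVf ?gt_eqF// powRr1// ltW.
rewrite ler_pdivlMr// => h1; apply: le_trans h1.
rewrite mulrC ler_wpM2l ?powR_ge0// (le_trans (ler_norm _))// lerDl//.
Qed.

(** Below the scale [d] the Hölder bound is at most [e]; above it the trivial bound 2 B is at most
    (2 B / d) |v|. *)
Lemma holder_reg h (B M th : R) : 0 < th -> (forall x, `|h x| <= B) ->
  (forall x y, `|h x - h y| <= M * `|x - y| `^ th) -> reg h.
Proof.
move=> th0 hB hM; split; first by exists B.
have B0 : 0 <= B by exact: le_trans (hB 0).
move=> e e0; have [d d0 hd] := hoelder_modulus M th0 e0.
exists (2 * B / d) => [|y v]; first by rewrite divr_ge0 ?mulr_ge0// ltW.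
have [vd|vd] := leP `|v| d.
  rewrite (le_trans (hM _ _))// addrC addKr (le_trans (hd _ _ vd))//.
  by rewrite lerDl mulr_ge0// divr_ge0 ?mulr_ge0// ltW.
rewrite (le_trans (ler_normB _ _))//.
have : 2 * B <= 2 * B / d * `|v|.
  by rewrite mulrAC ler_pdivlMr// ler_wpM2l ?mulr_ge0// ltW.
have := hB (y + v); have := hB y; lra.
Qed.

Lemma reg_mul h h' : reg h -> reg h' -> reg (fun y => h y * h' y).
Proof.
move=> [[B hB] ah] [[B' hB'] ah'].
have B0 : 0 <= B by exact: le_trans (hB 0).
have B0' : 0 <= B' by exact: le_trans (hB' 0).
split; first by exists (B * B') => y; rewrite normrM ler_pM.
move=> e e0; pose e1 := e / (B + B' + 1).
have b1 : 0 < B + B' + 1 by rewrite ltr_pwDr// addr_ge0.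
have e10 : 0 < e1 by exact: divr_gt0.
have [L L0 hL] := ah _ e10; have [L' L0' hL'] := ah' _ e10.
exists (B' * L + B * L') => [|y v]; first by rewrite addr_ge0// mulr_ge0.
have -> : h (y + v) * h' (y + v) - h y * h' y =
  (h (y + v) - h y) * h' (y + v) + h y * (h' (y + v) - h' y) by ring.
rewrite (le_trans (ler_normD _ _))// !normrM.
apply: (@le_trans _ _ ((e1 + L * `|v|) * B' + B * (e1 + L' * `|v|))).
  by rewrite lerD// ler_pM.
have : (B + B' + 1) * e1 = e by rewrite /e1 mulrC divfK// gt_eqF.
lra.
Qed.

Lemma uderiv_mul k f f' g g' : reg f -> reg f' -> reg g -> reg g' ->
  uderiv k f f' -> uderiv k g g' -> uderiv k (fun y => f y * g y) (fun y => f' y * g y + f y * g' y).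
Proof.
move=> [[A hA] _] [[A' hA'] _] [[B hB] _] [[B' hB'] _] df dg e e0.
have A0 : 0 <= A by exact: le_trans (hA 0).
have A0' : 0 <= A' by exact: le_trans (hA' 0).
have B0 : 0 <= B by exact: le_trans (hB 0).
have B0' : 0 <= B' by exact: le_trans (hB' 0).
have k0 : 0 < A + B + 1 by rewrite ltr_pwDr// addr_ge0.
pose e1 := e / 2 / (A + B + 1); have e10 : 0 < e1 by rewrite !divr_gt0.
have [d1 d10 hd1] := df _ e10; have [d2 d20 hd2] := dg _ e10.
have k1 : 0 < A' * B' + 1 by rewrite ltr_pwDr// mulr_ge0.
pose d3 := e / 2 / (A' * B' + 1); have d30 : 0 < d3 by rewrite !divr_gt0.
exists (Num.min d1 (Num.min d2 d3)) => [|y r]; first by rewrite !lt_min d10 d20.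
rewrite !le_min => /and3P[r1 r2 r3].
have h1 := hd1 y r r1; have h2 := hd2 y r r2.
have h4 : `|g (y + r *: e_ k) - g y| <= B' * `|r| by exact: uderiv_lip dg hB' _ _.
set f1 := f (y + _) in h1 *; set g1 := g (y + _) in h2 h4 *.
have -> : f1 * g1 - f y * g y - r * (f' y * g y + f y * g' y) =
  (f1 - f y - r * f' y) * g1 + f y * (g1 - g y - r * g' y) + r * f' y * (g1 - g y).
  by ring.
rewrite (le_trans (ler_normD _ _))// (le_trans (lerD (ler_normD _ _) (lexx _)))// !normrM.
have t1 : `|f1 - f y - r * f' y| * `|g1| <= (e1 * `|r|) * B.
  by apply: ler_pM => //; exact: hB.
have t2 : `|f y| * `|g1 - g y - r * g' y| <= A * (e1 * `|r|).
  by apply: ler_pM => //; exact: hA.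
have t3 : `|r| * `|f' y| * `|g1 - g y| <= d3 * A' * (B' * `|r|).
  by apply: ler_pM; rewrite ?mulr_ge0//; apply: ler_pM => //; exact: hA'.
have E1 : (A + B + 1) * e1 = e / 2 by rewrite /e1 mulrC divfK// gt_eqF.
have E2 : (A' * B' + 1) * d3 = e / 2 by rewrite /d3 mulrC divfK// gt_eqF.
apply: (le_trans (lerD (lerD t1 t2) t3)).
rewrite [leLHS](_ : _ = ((A + B + 1) * e1 - e1 + (A' * B' + 1) * d3 - d3) * `|r|); last by ring.
rewrite E1 E2 ler_wpM2r//; lra.
Qed.

Lemma uderiv_add k f f' g g' : uderiv k f f' -> uderiv k g g' ->
  uderiv k (fun y => f y + g y) (fun y => f' y + g' y).
Proof.
move=> df dg e e0; have e20 : 0 < e / 2 by rewrite divr_gt0.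
have [d1 d10 hd1] := df _ e20; have [d2 d20 hd2] := dg _ e20.
exists (Num.min d1 d2) => [|y r]; first by rewrite lt_min d10.
rewrite le_min => /andP[r1 r2].
have -> : f (y + r *: e_ k) + g (y + r *: e_ k) - (f y + g y) - r * (f' y + g' y) =
  (f (y + r *: e_ k) - f y - r * f' y) + (g (y + r *: e_ k) - g y - r * g' y) by ring.
rewrite (le_trans (ler_normD _ _))//.
have := hd1 y r r1; have := hd2 y r r2; lra.
Qed.

End calculus.

Section extraction.
Context (R : realType).
Notation V := 'rV[R]_3.
Notation e_ i := (delta_mx 0 i : V).

Lemma is_derive_coord (f : V -> V) (k i : 'I_3) y : derivable f y (e_ k) ->
  is_derive y (e_ k) (fun x => f x 0 i) (partial k f y 0 i).
Proof.
move=> df; have /derivable_mxP/(_ 0 i) h := df.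
by apply: DeriveDef => //; rewrite /partial (derive_mx df) mxE.
Qed.

Section solution.
Variables (C c : R) (U0 : V -> V) (U : R -> V -> V) (p : R -> V -> R).
Hypothesis sol : described_solution C c U0 U p.

Definition uC t (i : 'I_3) (x : V) := U t x 0 i.
(** The component comes first and the direction second, the transpose of the convention in
    [grad]. *)
Definition uC1 t (i j : 'I_3) (x : V) := partial j (U t) x 0 i.
Definition uC2 t (i j k : 'I_3) (x : V) := partial k (partial j (U t)) x 0 i.
Definition uCt t (i : 'I_3) (x : V) := derive1 (U ^~ x) t 0 i.
Definition convC t (i : 'I_3) (x : V) := \sum_j uC t j x * uC1 t i j x.
Definition convC1 t (k i : 'I_3) (x : V) :=
  \sum_j (uC1 t j k x * uC1 t i j x + uC t j x * uC2 t i j k x).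

Variable t : R.
Hypotheses (t0 : 0 < t) (tT : (t%:E < lifespan C U0)%E).

(** Any positive exponent would serve: the Hölder bound with exponent 0 yields no modulus of
    continuity. *)
Let half01 : 0 <= (1 / 2 : R) < 1. Proof. lra. Qed.

Let h2 := ds_C2 sol t0 tT half01.

Lemma uC_bound : exists B, forall i x, `|uC t i x| <= B.
Proof.
have [_ [M hM] _ _] := h2; exists M => i x.
exact: le_trans (rV_norm_le _ _) (hM x).
Qed.

Lemma uC_derive i j x : is_derive x (e_ j) (uC t i) (uC1 t i j x).
Proof. by have [_ _ hp _] := h2; exact: is_derive_coord. Qed.

Lemma uC1_bound : exists B, forall i j x, `|uC1 t i j x| <= B.
Proof.
have [_ _ _ h1] := h2.
have /choice[M hM] : forall j, exists M, forall x, `|partial j (U t) x| <= M.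
  by move=> j; have [_ [M hM] _ _] := h1 j; exists M.
exists (\sum_j `|M j|) => i j x; apply: (le_trans (rV_norm_le _ _)).
rewrite (le_trans (hM j x))// (le_trans (ler_norm _))// (bigD1 j)//= lerDl.
by rewrite sumr_ge0.
Qed.

Lemma uC1_derive i j k x : is_derive x (e_ k) (uC1 t i j) (uC2 t i j k x).
Proof. by have [_ _ _ h1] := h2; have [_ _ hp _] := h1 j; exact: is_derive_coord. Qed.

Lemma uC2_holder : exists B M, forall i j k, (forall x, `|uC2 t i j k x| <= B) /\
  (forall x y, `|uC2 t i j k x - uC2 t i j k y| <= M * `|x - y| `^ (1 / 2)).
Proof.
have [_ _ _ h1] := h2.
have /choice[M hM] : forall jk : 'I_3 * 'I_3, exists M,
    (forall x, `|partial jk.2 (partial jk.1 (U t)) x| <= M) /\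
    (forall x y, `|partial jk.2 (partial jk.1 (U t)) x -
      partial jk.2 (partial jk.1 (U t)) y| <= M * `|x - y| `^ (1 / 2)).
  move=> [j k] /=; have [_ _ _ h0] := h1 j.
  have [_ [M hM] [M' hM']] := h0 k; exists (`|M| + `|M'|); split=> [x|x y].
    by rewrite (le_trans (hM x _))// (le_trans (ler_norm _))// lerDl.
  rewrite (le_trans (hM' x y _ _))// ler_wpM2r ?powR_ge0//.
  by rewrite (le_trans (ler_norm _))// lerDr.
have le j k : M (j, k) <= \sum_jk `|M jk|.
  by rewrite (bigD1 (j, k))//= (le_trans (ler_norm _))// lerDl sumr_ge0.
exists (\sum_jk `|M jk|), (\sum_jk `|M jk|) => i j k; have [hB hH] := hM (j, k).
split=> [x|x y].
  exact: (le_trans (rV_norm_le _ _) (le_trans (hB x) (le _ _))).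
have -> : uC2 t i j k x - uC2 t i j k y =
   (partial k (partial j (U t)) x - partial k (partial j (U t)) y) 0 i by rewrite !mxE.
rewrite (le_trans (rV_norm_le _ _))// (le_trans (hH x y))//.
by rewrite ler_wpM2r ?powR_ge0.
Qed.

Lemma uC2_reg i j k : reg (uC2 t i j k).
Proof.
have [B [M h]] := uC2_holder; have [hB hM] := h i j k.
exact: (holder_reg _ hB hM).
Qed.

Lemma uC1_lip : exists2 B, 0 <= B & forall i j y v,
  `|uC1 t i j (y + v) - uC1 t i j y| <= B * `|v|.
Proof.
have [B [M h]] := uC2_holder; have B0 : 0 <= B by have [hB _] := h 0 0 0; exact: le_trans (hB 0).
exists (3 * B) => [|i j y v]; first by rewrite mulr_ge0.
apply: (lip3 (hd := fun k => uC2 t i j k)) => [k x|k x]; first exact: uC1_derive.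
by have [] := h i j k.
Qed.

Lemma uC1_reg i j : reg (uC1 t i j).
Proof.
split; first by have [B hB] := uC1_bound; exists B.
by have [B B0 hB] := uC1_lip; exact: lip_almost_lip (hB i j).
Qed.

Lemma uC1_uderiv i j k : uderiv k (uC1 t i j) (uC2 t i j k).
Proof. by apply: uderiv_almost_lip; [move=> y; exact: uC1_derive|have [] := uC2_reg i j k]. Qed.

Lemma uC_quad i : exists M, quad (uC t i) (uC1 t i) M.
Proof.
have [B B0 hB] := uC1_lip; exists (9 * B); apply: lip3_quad => // k y; exact: uC_derive.
Qed.

Lemma uC_reg i : reg (uC t i).
Proof.
split; first by have [B hB] := uC_bound; exists B.
have [B hB] := uC1_bound; have B0 : 0 <= B by exact: le_trans (hB 0 0 0).
apply: (@lip_almost_lip _ _ (3 * B)) => [|y v]; first by rewrite mulr_ge0.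
apply: (lip3 (hd := fun k => uC1 t i k)) => // k x; exact: uC_derive.
Qed.

Lemma uC_uderiv i k : uderiv k (uC t i) (uC1 t i k).
Proof. by have [M] := uC_quad i; exact: quad_uderiv. Qed.

Lemma convC_reg i : reg (convC t i).
Proof.
have h := @reg_sum R 3 (fun=> 1) (fun j y => uC t j y * uC1 t i j y)
  (fun j => reg_mul (uC_reg j) (uC1_reg i j)).
have -> : convC t i = fun y => \sum_j 1 * (uC t j y * uC1 t i j y) => //.
by apply/funext => y; apply: eq_bigr => j _; rewrite mul1r.
Qed.

Lemma convC1_reg k i : reg (convC1 t k i).
Proof.
have h := @reg_sum R 3 (fun=> 1) (fun j y => uC1 t j k y * uC1 t i j y + uC t j y * uC2 t i j k y)
  (fun j => reg_add (reg_mul (uC1_reg j k) (uC1_reg i j)) (reg_mul (uC_reg j) (uC2_reg i j k))).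
have -> : convC1 t k i = fun y => \sum_j 1 * (uC1 t j k y * uC1 t i j y + uC t j y * uC2 t i j k y) => //.
by apply/funext => y; apply: eq_bigr => j _; rewrite mul1r.
Qed.

Lemma convC_uderiv k i : uderiv k (convC t i) (convC1 t k i).
Proof.
have h j := uderiv_mul (uC_reg j) (uC1_reg j k) (uC1_reg i j) (uC2_reg i j k)
  (uC_uderiv j k) (uC1_uderiv i j k).
have := uderiv_add (uderiv_add (h ord0) (h (inord 1))) (h (inord 2)).
have -> : convC t i = fun y => uC t ord0 y * uC1 t i ord0 y +
    uC t (inord 1) y * uC1 t i (inord 1) y + uC t (inord 2) y * uC1 t i (inord 2) y.
  by apply/funext => y; rewrite /convC sum_ord3.
set g' := (X in uderiv _ _ X -> _).
by have -> : convC1 t k i = g' by apply/funext => y; rewrite /convC1 sum_ord3.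
Qed.

Lemma pressure_reg : reg (p t) /\ (forall j, reg (partial j (p t))) /\
  (forall j, uderiv j (p t) (partial j (p t))).
Proof.
have [_ [M hM] hp h0] := ds_pressure_C1 sol t0 tT half01.
have /choice[B hB] : forall j, exists B, forall x, `|partial j (p t) x| <= B.
  by move=> j; have [_ [B hB] _] := h0 j; exists B => x; exact: hB.
pose S := \sum_j `|B j|.
have hS j x : `|partial j (p t) x| <= S.
  rewrite (le_trans (hB j x))// (le_trans (ler_norm _))// /S (bigD1 j)//= lerDl.
  by rewrite sumr_ge0.
have S0 : 0 <= S by exact: sumr_ge0.
have dp j x : is_derive x (e_ j) (p t) (partial j (p t) x).
  by apply: DeriveDef => //; exact: hp.
have r1 j : reg (partial j (p t)).
  have [_ _ [K hK]] := h0 j.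
  apply: (@holder_reg _ _ (B j) K (1 / 2)) => [||x y]; [lra|exact: hB|exact: hK].
split; last first.
  split=> [//|j]; have [_ a1] := r1 j; exact: (uderiv_almost_lip (dp j) a1).
split; first by exists M.
apply: (@lip_almost_lip _ _ (3 * S)) => [|y v]; first by rewrite mulr_ge0.
exact: (lip3 (hd := fun k => partial k (p t))).
Qed.

(** The space-time Hölder bound is available only on times beyond some positive [eta]; it is taken
    with [eta = t / 2] and restricted to the slice at [t]. *)
Lemma uCt_reg i : reg (uCt t i).
Proof.
have th0 : 0 < t / 2 by rewrite divr_gt0.
have th : t / 2 < t by lra.
have tT2 : ((t / 2)%:E < lifespan C U0)%E by rewrite (lt_trans _ tT)// lte_fin.
have [_ [B hB] [M hM]] := ds_Ut sol th0 tT2 half01.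
apply: (@holder_reg _ _ B M (1 / 2 / 2)) => [|x|x y]; first by lra.
  exact: le_trans (rV_norm_le _ _) (hB (t, x) (conj th tT)).
have -> : uCt t i x - uCt t i y = (derive1 (U ^~ x) t - derive1 (U ^~ y) t) 0 i.
  by rewrite !mxE.
apply: (le_trans (rV_norm_le _ _)).
have := hM (t, x) (t, y) (conj th tT) (conj th tT).
by rewrite prod_normE/= subrr normr0 max_r.
Qed.

Lemma uCt_derive i x : is_derive t 1 (fun s => uC s i x) (uCt t i x).
Proof.
have [dU _ _] := (ds_NS sol).1 t x t0 tT.
have /derivable_mxP/(_ 0 i) h := dU.
apply: DeriveDef => //.
by rewrite /uCt derive1E (derive_mx dU) mxE.
Qed.

Lemma uC_equation i x : uCt t i x =
  \sum_j uC2 t i j j x - convC t i x - partial i (p t) x.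
Proof.
have [_ e _] := (ds_NS sol).1 t x t0 tT.
have := congr1 (fun w : V => w 0 i) e.
rewrite !mxE /laplacian /convection !summxE => <-.
rewrite -/(uCt t i x) /convC.
under eq_bigr do rewrite mxE; ring.
Qed.

Lemma uC_div x : \sum_i uC1 t i i x = 0.
Proof. by have [_ _] := (ds_NS sol).1 t x t0 tT. Qed.

End solution.

(** The whole convection term is put into [G]. The interval starts at a > 0 because the Hölder
    bounds are uniform only away from time 0. The one field that needs an argument is [st_dt]: the
    mean value theorem in time, with the Hölder modulus of U_t, which is uniform in x. *)
Lemma sol_stokes (C c : R) (U0 : V -> V) (U : R -> V -> V) (p : R -> V -> R) :
  described_solution C c U0 U p -> forall a b, 0 < a -> (b%:E <= lifespan C U0)%E ->
  stokes a b (uC U) (uC1 U) (fun t i j => uC2 U t i j j) (uCt U) (convC U) p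
    (fun t j => partial j (p t)).
Proof.
move=> sol a b a0 bT.
have rng t : a < t < b -> 0 < t /\ (t%:E < lifespan C U0)%E.
  move=> /andP[at_ tb]; split; first exact: lt_trans at_.
  by rewrite (lt_le_trans _ bT)// lte_fin.
split=> [t i|t i j|t i j|t i|t i|t|t i|t i|t i j|t i|t i|t i x|t x] tab;
  have [t0 tT] := rng _ tab.
- exact: (uC_reg sol t0 tT i).
- exact: (uC1_reg sol t0 tT i j).
- exact: (uC2_reg sol t0 tT i j j).
- exact: (uCt_reg sol t0 tT i).
- exact: (convC_reg sol t0 tT i).
- by have [] := pressure_reg sol t0 tT.
- by have [_ []] := pressure_reg sol t0 tT.
- exact: (uC_quad sol t0 tT i).
- exact: (uC1_uderiv sol t0 tT i j j).
- by have [_ []] := pressure_reg sol t0 tT.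
- move=> e e0; have /andP[at_ tb] := tab.
  have aT : (a%:E < lifespan C U0)%E by rewrite (lt_trans _ tT)// lte_fin.
  have half01 : 0 <= (1 / 2 : R) < 1 by lra.
  have [_ _ [M hM]] := ds_Ut sol a0 aT half01.
  have [|d d0 hd] := @hoelder_modulus R M (1 / 2 / 2) _ e e0; first by lra.
  (* Besides obeying the modulus [d], the step stays below half the distance to the ends, so that
     all times between t and t + r lie in the interval. *)
  pose d1 := Num.min d (Num.min (t - a) (b - t) / 2).
  have d10 : 0 < d1 by rewrite lt_min d0 divr_gt0// lt_min !subr_gt0 at_.
  have N1 : \forall r \near (0 : R), `|r| < d1 by exact: nbhs0_lt.
  apply: filterS N1 => r; rewrite !lt_min => /andP[rd].
  rewrite ltr_pdivlMr// lt_min => /andP[ra rb] x.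
  have in_ s : `|s| <= `|r| -> a < t + s < b.
    by rewrite ler_norml => /andP[s1 s2]; apply/andP; split; have := normr_ge0 r; lra.
  pose f s := uC U s i x - s * uCt U t i x.
  have df (s : R) : a < s < b -> is_derive s 1 f (uCt U s i x - uCt U t i x).
    move=> sab; have [s0 sT] := rng _ sab.
    have d3 := uCt_derive sol s0 sT i x.
    have d2 : is_derive s 1 (fun s : R => s * uCt U t i x) (uCt U t i x).
      by apply: is_derive_eq; rewrite /GRing.scale/=; ring.
    exact: is_deriveB.
  have dB (s : R) : is_derive s 1 (fun s : R => e * s) e.
    by apply: is_derive_eq; rewrite /GRing.scale/= mulr1.
  have bnd s : `|s| <= `|r| -> `|uCt U (t + s) i x - uCt U t i x| <= e.
    move=> sr; have sab := in_ _ sr; have [s0 sT] := rng _ sab; have /andP[as_ _] := sab.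
    have -> : uCt U (t + s) i x - uCt U t i x =
        (derive1 (U ^~ x) (t + s) - derive1 (U ^~ x) t) 0 i by rewrite !mxE.
    apply: (le_trans (rV_norm_le _ _)).
    apply: (le_trans (hM (t + s, x) (t, x) (conj as_ sT) (conj at_ tT))).
    have -> : `|(t + s, x) - (t, x)| = `|s|.
      rewrite prod_normE/= subrr normr0 max_l//.
      by rewrite addrC addKr.
    apply: hd => //; exact: (le_trans sr (ltW rd)).
  have -> : uC U (t + r) i x - uC U t i x - r * uCt U t i x = f (t + r) - f t.
    by rewrite /f; ring.
  have [r0|r0] := leP 0 r.
    have := @mvt_le _ f (fun s => e * s) (fun s => uCt U s i x - uCt U t i x) (fun=> e)
      t (t + r) _ _ (fun s _ => dB s) _.
    rewrite (_ : e * (t + r) - e * t = e * r); last by ring.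
    rewrite (ger0_norm r0); apply.
    - by rewrite lerDl.
    - move=> s /andP[ts sr]; apply: df.
      have -> : s = t + (s - t) by rewrite addrC subrK.
      by apply: in_; rewrite !ger0_norm ?subr_ge0// lerBlDl.
    - move=> s /andP[ts sr].
      have -> : uCt U s i x = uCt U (t + (s - t)) i x by rewrite (addrC t) subrK.
      by apply: bnd; rewrite !ger0_norm ?subr_ge0// lerBlDl.
  have := @mvt_le _ f (fun s => e * s) (fun s => uCt U s i x - uCt U t i x) (fun=> e)
    (t + r) t _ _ (fun s _ => dB s) _.
  rewrite (_ : e * t - e * (t + r) = e * - r); last by ring.
  rewrite distrC (ltr0_norm r0); apply.
  - by rewrite gerDl ltW.
  - move=> s /andP[ts sr]; apply: df.
    have -> : s = t + (s - t) by rewrite addrC subrK.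
    by apply: in_; rewrite !ler0_norm ?subr_le0 ?(ltW r0)//; lra.
  - move=> s /andP[ts sr].
    have -> : uCt U s i x = uCt U (t + (s - t)) i x by rewrite (addrC t) subrK.
    by apply: bnd; rewrite !ler0_norm ?subr_le0 ?(ltW r0)//; lra.
- exact: (uC_equation sol t0 tT i x).
- exact: (uC_div sol t0 tT x).
Qed.
End extraction.

(** * Estimates in L^3 *)

Section l3.
Context (R : realType).
Notation V := 'rV[R]_3.
Notation M := (measurableTypeR R).
Notation T3 := (M * M * M)%type.
Implicit Types (f g h : V -> R) (A B : R).

(** Integrability is recorded separately, since the value of [int3] alone would not ensure that the
    norm is finite. *)
Definition l3 g A := integrable3 (fun v => `|g v| ^+ 3) /\ int3 (fun v => `|g v| ^+ 3) <= A ^+ 3.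

Lemma continuous_norm3 g : continuous g -> continuous (fun v => `|g v| ^+ 3).
Proof.
move=> cg v; apply: (@continuous_comp _ _ _ (fun v => `|g v|) (fun y : R => y ^+ 3));
  last exact: exprn_continuous.
by apply: (@continuous_comp _ _ _ g (fun y : R => `|y|)); [exact: cg|exact: norm_continuous].
Qed.

Lemma l3_dom g h A : continuous g -> l3 h A -> (forall v, `|g v| <= `|h v|) -> l3 g A.
Proof.
move=> cg [okh ih] gh.
have ok : integrable3 (fun v => `|g v| ^+ 3).
  apply: (integrable3_dom (continuous_norm3 cg) okh) => v.
  by rewrite ger0_norm ?exprn_ge0// lerXn2r ?nnegrE.
split=> //; apply: le_trans ih; apply: le_int3 => // v.
by rewrite lerXn2r ?nnegrE.
Qed.

Lemma l3_scale g A c : l3 g A -> l3 (fun v => c * g v) (`|c| * A).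
Proof.
move=> [okg ig]; have E : (fun v => `|c * g v| ^+ 3) = (fun v => `|c| ^+ 3 * `|g v| ^+ 3).
  by apply/funext => v; rewrite normrM exprMn.
split; rewrite E; first exact: integrable3Z.
by rewrite int3Z// exprMn ler_wpM2l// exprn_ge0.
Qed.

(** Convexity of the cube: on nonnegative numbers its graph lies above the tangent at the mean [m],
    and the linear terms sum to 0. *)
Lemma cube_sum_le (I : finType) (x : I -> R) : (forall i, 0 <= x i) ->
  (\sum_i x i) ^+ 3 <= #|I|%:R ^+ 2 * \sum_i x i ^+ 3.
Proof.
move=> x0; case: (posnP #|I|) => [I0|I0].
  rewrite !big1 ?expr0n ?mulr0//; move=> i _; have := card0_eq I0 i; by rewrite inE.
have n0 : 0 < #|I|%:R :> R by rewrite ltr0n.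
set n := #|I|%:R; set S := \sum_i x i; pose m := S / n.
have m0 : 0 <= m by rewrite divr_ge0 ?(ltW n0)// sumr_ge0.
have tan i : m ^+ 3 + 3 * m ^+ 2 * (x i - m) <= x i ^+ 3.
  rewrite -subr_ge0.
  have -> : x i ^+ 3 - (m ^+ 3 + 3 * m ^+ 2 * (x i - m)) = (x i - m) ^+ 2 * (x i + 2 * m).
    by ring.
  by rewrite mulr_ge0 ?sqr_ge0// addr_ge0// mulr_ge0.
have : \sum_i (m ^+ 3 + 3 * m ^+ 2 * (x i - m)) <= \sum_i x i ^+ 3 by exact: ler_sum.
have -> : \sum_i (m ^+ 3 + 3 * m ^+ 2 * (x i - m)) = n * m ^+ 3.
  transitivity (\sum_i ((m ^+ 3 - 3 * m ^+ 2 * m) + 3 * m ^+ 2 * x i)).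
    by apply: eq_bigr => i _; ring.
  rewrite big_split/= sumr_const -mulr_natl -/n.
  rewrite -[X in _ + X]mulr_sumr -/S.
  have -> : S = n * m by rewrite /m mulrC divfK// gt_eqF.
  ring.
move=> h.
have -> : S ^+ 3 = n ^+ 2 * (n * m ^+ 3).
  by rewrite /m; field; rewrite gt_eqF.
by rewrite ler_wpM2l// sqr_ge0.
Qed.

Lemma integrable3_bigsum (I : finType) (F : I -> V -> R) : (forall i, integrable3 (F i)) ->
  integrable3 (fun v => \sum_i F i v) /\ int3 (fun v => \sum_i F i v) = \sum_i int3 (F i).
Proof.
move=> okF.
have E : (fun v => \sum_i F i v) = (fun v => \sum_(j < #|I|) F (enum_val j) v).
  by apply/funext => v; rewrite (reindex _ (onW_bij _ (@enum_val_bij I))).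
rewrite E; split; first by apply: integrable3_sum.
by rewrite int3_sum// [RHS](reindex _ (onW_bij _ (@enum_val_bij I))).
Qed.

(** Minkowski's inequality for n functions with a common bound, obtained from convexity: n^2 from
    [cube_sum_le] times n summands gives n^3. *)
Lemma l3_sum (I : finType) (g : V -> R) (f : I -> V -> R) A : continuous g ->
  (forall i, l3 (f i) A) -> (forall v, `|g v| <= \sum_i `|f i v|) -> l3 g (#|I|%:R * A).
Proof.
move=> cg lf gf.
have [okS iS] := integrable3_bigsum (fun i => (lf i).1).
have okS2 := integrable3Z (#|I|%:R ^+ 2) okS.
have le v : `|g v| ^+ 3 <= #|I|%:R ^+ 2 * \sum_i `|f i v| ^+ 3.
  apply: le_trans (cube_sum_le (fun i => normr_ge0 (f i v))).
  by rewrite lerXn2r ?nnegrE ?sumr_ge0.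
have ok : integrable3 (fun v => `|g v| ^+ 3).
  apply: (integrable3_dom (continuous_norm3 cg) okS2) => v.
  by rewrite ger0_norm ?exprn_ge0.
split=> //; apply: (le_trans (le_int3 ok okS2 le)).
rewrite int3Z// iS.
apply: (@le_trans _ _ (#|I|%:R ^+ 2 * \sum_(i : I) A ^+ 3)).
  by rewrite ler_wpM2l ?sqr_ge0//; apply: ler_sum => i _; have [] := lf i.
rewrite sumr_const -[X in _ * X]mulr_natl; move: (#|I|%:R : R) => n.
by rewrite (_ : n ^+ 2 * (n * A ^+ 3) = (n * A) ^+ 3)//; ring.
Qed.

(** Young's inequality with exponents 3 and 3/2: for z = lam x, the difference of the two sides is
    (z - y)^2 (z + 2 y) up to a positive factor. *)
Lemma young3 (x y lam : R) : 0 <= x -> 0 <= y -> 0 < lam ->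
  x * y ^+ 2 <= 3^-1 * (lam ^+ 2 * x ^+ 3 + 2 / lam * y ^+ 3).
Proof.
move=> x0 y0 l0; pose z := lam * x.
have -> : x = z / lam by rewrite /z mulrC mulKf// gt_eqF.
have z0 : 0 <= z by rewrite mulr_ge0// ltW.
rewrite -subr_ge0.
have -> : 3^-1 * (lam ^+ 2 * (z / lam) ^+ 3 + 2 / lam * y ^+ 3) - z / lam * y ^+ 2 =
  (3 * lam)^-1 * ((z - y) ^+ 2 * (z + 2 * y)) by field; rewrite gt_eqF.
have h1 : 0 <= (3 * lam)^-1 by rewrite invr_ge0 mulr_ge0// ltW.
have h2 : 0 <= z + 2 * y by rewrite addr_ge0// mulr_ge0.
by rewrite mulr_ge0// mulr_ge0// sqr_ge0.
Qed.

Lemma gauss3_le1 a (v : V) : 0 < a -> gauss3 a v <= 1.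
Proof.
move=> a0; rewrite /gauss3 -expR0 ler_expR mulNr oppr_le0 mulr_ge0 ?(ltW a0)//.
by rewrite sumr_ge0// => i _; exact: sqr_ge0.
Qed.

(* [|f| f] is the functional norming [f] in L^3; the Gaussian makes it integrable
   before [f] is known to lie in L^3. *)
Definition dual3 a f v := `|f v| * f v * gauss3 a v.

Section duality.
Variables (f : V -> R) (a : R).
Hypotheses (rf : reg f) (a0 : 0 < a).

Let cf := reg_continuous rf.

Let g0 v : 0 <= gauss3 a v :> R. Proof. exact: expR_ge0. Qed.

Lemma continuous_dual3 : continuous (dual3 a f).
Proof.
move=> v; apply: (@continuousM R V (fun v => `|f v| * f v)); last exact: continuous_gauss3.
apply: (@continuousM R V (fun v => `|f v|)); last exact: cf.
by apply: (@continuous_comp _ _ _ f (fun y : R => `|y|)); [exact: cf|exact: norm_continuous].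
Qed.

Lemma integrable3_dual3 : integrable3 (dual3 a f).
Proof.
have [[B hB] _] := rf; have B0 : 0 <= B by exact: le_trans (hB 0).
apply: (@integrable3_gdom _ _ a (B * B)) => // [|v]; first exact: continuous_dual3.
by rewrite /dual3 !normrM normr_id (ger0_norm (g0 v)) ler_wpM2r// ler_pM.
Qed.

Lemma integrable3_cube_gauss : integrable3 (fun v => `|f v| ^+ 3 * gauss3 a v).
Proof.
have [[B hB] _] := rf; have B0 : 0 <= B by exact: le_trans (hB 0).
apply: (@integrable3_gdom _ _ a (B ^+ 3)) => // [v|v].
  apply: (@continuousM R V (fun v => `|f v| ^+ 3)); first exact: continuous_norm3.
  exact: continuous_gauss3.
by rewrite normrM (ger0_norm (g0 v)) ler_wpM2r// ger0_norm ?exprn_ge0// lerXn2r ?nnegrE.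
Qed.

(** Hölder's inequality with exponents 3 and 3/2, derived from Young's with the optimal
    [lam = b / A]: the two terms become one third and two thirds of A b^2. *)
Lemma conv3_dual3_le g A b x : reg g -> l3 g A -> 0 < A -> 0 < b ->
  b ^+ 3 = int3 (fun v => `|f v| ^+ 3 * gauss3 a v) ->
  `|conv3 (dual3 a f) g x| <= A * b ^+ 2.
Proof.
move=> rg [okg ig] A0 b0 bE.
pose lam := b / A; have l0 : 0 < lam by exact: divr_gt0.
have okc : integrable3 (fun y => dual3 a f y * g (x + y)).
  apply: integrable3_mul_bdd; [exact: continuous_dual3|exact: integrable3_dual3|
    exact: reg_continuous|exact: reg_bdd].
have okgx : integrable3 (fun y => `|g (y + x)| ^+ 3) by exact: (integrable3_shift x okg).
have okr : integrable3 (fun y => 3^-1 * (lam ^+ 2 * `|g (y + x)| ^+ 3 +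
    2 / lam * (`|f y| ^+ 3 * gauss3 a y))).
  by apply: integrable3Z; apply: integrable3D; apply: integrable3Z => //; exact: integrable3_cube_gauss.
have le y : `|dual3 a f y * g (x + y)| <= 3^-1 * (lam ^+ 2 * `|g (y + x)| ^+ 3 +
    2 / lam * (`|f y| ^+ 3 * gauss3 a y)).
  rewrite /dual3 !normrM normr_id (ger0_norm (g0 y)) addrC.
  apply: (@le_trans _ _ (3^-1 * (lam ^+ 2 * `|g (y + x)| ^+ 3 + 2 / lam * `|f y| ^+ 3) * gauss3 a y)).
    rewrite mulrAC ler_wpM2r// -expr2 mulrC; exact: young3.
  rewrite -mulrA ler_wpM2l ?invr_ge0// mulrDl -[X in _ + X]mulrA lerD2r.
  by rewrite -[leRHS]mulr1 ler_wpM2l ?gauss3_le1// mulr_ge0 ?sqr_ge0// exprn_ge0.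
apply: (le_trans (ler_norm_int3 okc okr le)).
rewrite int3Z; last by apply: integrable3D; apply: integrable3Z => //; exact: integrable3_cube_gauss.
rewrite int3D; [|exact: integrable3Z|by apply: integrable3Z; exact: integrable3_cube_gauss].
rewrite !int3Z//; last exact: integrable3_cube_gauss.
rewrite (int3_shift x okg) -bE.
apply: (@le_trans _ _ (3^-1 * (lam ^+ 2 * A ^+ 3 + 2 / lam * b ^+ 3))).
  by rewrite ler_wpM2l ?invr_ge0// lerD2r ler_wpM2l ?sqr_ge0.
by rewrite le_eqVlt; apply/orP; left; apply/eqP; rewrite /lam; field; rewrite !gt_eqF.
Qed.

Lemma conv3_dual3_self : conv3 (dual3 a f) f 0 = int3 (fun v => `|f v| ^+ 3 * gauss3 a v).
Proof.
apply: eq_int3 => v; rewrite add0r /dual3.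
have -> : `|f v| ^+ 3 = `|f v| * `|f v| ^+ 2 by rewrite exprS.
by rewrite real_normK ?num_real//; ring.
Qed.
End duality.

(** At 0 the pairing equals b^3, so the hypothesis gives b <= K for every Gaussian cut-off. Letting
    [a] decrease to 0, monotone convergence yields the integrability together with the bound. *)
Lemma l3_dual f K : reg f -> 0 <= K ->
  (forall a b, 0 < a -> 0 < b -> b ^+ 3 = int3 (fun v => `|f v| ^+ 3 * gauss3 a v) ->
     conv3 (dual3 a f) f 0 <= K * b ^+ 2) -> l3 f K.
Proof.
move=> rf K0 h; have cf := reg_continuous rf.
have key a : 0 < a -> int3 (fun v => `|f v| ^+ 3 * gauss3 a v) <= K ^+ 3.
  move=> a0; set X := int3 _.
  have X0 : 0 <= X by apply: int3_ge0 => v; rewrite mulr_ge0 ?exprn_ge0// expR_ge0.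
  have [X00|Xpos] := eqVneq X 0; first by rewrite X00 exprn_ge0.
  have {}Xpos : 0 < X by rewrite lt_neqAle eq_sym Xpos.
  pose b := X `^ 3^-1; have b0 : 0 < b by exact: powR_gt0.
  have bE : b ^+ 3 = X.
    by rewrite /b -powR_mulrn ?powR_ge0// -powRrM mulVf// powRr1.
  have := h a b a0 b0 bE; rewrite conv3_dual3_self// -/X -bE => h1.
  have bK : b <= K.
    have : b ^+ 2 * b <= b ^+ 2 * K by rewrite -exprSr [leRHS]mulrC.
    by rewrite ler_pM2l// exprn_gt0.
  by rewrite lerXn2r ?nnegrE// ltW.
pose F n (z : T3) := (`|f (row3 z)| ^+ 3 * gauss3 n.+1%:R^-1 (row3 z))%:E.
have a0 n : 0 < n.+1%:R^-1 :> R by rewrite invr_gt0.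
have Fi n : (\int[leb3 R]_z F n z <= (K ^+ 3)%:E)%E.
  have ok := integrable3_cube_gauss rf (a0 n).
  rewrite -(fineK (integrable_fin_num measurableT ok)) lee_fin.
  exact: key (a0 n).
have Fm n : measurable_fun setT (F n).
  by have /integrableP[] := integrable3_cube_gauss rf (a0 n).
have F0 n z : setT z -> (0 <= F n z)%E.
  by move=> _; rewrite lee_fin mulr_ge0 ?exprn_ge0// expR_ge0.
have Fnd z : setT z -> {homo F ^~ z : n m / (n <= m)%N >-> (n <= m)%E}.
  move=> _ n m nm; rewrite lee_fin ler_wpM2l ?exprn_ge0// ler_expR ler_wpM2r//.
    by rewrite sumr_ge0// => i _; exact: sqr_ge0.
  by rewrite lerN2 lef_pV2 ?posrE// ler_nat.
have Flim z : limn (F ^~ z) = (`|f (row3 z)| ^+ 3)%:E.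
  apply/cvg_lim => //; apply/cvg_EFin; first by apply: nearW.
  rewrite -[X in _ --> X]mulr1; apply: cvgM; first exact: cvg_cst.
  have h1 : - n.+1%:R^-1 * \sum_i row3 z 0 i ^+ 2 @[n --> \oo] --> (0 : R).
    rewrite -[X in _ --> X](mul0r (\sum_i row3 z 0 i ^+ 2)).
    by apply: cvgMl; rewrite -oppr0; apply: cvgN; exact: cvg_harmonic.
  have := cvg_comp _ _ h1 (@continuous_expR R 0); rewrite expR0; exact.
have := monotone_convergence (leb3 R) measurableT Fm F0 Fnd.
move=> E.
have le : (\int[leb3 R]_z (`|f (row3 z)| ^+ 3)%:E <= (K ^+ 3)%:E)%E.
  under eq_integral do rewrite -Flim.
  rewrite E; apply: lime_le.
    apply: ereal_nondecreasing_is_cvgn => n m nm; apply: ge0_le_integral => //;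
      by move=> z _; first [exact: F0|exact: (Fnd z Logic.I n m nm)].
  exact: nearW.
have ok : integrable3 (fun v => `|f v| ^+ 3).
  apply/integrableP; split.
    by apply/measurable_EFinP; apply: (continuous_measurable3 (continuous_norm3 cf)).
  under eq_integral do rewrite gee0_abs ?lee_fin ?exprn_ge0//.
  exact: le_lt_trans le (ltry _).
split=> //; rewrite /int3 /Rintegral -lee_fin fineK//.
exact: (integrable_fin_num measurableT ok).
Qed.
End l3.

Section stokes_l3.
Context (R : realType).
Notation V := 'rV[R]_3.
Implicit Types (f g h : V -> R) (A B K : R).

Lemma l3_le g A B : l3 g A -> 0 <= A -> A <= B -> l3 g B.
Proof.
move=> [okg ig] A0 AB; split=> //; apply: (le_trans ig).
by rewrite lerXn2r ?nnegrE// (le_trans A0).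
Qed.

(** [A] and [K] are taken positive because the optimal parameter in [conv3_dual3_le] divides by
    them. *)
Definition gradient_estimate_l3 (C : R) : Prop :=
  forall a b u u1 u2 ut G P P1, stokes a b u u1 u2 ut G P P1 ->
  forall t0 t A K, a < t0 -> t0 < t -> t < b -> 0 < A -> 0 < K ->
  (forall i, l3 (u t i) A) -> (forall i, l3 (u t0 i) A) ->
  (forall r i, t0 <= r <= t -> l3 (G r i) K) ->
  forall i l, l3 (u1 t i l) (C * (A / Num.sqrt (t - t0) + K * Num.sqrt (t - t0))).

(** The kernel is built from the derivative to be estimated, at time [t], and then kept fixed for
    all times. The convolved functions solve the linear system again, with data bounded by A b^2 and
    K b^2 in the sup norm, so the constant is that of the sup estimate. *)
Theorem stokes_gradient_l3 : exists2 C : R, 0 < C & gradient_estimate_l3 C.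
Proof.
have [C C0 hC] := stokes_gradient R; exists C => //.
move=> a b u u1 u2 ut G P P1 S t0 t A K at0 t0t tb A0 K0 hA hA0 hK i l.
have rng r : t0 <= r <= t -> a < r < b.
  by move=> /andP[h1 h2]; rewrite (lt_le_trans at0 h1) (le_lt_trans h2 tb).
have t0ab : a < t0 < b by apply: rng; rewrite lexx ltW.
have tab : a < t < b by apply: rng; rewrite lexx ltW.
have rf := st_u1 S i l tab.
apply: l3_dual => //.
  by rewrite mulr_ge0 ?(ltW C0)// addr_ge0// ?divr_ge0 ?mulr_ge0 ?sqrtr_ge0// ltW.
move=> c b' c0 b0 bE.
have TL := tinv_conv3 (continuous_dual3 rf) (integrable3_dual3 rf c0).
have := hC _ _ _ _ _ _ _ _ _ (stokes_tinv TL S) t0 t (A * b' ^+ 2) (K * b' ^+ 2) at0 t0t tb.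
move=> /(_ _ _ _ i l 0) => h.
apply: (le_trans (ler_norm _)); apply: (le_trans (h _ _ _)).
- by move=> j x; apply: conv3_dual3_le => //; exact: (st_u S j tab).
- by move=> j x; apply: conv3_dual3_le => //; exact: (st_u S j t0ab).
- by move=> r j x tr; apply: conv3_dual3_le => //; [exact: (st_G S j (rng _ tr))|exact: hK].
by rewrite le_eqVlt; apply/orP; left; apply/eqP; ring.
Qed.

Definition hessian_estimate_l3 (C : R) : Prop :=
  forall a b u u1 u2 ut G P P1, stokes a b u u1 u2 ut G P P1 ->
  forall t0 t A K k G1, a < t0 -> t0 < t -> t < b -> 0 < A -> 0 < K ->
  (forall i, l3 (u1 t i k) A) -> (forall i, l3 (u1 t0 i k) A) ->
  (forall r i, t0 <= r <= t ->
     [/\ reg (G1 r i), uderiv k (G r i) (G1 r i) & l3 (G1 r i) K]) ->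
  forall i l w, reg w -> uderiv k (u1 t i l) w ->
  l3 w (C * (A / Num.sqrt (t - t0) + K * Num.sqrt (t - t0))).

Theorem stokes_hessian_l3 : exists2 C : R, 0 < C & hessian_estimate_l3 C.
Proof.
have [C C0 hC] := stokes_hessian R; exists C => //.
move=> a b u u1 u2 ut G P P1 S t0 t A K k G1 at0 t0t tb A0 K0 hA hA0 hK i l w rw dw.
have rng r : t0 <= r <= t -> a < r < b.
  by move=> /andP[h1 h2]; rewrite (lt_le_trans at0 h1) (le_lt_trans h2 tb).
have t0ab : a < t0 < b by apply: rng; rewrite lexx ltW.
have tab : a < t < b by apply: rng; rewrite lexx ltW.
apply: l3_dual => //.
  by rewrite mulr_ge0 ?(ltW C0)// addr_ge0// ?divr_ge0 ?mulr_ge0 ?sqrtr_ge0// ltW.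
move=> c b' c0 b0 bE.
have TL := tinv_conv3 (continuous_dual3 rw) (integrable3_dual3 rw c0).
have := hC _ _ _ _ _ _ _ _ _ (stokes_tinv TL S) t0 t (A * b' ^+ 2) (K * b' ^+ 2) k at0 t0t tb.
have dLw := tinv_uderiv TL (st_u1 S i l tab) rw dw.
move=> /(_ _ _ _ i l _ dLw 0) => h.
apply: (le_trans (ler_norm _)); apply: (le_trans (h _ _ _)).
- by move=> j x; apply: conv3_dual3_le => //; exact: (st_u1 S j k tab).
- by move=> j x; apply: conv3_dual3_le => //; exact: (st_u1 S j k t0ab).
- move=> r j x c' tr; have [rG1 dG1 lG1] := hK r j tr.
  apply: (uderiv_lip (tinv_uderiv TL (st_G S j (rng _ tr)) rG1 dG1)) => y.
  exact: conv3_dual3_le.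
by rewrite le_eqVlt; apply/orP; left; apply/eqP; ring.
Qed.
End stokes_l3.

(** * Smallness of the second derivatives *)

Section absorption.
Context (R : realType).
Notation V := 'rV[R]_3.

(* Absorption without knowing that the optimal bound [N] is attained. *)
Lemma iterate_half (X D N0 : R) (P : R -> Prop) :
  (forall N, 0 <= N -> P N -> P (D + N / 2)) -> 0 <= D -> 0 <= N0 -> P N0 ->
  (forall N, P N -> X <= N) -> X <= 2 * D.
Proof.
move=> step D0 N00 PN0 XP.
have key n : P (2 * D * (1 - 2^-1 ^+ n) + N0 * 2^-1 ^+ n) /\
   0 <= 2 * D * (1 - 2^-1 ^+ n) + N0 * 2^-1 ^+ n.
  elim: n => [|n [Pn n0]]; first by rewrite expr0 subrr mulr0 add0r mulr1.
  have -> : 2 * D * (1 - 2^-1 ^+ n.+1) + N0 * 2^-1 ^+ n.+1 =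
     D + (2 * D * (1 - 2^-1 ^+ n) + N0 * 2^-1 ^+ n) / 2 by rewrite exprS; field.
  split; first exact: step.
  by rewrite addr_ge0// divr_ge0.
apply/ler_addgt0Pl => e e0.
have h : N0 * 2^-1 ^+ n @[n --> \oo] --> (0 : R).
  rewrite -[X in _ --> X](mulr0 N0); apply: cvgMr.
  by apply: cvg_expr; rewrite ger0_norm ?invr_ge0// invf_lt1// ltr1n.
have : \forall n \near \oo, N0 * 2^-1 ^+ n <= e by exact: (cvgr_le _ h).
case=> n _ /(_ n (leqnn n)) /= hn.
have [Pn _] := key n; apply: (le_trans (XP _ Pn)).
have : 0 <= 2 * D * 2^-1 ^+ n by rewrite !mulr_ge0// exprn_ge0// invr_ge0.
lra.
Qed.

Section solution.
Variables (C c : R) (U0 : V -> V) (U : R -> V -> V) (p : R -> V -> R).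
Hypothesis sol : described_solution C c U0 U p.
Variables (tau b : R).
Hypotheses (taub : tau < b) (bT : (b%:E <= lifespan C U0)%E).

Let inT s : 0 < s -> s <= tau -> (s%:E < lifespan C U0)%E.
Proof. by move=> s0 st; rewrite (lt_le_trans _ bT)// lte_fin (le_lt_trans st). Qed.

(** A bound without rate, which provides the finite value from which the absorption is iterated. *)
Lemma uC2_bound_away eta : 0 < eta -> eta <= tau -> exists2 B, 0 <= B &
  forall s i j k x, eta < s -> s <= tau -> `|uC2 U s i j k x| <= B.
Proof.
move=> e0 et; have half01 : 0 <= (1 / 2 : R) < 1 by lra.
have /choice[B hB] : forall jk : 'I_3 * 'I_3, exists B, forall s x, eta < s -> s <= tau ->
    `|partial jk.2 (partial jk.1 (U s)) x| <= B.
  move=> [j k] /=; have [_ [B hB] _] := ds_D2 sol e0 (inT e0 et) half01 k j.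
  exists B => s x es st; apply: (hB (s, x)); split=> //=.
  by apply: inT => //; exact: lt_trans es.
exists (\sum_jk `|B jk|) => [|s i j k x es st]; first exact: sumr_ge0.
apply: (le_trans (rV_norm_le _ _)); apply: (le_trans (hB (j, k) s x es st)).
by rewrite (le_trans (ler_norm _))// (bigD1 (j, k))//= lerDl sumr_ge0.
Qed.

Lemma convC1_le t k i x X Y Z : 0 <= X -> 0 <= Y -> 0 <= Z ->
  (forall j, `|uC U t j x| <= X) -> (forall i j, `|uC1 U t i j x| <= Y) ->
  (forall i j k, `|uC2 U t i j k x| <= Z) -> `|convC1 U t k i x| <= 3 * (Y * Y + X * Z).
Proof.
move=> X0 Y0 Z0 hX hY hZ; rewrite /convC1.
rewrite (le_trans (ler_norm_sum _ _ _))//.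
apply: (@le_trans _ _ (\sum_(j < 3) (Y * Y + X * Z))).
  apply: ler_sum => j _; rewrite (le_trans (ler_normD _ _))// !normrM.
  by rewrite lerD// ler_pM.
by rewrite sumr_const card_ord mulr_natl.
Qed.

Section small.
Variables (CH eps : R).
Hypotheses (CH0 : 0 < CH) (hCH : hessian_estimate CH).
Hypotheses (eps0 : 0 < eps) (eps1 : eps <= 1) (epsC : 18 * CH * eps <= 1).
Hypotheses (hu : forall s i x, 0 < s -> s <= tau -> `|uC U s i x| <= eps / Num.sqrt s)
  (hu1 : forall s i j x, 0 < s -> s <= tau -> `|uC1 U s i j x| <= eps / s).

(** The weight vanishes at [eta], which is taken positive, and not at time 0: no bound on the second
    derivatives near 0 is known beforehand, so only this shifted supremum is known to be finite. *)
Let Pr eta N := forall s i j k x, eta < s -> s <= tau ->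
  (s - eta) * Num.sqrt (s - eta) * `|uC2 U s i j k x| <= N.

(** The Hessian estimate on [t - del, t] with del = (t - eta) / 2: there s - eta >= del, so the old
    bound gives |D^2 U| <= N del^(-3/2). Multiplied by the weight, the right side is at most 3 CH
    eps + 9 CH eps^2 + 9 CH eps N; the first two terms are at most 12 CH eps as eps <= 1, and the
    last is at most N / 2 by [epsC]. *)
Lemma absorption_step eta N : 0 < eta -> 0 <= N -> Pr eta N -> Pr eta (12 * CH * eps + N / 2).
Proof.
move=> e0 N0 PN t i l k x et tt.
pose del := (t - eta) / 2; have d0 : 0 < del by rewrite divr_gt0// subr_gt0.
pose rho := Num.sqrt del; have r0 : 0 < rho by rewrite sqrtr_gt0.
have rho2 : del = rho ^+ 2 by rewrite sqr_sqrtr// ltW.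
have S := sol_stokes sol e0 bT.
pose t0 := t - del.
have et0 : eta < t0 by rewrite /t0 /del; lra.
have t0t : t0 < t by rewrite /t0; lra.
have tb : t < b by exact: le_lt_trans tt taub.
have tE : t - t0 = del by rewrite /t0; ring.
have tp r : t0 <= r -> [/\ 0 < r, eta < r, del <= r & del <= r - eta].
  by rewrite /t0 /del => h; split; lra.
have sq r : del <= r -> rho <= Num.sqrt r by move=> h; exact: ler_wsqrtr.
have Nb r i' j' k' y : t0 <= r -> r <= t -> `|uC2 U r i' j' k' y| <= N / (del * rho).
  move=> h1 h2; have [r0' er dr dr'] := tp r h1.
  have drho : 0 < del * rho by exact: mulr_gt0.
  rewrite ler_pdivlMr// [leLHS]mulrC.
  apply: le_trans (PN r i' j' k' y er (le_trans h2 tt)).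
  by rewrite ler_wpM2r//; apply: ler_pM (ltW d0) (ltW r0) dr' (sq _ dr').
have u1b r i' j' y : t0 <= r -> r <= t -> `|uC1 U r i' j' y| <= eps / del.
  move=> h1 h2; have [r0' er dr dr'] := tp r h1.
  apply: (le_trans (hu1 _ _ _ r0' (le_trans h2 tt))).
  by rewrite ler_wpM2l ?(ltW eps0)// lef_pV2 ?posrE.
have ub r i' y : t0 <= r -> r <= t -> `|uC U r i' y| <= eps / rho.
  move=> h1 h2; have [r0' er dr dr'] := tp r h1.
  apply: (le_trans (hu _ _ r0' (le_trans h2 tt))).
  by rewrite ler_wpM2l ?(ltW eps0)// lef_pV2 ?posrE ?sqrtr_gt0// sq.
pose K := 3 * (eps / del * (eps / del) + eps / rho * (N / (del * rho))).
have X0 : 0 <= eps / rho by apply: ltW; exact: divr_gt0.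
have Y0 : 0 <= eps / del by apply: ltW; exact: divr_gt0.
have Z0 : 0 <= N / (del * rho) by rewrite divr_ge0// ltW// mulr_gt0.
have t00 : 0 < t by exact: lt_trans et.
have := hCH S (K := K) (k := k) (A := eps / del) et0 t0t tb _ _ _
  (uC1_uderiv sol t00 (inT t00 tt) i l k) x.
rewrite tE -/rho => h.
have {}h := h (fun i x => u1b t i k x (ltW t0t) (lexx _))
  (fun i x => u1b t0 i k x (lexx _) (ltW t0t)) _.
have hK r i' y c' : t0 <= r <= t ->
    `|convC U r i' (y + c' *: (delta_mx 0 k : V)) - convC U r i' y| <= K * `|c'|.
  move=> /andP[h1 h2]; have [r0' er dr dr'] := tp r h1.
  apply: (uderiv_lip (convC_uderiv sol r0' (inT r0' (le_trans h2 tt)) k i')) => z.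
  by apply: convC1_le => // *; [exact: ub|exact: u1b|exact: Nb].
have {}h := h hK.
have t2 : t - eta = 2 * del by rewrite /del; field.
(* The factor sqrt 2 is replaced by the rational bound 3/2, so that (t - eta)^(3/2) <= 3 rho^3. *)
have s2 : Num.sqrt (t - eta) <= 3 / 2 * rho.
  rewrite -[leRHS]ger0_norm ?mulr_ge0 ?(ltW r0)// -sqrtr_sqr ler_wsqrtr// t2 exprMn -rho2.
  by have := d0; lra.
apply: (@le_trans _ _ (3 * rho ^+ 3 * `|uC2 U t i l k x|)).
  move: s2; set q := Num.sqrt (t - eta) => s2.
  rewrite ler_wpM2r// t2 rho2 [leRHS](_ : _ = 2 * rho ^+ 2 * (3 / 2 * rho)); last by field.
  by apply: ler_wpM2l => //; apply: mulr_ge0 => //; exact: sqr_ge0.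
apply: (@le_trans _ _ (3 * rho ^+ 3 * (CH * (eps / del / rho + K * rho)))).
  by rewrite ler_wpM2l// mulr_ge0// exprn_ge0// ltW.
have -> : 3 * rho ^+ 3 * (CH * (eps / del / rho + K * rho)) =
   3 * CH * eps + 9 * CH * eps * eps + 9 * CH * eps * N.
  by rewrite /K rho2; field; rewrite gt_eqF.
have h1 : CH * eps * eps <= CH * eps by rewrite -[leRHS]mulr1 ler_wpM2l// mulr_ge0// ltW.
have h2 : 18 * CH * eps * N <= N by rewrite -[leRHS]mul1r ler_wpM2r.
lra.
Qed.

(** With eta = s / 2 the iteration gives 2 times 12 CH eps for the weight (s/2)^(3/2), and s^(3/2)
    <= 3 (s/2)^(3/2): this is the 72. The starting bound depends on s but disappears in the
    limit. *)
Lemma hessian_decay s i j k x : 0 < s -> s <= tau ->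
  `|uC2 U s i j k x| <= 72 * CH * eps / (s * Num.sqrt s).
Proof.
move=> s0 st; pose eta := s / 2.
have e0 : 0 < eta by rewrite divr_gt0.
have es : eta < s by rewrite /eta; lra.
have et : eta <= tau by exact: le_trans (ltW es) st.
have [B B0 hB] := uC2_bound_away e0 et.
have tau0 : 0 < tau by exact: lt_le_trans st.
have P0 : Pr eta (tau * Num.sqrt tau * B).
  move=> r i' j' k' y er rt.
  have h1 : 0 <= r - eta by rewrite subr_ge0 ltW.
  have h2 : r - eta <= tau by lra.
  by rewrite ler_pM ?mulr_ge0 ?sqrtr_ge0// ?ler_pM ?sqrtr_ge0 ?ler_wsqrtr// hB.
have D0 : 0 <= 12 * CH * eps by rewrite !mulr_ge0// ltW.
have N0 : 0 <= tau * Num.sqrt tau * B by rewrite !mulr_ge0 ?sqrtr_ge0// ltW.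
have h := iterate_half (fun N N0 => @absorption_step eta N e0 N0) D0 N0 P0
  (fun N PN => PN s i j k x es st).
have sE : s - eta = s / 2 by rewrite /eta; field.
rewrite sE in h.
have ss0 : 0 < Num.sqrt s by rewrite sqrtr_gt0.
rewrite ler_pdivlMr ?mulr_gt0//.
have sq : Num.sqrt s <= 3 / 2 * Num.sqrt (s / 2).
  rewrite -[leRHS]ger0_norm ?mulr_ge0 ?sqrtr_ge0// -sqrtr_sqr ler_wsqrtr// exprMn.
  by rewrite sqr_sqrtr ?divr_ge0 ?ltW//; lra.
rewrite mulrC; apply: (@le_trans _ _ (3 * (s / 2 * Num.sqrt (s / 2) * `|uC2 U s i j k x|))).
  rewrite !mulrA ler_wpM2r//.
  rewrite [leRHS](_ : _ = s * (3 / 2 * Num.sqrt (s / 2))); last by field.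
  by rewrite ler_wpM2l// ltW.
lra.
Qed.
End small.
End solution.
End absorption.

(** * L^3 bounds of the derivatives of the solution *)

Section solution_l3.
Context (R : realType).
Notation V := 'rV[R]_3.
Variables (C c : R) (U0 : V -> V) (U : R -> V -> V) (p : R -> V -> R).
Hypothesis sol : described_solution C c U0 U p.
Variables (tau b : R).
Hypotheses (taub : tau < b) (bT : (b%:E <= lifespan C U0)%E).

Let inT s : 0 < s -> s <= tau -> (s%:E < lifespan C U0)%E.
Proof. by move=> s0 st; rewrite (lt_le_trans _ bT)// lte_fin (le_lt_trans st). Qed.

Variables (CG CH A D : R).
Hypotheses (CG0 : 0 < CG) (CH0 : 0 < CH) (A0 : 0 < A) (D0 : 0 <= D).
Hypotheses (hCG : gradient_estimate_l3 CG) (hCH : hessian_estimate_l3 CH).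
Hypothesis hA : forall s i, 0 < s -> s <= tau -> l3 (uC U s i) A.
Hypothesis hu1 : forall s i j x, 0 < s -> s <= tau -> `|uC1 U s i j x| <= 1 / s.
Hypothesis hu2 : forall s i j k x, 0 < s -> s <= tau ->
  `|uC2 U s i j k x| <= D / (s * Num.sqrt s).

(** On [t/2, t] the convection term has three summands, each a derivative bounded by 2/t times a
    component with L^3 bound [A]: hence 6 A / t. With t = 2 rho^2 the estimate gives 4 CG A / rho,
    and 1 / rho <= 2 / sqrt t. *)
Lemma gradient_l3 t i l : 0 < t -> t <= tau -> l3 (uC1 U t i l) (8 * CG * A / Num.sqrt t).
Proof.
move=> t0 tt; pose rho := Num.sqrt (t / 2).
have t20 : 0 < t / 2 by rewrite divr_gt0.
have r0 : 0 < rho by rewrite sqrtr_gt0.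
have rho2 : rho ^+ 2 = t / 2 by rewrite sqr_sqrtr// ltW.
(* The system is set up from t/4 on, because the estimate requires its initial time t/2 to be
   interior. *)
have S := sol_stokes sol (divr_gt0 t0 (ltr0n R 4)) bT.
have K0 : 0 < 6 * A / t by rewrite divr_gt0// mulr_gt0.
have t4 : t / 4 < t / 2 by lra.
have t2 : t / 2 < t by lra.
have t2tau : t / 2 <= tau by rewrite (le_trans _ tt)// ltW.
have lG r i' : t / 2 <= r <= t -> l3 (convC U r i') (6 * A / t).
  move=> /andP[h1 h2]; have r0' : 0 < r by exact: lt_le_trans h1.
  have rT := inT r0' (le_trans h2 tt).
  have h : l3 (convC U r i') (#|'I_3|%:R * (`|1 / r| * A)).
    apply: (@l3_sum _ _ _ (fun j x => (1 / r) * uC U r j x)) => [|j|x].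
    - exact: (reg_continuous (convC_reg sol r0' rT i')).
    - by apply: l3_scale; exact: (hA j r0' (le_trans h2 tt)).
    - rewrite /convC (le_trans (ler_norm_sum _ _ _))//; apply: ler_sum => j _.
      rewrite !normrM mulrC ler_wpM2r// -normrM [leRHS]ger0_norm.
        exact: (hu1 i' j x r0' (le_trans h2 tt)).
      by rewrite divr_ge0// ltW.
  apply: (l3_le h); rewrite card_ord; first by rewrite !mulr_ge0// ltW.
  rewrite (ger0_norm (divr_ge0 ler01 (ltW r0'))) mulrCA.
  rewrite [leRHS](_ : _ = (2 / t) * (3 * A)); last by ring.
  rewrite ler_wpM2r ?mulr_ge0 ?(ltW A0)// ler_pdivrMr// mulrAC ler_pdivlMr//; lra.
have h := hCG S t4 t2 (le_lt_trans tt taub) A0 K0 (fun i => hA i t0 tt)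
  (fun i => hA i t20 t2tau) lG i l.
apply: (l3_le h).
  apply: mulr_ge0; first exact: ltW.
  apply: addr_ge0; first by apply: divr_ge0; [exact: ltW|exact: sqrtr_ge0].
  by apply: mulr_ge0; [exact: ltW|exact: sqrtr_ge0].
have -> : t - t / 2 = t / 2 by field.
rewrite -/rho.
have tE : t = 2 * rho ^+ 2 by rewrite rho2; field.
have -> : CG * (A / rho + 6 * A / t * rho) = 4 * CG * A / rho.
  by rewrite tE; field; rewrite gt_eqF.
have h1 : 0 <= 4 * CG * A by rewrite !mulr_ge0// ltW.
have -> : 8 * CG * A / Num.sqrt t = (4 * CG * A) * (2 / Num.sqrt t) by ring.
rewrite ler_wpM2l// ler_pdivlMr ?sqrtr_gt0// mulrC ler_pdivrMr//.
rewrite -[leRHS]ger0_norm ?mulr_ge0 ?(ltW r0)// -sqrtr_sqr ler_wsqrtr// exprMn rho2.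
lra.
Qed.

(** In the derivative of the convection term, one gradient factor is bounded in the sup norm against
    the other in L^3, and D^2 U in the sup norm against U in L^3. [A'] bounds each of the six
    summands; since 1 / rho^2 = 2 / t, the constant is 2 (8 CG + 6 (8 CG + D)) = 112 CG + 12 D. *)
Lemma hessian_l3 t i j k : 0 < t -> t <= tau ->
  l3 (uC2 U t i j k) (CH * (112 * CG + 12 * D) * A / t).
Proof.
move=> t0 tt; pose rho := Num.sqrt (t / 2).
have t20 : 0 < t / 2 by rewrite divr_gt0.
have r0 : 0 < rho by rewrite sqrtr_gt0.
have rho2 : rho ^+ 2 = t / 2 by rewrite sqr_sqrtr// ltW.
have S := sol_stokes sol (divr_gt0 t0 (ltr0n R 4)) bT.
pose A' := (8 * CG + D) * A / rho ^+ 3.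
have rho30 : 0 < rho ^+ 3 by exact: exprn_gt0.
have CGD : 0 < 8 * CG + D by rewrite ltr_pwDl// mulr_gt0.
have A'0 : 0 < A' by rewrite divr_gt0// mulr_gt0.
have K0 : 0 < 6 * A' by rewrite mulr_gt0.
have A10 : 0 < 8 * CG * A / rho by rewrite divr_gt0// !mulr_gt0.
have t4 : t / 4 < t / 2 by lra.
have t2 : t / 2 < t by lra.
have t2tau : t / 2 <= tau by rewrite (le_trans _ tt)// ltW.
have sq r : t / 2 <= r -> rho <= Num.sqrt r by move=> h; exact: ler_wsqrtr.
have l1 r i' j' : t / 2 <= r -> r <= t -> l3 (uC1 U r i' j') (8 * CG * A / rho).
  move=> h1 h2; have r0' : 0 < r by exact: lt_le_trans h1.
  apply: (l3_le (gradient_l3 i' j' r0' (le_trans h2 tt))).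
    by rewrite divr_ge0 ?sqrtr_ge0// !mulr_ge0// ltW.
  by rewrite ler_wpM2l ?mulr_ge0 ?(ltW CG0) ?(ltW A0)// lef_pV2 ?posrE ?sqrtr_gt0// sq.
have lG r i' : t / 2 <= r <= t -> [/\ reg (convC1 U r k i'),
    uderiv k (convC U r i') (convC1 U r k i') & l3 (convC1 U r k i') (6 * A')].
  move=> /andP[h1 h2]; have r0' : 0 < r by exact: lt_le_trans h1.
  have rtau := le_trans h2 tt; have rT := inT r0' rtau.
  have rc := convC1_reg sol r0' rT k i'.
  split=> //; first exact: (convC_uderiv sol r0' rT).
  have ir : 1 / r <= (rho ^+ 2)^-1.
    by rewrite rho2 div1r lef_pV2 ?posrE.
  have ir0 : 0 <= 1 / r by rewrite divr_ge0// ltW.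
  have ds : D / (r * Num.sqrt r) <= D / rho ^+ 3.
    rewrite ler_wpM2l// lef_pV2 ?posrE ?mulr_gt0 ?sqrtr_gt0//.
    by rewrite exprSr rho2; apply: ler_pM => //; [exact: ltW|exact: ltW|exact: sq].
  have ds0 : 0 <= D / (r * Num.sqrt r) by rewrite divr_ge0// mulr_ge0 ?sqrtr_ge0// ltW.
  have h : l3 (convC1 U r k i') (#|{: 'I_3 + 'I_3}|%:R * A').
    apply: (@l3_sum _ _ _ (fun q x => match q with
      | inl j' => (1 / r) * uC1 U r j' k x
      | inr j' => (D / (r * Num.sqrt r)) * uC U r j' x end)) => [|[j'|j']|x].
    - exact: reg_continuous.
    - apply: (l3_le (l3_scale (1 / r) (l1 r j' k h1 h2))).
        by rewrite mulr_ge0// ltW.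
      rewrite ger0_norm//; apply: (@le_trans _ _ ((rho ^+ 2)^-1 * (8 * CG * A / rho))).
        by rewrite ler_wpM2r// ltW.
      rewrite /A' [leLHS](_ : _ = (8 * CG) * A / rho ^+ 3); last by field; rewrite gt_eqF.
      by rewrite ler_wpM2r ?invr_ge0 ?(ltW rho30)// ler_wpM2r ?(ltW A0)// lerDl.
    - apply: (l3_le (l3_scale (D / (r * Num.sqrt r)) (hA j' r0' rtau))).
        by rewrite mulr_ge0// ltW.
      rewrite ger0_norm//; apply: (@le_trans _ _ (D / rho ^+ 3 * A)).
        by rewrite ler_wpM2r// ltW.
      rewrite /A' mulrAC ler_wpM2r ?invr_ge0 ?(ltW rho30)// ler_wpM2r ?(ltW A0)// lerDr.
      by rewrite mulr_ge0// ltW.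
    - rewrite big_sumType/= -big_split/= /convC1 (le_trans (ler_norm_sum _ _ _))//.
      apply: ler_sum => j' _; rewrite (le_trans (ler_normD _ _))// !normrM lerD//.
        rewrite mulrC ler_wpM2r// -normrM (ger0_norm ir0); exact: hu1.
      rewrite mulrC ler_wpM2r// -!normrM.
      have -> : D * (r * Num.sqrt r)^-1 = D / (r * Num.sqrt r) by [].
      by rewrite (ger0_norm ds0); exact: hu2.
  by move: h; rewrite card_sum card_ord.
have tT := inT t0 tt.
have h := hCH S t4 t2 (le_lt_trans tt taub) A10 K0
  (fun i => l1 t i k (ltW t2) (lexx _)) (fun i => l1 (t / 2) i k (lexx _) (ltW t2)) lG
  (uC2_reg sol t0 tT i j k) (uC1_uderiv sol t0 tT i j k).
apply: (l3_le h).
  apply: mulr_ge0; first exact: ltW.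
  apply: addr_ge0; first by apply: divr_ge0; [exact: ltW|exact: sqrtr_ge0].
  by apply: mulr_ge0; [exact: ltW|exact: sqrtr_ge0].
have -> : t - t / 2 = t / 2 by field.
rewrite -/rho.
have tE : t = 2 * rho ^+ 2 by rewrite rho2; field.
rewrite le_eqVlt; apply/orP; left; apply/eqP.
by rewrite /A' tE; field; rewrite gt_eqF.
Qed.
End solution_l3.

(** * Lebesgue norms *)

Section Lp_norms.
Context (R : realType).
Notation V := 'rV[R]_3.
Notation M := (measurableTypeR R).
Notation T3 := (M * M * M)%type.
Implicit Types (f g h : V -> R) (A B : R).

(** Cubes are products of intervals, so their measure is explicit; they stand in for balls in lower
    and upper bounds of measures. *)
Definition box3 (x : V) (r : R) : set T3 := [set z | `|row3 z - x| <= r].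

Let side (x : V) r (i : 'I_3) : set M := `[x 0 i - r, x 0 i + r]%classic.

Let box3E x r : 0 <= r -> box3 x r =
  (side x r 0 `*` side x r 1) `*` side x r (inord 2).
Proof.
move=> r0; have ii y i : side x r i y <-> `|y - x 0 i| <= r.
  by rewrite /side/= in_itv/= ler_norml; split=> /andP[a b]; apply/andP; split; lra.
have i2 (z : T3) : z.2 = row3 z 0 (inord 2) by rewrite mxE inordK.
have i1 (z : T3) : z.1.2 = row3 z 0 1 by rewrite mxE.
have i0 (z : T3) : z.1.1 = row3 z 0 0 by rewrite mxE.
apply/seteqP; split=> z /=.
  move=> h; have {}h i : side x r i (row3 z 0 i).
    by apply/ii; apply: le_trans h; have := rV_norm_le (row3 z - x) i; rewrite !mxE.
  by rewrite i0 i1 i2; split=> //; split.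
rewrite i0 i1 i2 => -[[/ii h0 /ii h1] /ii h2]; apply: rV_norm_leP => // i.
have [->|n0] := eqVneq i 0; first by move: h0; rewrite !mxE.
have [->|n1] := eqVneq i 1; first by move: h1; rewrite !mxE.
have -> : i = inord 2 by apply/val_inj; rewrite /= inordK//; case: i n0 n1 => -[|[|[|]]].
by move: h2; rewrite !mxE.
Qed.

Let mside x r i : measurable (side x r i). Proof. exact: measurable_itv. Qed.

Lemma measurable_box3 x r : 0 <= r -> measurable (box3 x r).
Proof. by move=> r0; rewrite box3E//; do 2?apply: measurableX. Qed.

Lemma leb3_box3 x r : 0 < r -> leb3 R (box3 x r) = ((2 * r) ^+ 3)%:E.
Proof.
move=> r0; rewrite box3E ?(ltW r0)//.
have muI i : (lebesgue_measure (side x r i) = (2 * r)%:E)%E.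
  rewrite lebesgue_measure_itv/= lte_fin ifT; last by lra.
  by rewrite -EFinB; congr (_%:E); ring.
transitivity ((@lebesgue_measure R \x @lebesgue_measure R) (side x r 0%R `*` side x r 1%R) *
    lebesgue_measure (side x r (inord 2)))%E.
  by apply: product_measure1E; first exact: measurableX.
have -> : ((@lebesgue_measure R \x @lebesgue_measure R) (side x r 0%R `*` side x r 1%R) =
    lebesgue_measure (side x r 0%R) * lebesgue_measure (side x r 1%R))%E.
  by apply: product_measure1E.
by rewrite !muI -!EFinM; congr (_%:E); ring.
Qed.

Lemma leb3_ball_gt0 (x : V) (r : R) (N : set T3) : 0 < r -> measurable N ->
  (forall z : T3, `|row3 z - x| < r -> N z) -> (0 < leb3 R N)%E.
Proof.
move=> r0 mN h; have r20 : 0 < r / 2 by rewrite divr_gt0.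
apply: (@lt_le_trans _ _ (leb3 R (box3 x (r / 2)))).
  by rewrite leb3_box3// lte_fin exprn_gt0// mulr_gt0.
apply: le_measure; rewrite ?inE//; first by apply: measurable_box3; exact: ltW.
by move=> z hz; apply: h; apply: (le_lt_trans hz); lra.
Qed.

(** The norm with exponent [+oo] unfolds to an essential supremum only for a nonzero measure. *)
Lemma leb3_setT_gt0 : (0 < leb3 R setT)%E.
Proof. exact: (leb3_ball_gt0 (x := 0) ltr01). Qed.

Lemma Lp_infty_le f B : (forall x, `|f x| <= B) -> (Lp +oo f <= B%:E)%E.
Proof.
move=> h; rewrite /Lp unlock /= leb3_setT_gt0.
by apply/ess_sup_inf.ess_supP; apply: nearW => z /=; rewrite lee_fin.
Qed.

(** By continuity an excess at one point persists on a ball around it, and balls have positive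
    measure. *)
Lemma le_Lp_infty f B : continuous f -> (Lp +oo f <= B%:E)%E -> forall x, `|f x| <= B.
Proof.
move=> cf; rewrite /Lp unlock /= leb3_setT_gt0 => /ess_sup_inf.ess_supP[N [mN N0 hN]] x.
rewrite leNgt; apply/negP => Bf.
have : \forall y \near x, B < `|f y|.
  apply: (@cvgr_gt _ _ (nbhs x) _ (fun y => `|f y|) (`|f x|)) => //.
  by apply: cvg_norm; exact: cf.
move=> /nbhs_ballP[r r0 hr].
suff : (0 < leb3 R N)%E by rewrite N0 ltxx.
apply: (@leb3_ball_gt0 x r) => // z hz; apply: hN => /=; apply/negP.
rewrite lee_fin -ltNge; apply: hr; split=> // i j.
rewrite ord1 /ball/=; apply: le_lt_trans hz; rewrite distrC.
by have := rV_norm_le (row3 z - x) j; rewrite !mxE.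
Qed.

Lemma Lp3_l3 f A : continuous f -> 0 <= A -> (Lp 3%:E f <= A%:E)%E -> l3 f A.
Proof.
move=> cf A0 h.
have E : (\int[leb3 R]_z (`|f (row3 z)| ^+ 3)%:E <= (A ^+ 3)%:E)%E.
  have := @poweR_Lnorm _ _ _ (leb3 R) (fun z => (f (row3 z))%:E) 3 (lt0r_neq0 (ltr0n _ 3)).
  rewrite (eq_integral (fun z => (`|f (row3 z)| ^+ 3)%:E)); last first.
    by move=> z _; rewrite abse_EFin poweR_EFin powR_mulrn.
  move=> <-; rewrite -(powR_mulrn 3 A0) -poweR_EFin.
  by apply: gt0_ler_poweR => //; rewrite in_itv/= leey andbT ?Lnorm_ge0// lee_fin.
have m := continuous_measurable3 (continuous_norm3 cf).
have ok : integrable3 (fun v => `|f v| ^+ 3).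
  apply/integrableP; split; first exact/measurable_EFinP.
  apply: le_lt_trans (ltry (A ^+ 3)); apply: le_trans E.
  by rewrite le_eqVlt; apply/orP; left; apply/eqP; apply: eq_integral => z _; rewrite /= ger0_norm.
split=> //; rewrite /int3 /Rintegral -lee_fin fineK//; exact: integrable_fin_num.
Qed.

(** Pointwise, |f|^q <= B^(q-3) |f|^3. *)
Lemma Lp_interpolation f A B q : continuous f -> 0 <= B -> 3 < q ->
  l3 f A -> (forall x, `|f x| <= B) ->
  (Lp q%:E f <= ((B `^ (q - 3) * A ^+ 3) `^ q^-1)%:E)%E.
Proof.
move=> cf B0 q3 [okf iA] hB; rewrite /Lp unlock -poweR_EFin.
have q0 : 0 < q by apply: lt_trans q3.
have I0 : (0 <= \int[leb3 R]_z `|(f (row3 z))%:E| `^ q)%E.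
  by apply: integral_ge0 => z _; exact: poweR_ge0.
have ok := integrable3Z (B `^ (q - 3)) okf.
have le : (\int[leb3 R]_z `|(f (row3 z))%:E| `^ q <= (B `^ (q - 3) * A ^+ 3)%:E)%E.
  apply: (@le_trans _ _ (\int[leb3 R]_z (B `^ (q - 3) * `|f (row3 z)| ^+ 3)%:E)%E).
    apply: ge0_le_integral => //.
    - by move=> z _; exact: poweR_ge0.
    - under eq_fun do rewrite abse_EFin poweR_EFin; apply/measurable_EFinP.
      apply: (@measurableT_comp _ _ _ _ _ _ (fun y : R => y `^ q) _
        (fun z => `|f (row3 z)|)); first exact: measurable_powR.
      apply: (@continuous_measurable3 _ (fun x => `|f x|)) => x.
      by apply: (@continuous_comp _ _ _ f (fun y : R => `|y|)); [exact: cf|exact: norm_continuous].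
    - exact: (measurable_int _ ok).
    - move=> z _; rewrite abse_EFin poweR_EFin lee_fin.
      set y := `|_|; have y0 : 0 <= y by exact: normr_ge0.
      have -> : y `^ q = y `^ (q - 3) * y ^+ 3.
        rewrite -powR_mulrn// -powRD ?subrK//.
        by rewrite gt_eqF//= ?lt0r.
      rewrite ler_wpM2r ?exprn_ge0//; apply: ge0_ler_powR; rewrite ?nnegrE//.
        by rewrite subr_ge0 ltW.
      exact: hB.
  have := int3Z (B `^ (q - 3)) okf; rewrite /int3 /Rintegral => e.
  rewrite -(fineK (integrable_fin_num measurableT ok)) e lee_fin.
  by rewrite ler_wpM2l// powR_ge0.
apply: gt0_ler_poweR => //; rewrite ?in_itv/= ?leey ?andbT//.
- by rewrite invr_ge0 ltW.
- exact: le_trans I0 le.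
Qed.

Lemma ereal_littleoP (N : R -> \bar R) (g : R -> R) :
  (forall t, 0 <= N t)%E -> (forall t, 0 <= g t) ->
  (forall e, 0 < e -> exists2 tau, 0 < tau & forall t, 0 < t -> t <= tau ->
     (N t <= (e * g t)%:E)%E) -> ereal_littleo N g.
Proof.
move=> N0 g0 h; have near_tau tau (P : R -> Prop) : 0 < tau ->
    (forall t, 0 < t -> t <= tau -> P t) -> \forall t \near 0^'+, P t.
  move=> tau0 hP; near=> t; apply: hP; near: t; first exact: nbhs_right_gt.
  exact: nbhs_right_le.
have fin t (B : R) : (N t <= B%:E)%E -> N t \is a fin_num.
  by move=> NB; rewrite fin_numE -ltNye -ltey (lt_le_trans _ (N0 t))//= (le_lt_trans NB)// ltry.
split.
  have [tau tau0 ht] := h 1 ltr01; apply: (near_tau tau) => // t t0 tt.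
  exact: fin (ht t t0 tt).
apply/eqoP => e e0; have [tau tau0 ht] := h e e0.
apply: (near_tau tau) => // t t0 tt; have Ne := ht t t0 tt.
rewrite (ger0_norm (g0 t)) ger0_norm ?fine_ge0//.
by rewrite -lee_fin fineK//; exact: fin Ne.
Unshelve. all: by end_near. Qed.

Lemma Lp_littleo (f : R -> V -> R) A be q : 3 < q -> 0 < A ->
  (exists2 tau, 0 < tau & forall t, 0 < t -> t <= tau ->
     continuous (f t) /\ l3 (f t) (A * t `^ be)) ->
  (forall e, 0 < e -> exists2 tau, 0 < tau & forall t, 0 < t -> t <= tau ->
     forall x, `|f t x| <= e * t `^ (be - 1 / 2)) ->
  ereal_littleo (fun t => Lp q%:E (f t)) (fun t => t `^ (be - (q - 3) / (2 * q))).
Proof.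
move=> q3 A0 [t1 t10 h1] h2.
have q0 : 0 < q by apply: lt_trans q3.
have q30 : 0 < q - 3 by rewrite subr_gt0.
apply: ereal_littleoP => [t|t|e e0]; [exact: Lnorm_ge0|exact: powR_ge0|].
(* [d] solves d^(q-3) A^3 = e^q, so the interpolated bound is exactly [e] times a power of t; its
   exponent is ((be - 1/2) (q - 3) + 3 be) / q = be - (q - 3) / (2 q). *)
pose d := (e `^ q / A ^+ 3) `^ (q - 3)^-1.
have d0 : 0 < d by rewrite powR_gt0// divr_gt0 ?exprn_gt0// powR_gt0.
have [t2 t20 ht2] := h2 d d0.
exists (Num.min t1 t2); first by rewrite lt_min t10.
move=> t t0; rewrite le_min => /andP[tt1 tt2].
have [cf lf] := h1 t t0 tt1.
have dt0 : 0 <= d * t `^ (be - 1 / 2) by rewrite mulr_ge0 ?(ltW d0)// powR_ge0.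
apply: (le_trans (Lp_interpolation cf dt0 q3 lf (ht2 t t0 tt2))).
rewrite lee_fin le_eqVlt; apply/orP; left; apply/eqP.
have tn0 : t != 0 by rewrite gt_eqF.
have -> : (d * t `^ (be - 1 / 2)) `^ (q - 3) = (e `^ q / A ^+ 3) * t `^ ((be - 1 / 2) * (q - 3)).
  rewrite powRM ?(ltW d0) ?powR_ge0// -!powRrM mulVf ?gt_eqF// powRr1//.
  by rewrite divr_ge0 ?powR_ge0// exprn_ge0// ltW.
rewrite exprMn -(powR_mulrn 3 (powR_ge0 t be)) -(powRrM t).
rewrite (_ : _ * _ = e `^ q * t `^ ((be - 1 / 2) * (q - 3) + be * 3)); last first.
  rewrite powRD; last by rewrite tn0 implybT.
  by field; rewrite gt_eqF.
rewrite powRM ?powR_ge0// -!powRrM mulfV ?gt_eqF// powRr1 ?(ltW e0)//.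
by congr (_ * _ `^ _); field; rewrite gt_eqF.
Qed.
End Lp_norms.

Section norms.
Context (R : realType).
Notation V := 'rV[R]_3.
Implicit Types (f g h : V -> R) (A B : R).

Lemma sqrt_sum_sqr_le (I : finType) (x : I -> R) :
  Num.sqrt (\sum_i x i ^+ 2) <= \sum_i `|x i|.
Proof.
have S0 : 0 <= \sum_i `|x i| by exact: sumr_ge0.
rewrite -[leRHS]ger0_norm// -sqrtr_sqr ler_wsqrtr// [leRHS]expr2 mulr_suml.
apply: ler_sum => i _; rewrite -real_normK ?num_real// expr2 ler_wpM2l//.
by rewrite (bigD1 i)//= lerDl sumr_ge0.
Qed.

Lemma enorm_pair m n (A : 'M[R]_(m, n)) :
  enorm A = Num.sqrt (\sum_(q : 'I_m * 'I_n) A q.1 q.2 ^+ 2).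
Proof. by rewrite /enorm pair_big. Qed.

Lemma le_enorm m n (A : 'M[R]_(m, n)) i j : `|A i j| <= enorm A.
Proof.
rewrite enorm_pair -sqrtr_sqr ler_wsqrtr// (bigD1 (i, j))//= lerDl.
by apply: sumr_ge0 => q _; exact: sqr_ge0.
Qed.

Lemma enorm_ge0 m n (A : 'M[R]_(m, n)) : 0 <= enorm A.
Proof. exact: sqrtr_ge0. Qed.

Lemma enorm_le m n (A : 'M[R]_(m, n)) : enorm A <= \sum_i \sum_j `|A i j|.
Proof. by rewrite enorm_pair (le_trans (sqrt_sum_sqr_le _))// pair_big. Qed.

Lemma continuous_sqrt_sum m n (F : 'I_m -> 'I_n -> V -> R) :
  (forall i j, continuous (F i j)) ->
  continuous (fun x => Num.sqrt (\sum_i \sum_j F i j x ^+ 2)).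
Proof.
move=> cF x; apply: (@continuous_comp _ _ _ (fun x => \sum_i \sum_j F i j x ^+ 2) Num.sqrt);
  last exact: sqrt_continuous.
apply: continuous_sum => i; apply: continuous_sum => j y.
apply: (@continuous_comp _ _ _ (F i j) (fun z : R => z ^+ 2)); first exact: cF.
exact: exprn_continuous.
Qed.

Lemma near0_right (P : R -> Prop) : (\forall t \near 0^'+, P t) ->
  exists2 tau : R, 0 < tau & forall t, 0 < t -> t <= tau -> P t.
Proof.
move=> /nbhs_ballP[r r0 h]; exists (r / 2); first by rewrite divr_gt0.
move=> t t0 tr; apply: h => //=; rewrite /ball/= sub0r normrN gtr0_norm//.
by apply: (le_lt_trans tr); rewrite ltr_pdivrMr// ltr_pMr// ltr1n.
Qed.

Lemma right0_near (tau : R) (P : R -> Prop) : 0 < tau ->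
  (forall t, 0 < t -> t <= tau -> P t) -> \forall t \near 0^'+, P t.
Proof.
move=> tau0 hP; near=> t; apply: hP; near: t; first exact: nbhs_right_gt.
exact: nbhs_right_le.
Unshelve. all: by end_near. Qed.

Lemma ereal_cvg0P (N : R -> \bar R) : (forall t, 0 < t -> (0 <= N t)%E) ->
  N t @[t --> 0^'+] --> 0%E <->
  forall e, 0 < e -> exists2 tau, 0 < tau & forall t, 0 < t -> t <= tau -> (N t <= e%:E)%E.
Proof.
move=> N0; split=> [/fine_cvgP[fin cv] e e0|h].
  apply: near0_right; move/cvgrPdist_le : cv => /(_ e e0) cv.
  near=> t; have Nfin : N t \is a fin_num by near: t.
  rewrite -(fineK Nfin) lee_fin; apply: le_trans (ler_norm _) _.
  have : `|0 - fine (N t)| <= e by near: t.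
  by rewrite sub0r normrN.
have fin t (B : R) : 0 < t -> (N t <= B%:E)%E -> N t \is a fin_num.
  by move=> t0 NB; rewrite fin_numE -ltNye -ltey (lt_le_trans _ (N0 t t0))//=
    (le_lt_trans NB)// ltry.
apply/fine_cvgP; split.
  have [tau tau0 ht] := h 1 ltr01; apply: (right0_near tau0) => t t0 tt.
  exact: fin (ht t t0 tt).
apply/cvgrPdist_le => e e0; have [tau tau0 ht] := h e e0.
apply: (right0_near tau0) => t t0 tt; have Ne := ht t t0 tt.
rewrite sub0r normrN ger0_norm; last by rewrite fine_ge0// N0.
by rewrite -lee_fin fineK//; exact: fin Ne.
Unshelve. all: by end_near. Qed.

Lemma Lp_littleo_sum (I : finType) (f : R -> V -> R) (g : I -> R -> V -> R) A be q :
  3 < q -> 0 < A ->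
  (exists2 tau, 0 < tau & forall t, 0 < t -> t <= tau ->
     [/\ continuous (f t), forall x, `|f t x| <= \sum_i `|g i t x|
       & forall i, l3 (g i t) (A * t `^ be)]) ->
  (forall e, 0 < e -> exists2 tau, 0 < tau & forall t, 0 < t -> t <= tau ->
     forall i x, `|g i t x| <= e * t `^ (be - 1 / 2)) ->
  ereal_littleo (fun t => Lp q%:E (f t)) (fun t => t `^ (be - (q - 3) / (2 * q))).
Proof.
(* The successor keeps [n] positive for an empty index type. *)
move=> q3 A0 [t1 t10 h1] h2; pose n : R := #|I|.+1%:R; have n0 : 0 < n by rewrite ltr0n.
have In : #|I|%:R <= n by rewrite ler_nat.
apply: (Lp_littleo (A := n * A)) => //; first exact: mulr_gt0.
  exists t1 => // t t0 tt; have [cf fg lg] := h1 t t0 tt; split=> //.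
  have P0 : 0 <= A * t `^ be by rewrite mulr_ge0 ?(ltW A0)// powR_ge0.
  apply: (l3_le (l3_sum cf lg fg)); first by rewrite mulr_ge0.
  by rewrite -mulrA ler_wpM2r.
move=> e e0; have [t2 t20 ht2] := h2 (e / n) (divr_gt0 e0 n0).
exists (Num.min t1 t2); first by rewrite lt_min t10.
move=> t t0; rewrite le_min => /andP[tt1 tt2] x; have [_ fg _] := h1 t t0 tt1.
apply: (le_trans (fg x)).
apply: (@le_trans _ _ (\sum_(i : I) (e / n * t `^ (be - 1 / 2)))).
  by apply: ler_sum => i _; exact: ht2.
rewrite sumr_const -[leLHS]mulr_natl mulrA ler_wpM2r ?powR_ge0//.
by rewrite mulrCA ler_piMr ?(ltW e0)// ler_pdivrMr// mul1r.
Qed.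
End norms.

(** * Positivity of the lifespan *)

Section lifespan_pos.
Context (R : realType).
Notation V := 'rV[R]_3.
Notation M := (measurableTypeR R).
Notation T3 := (M * M * M)%type.

Lemma measurable_enorm (w : T3 -> V) : (forall i, measurable_fun setT (fun z => w z 0 i)) ->
  measurable_fun setT (fun z => enorm (w z)).
Proof.
move=> mw; apply: (@measurableT_comp _ _ _ _ _ _ (@Num.sqrt R) _
  (fun z => \sum_i \sum_j w z i j ^+ 2)).
  by apply: continuous_measurable_fun; exact: sqrt_continuous.
apply: measurable_sum => i; apply: measurable_sum => j; rewrite ord1.
exact: measurable_funX.
Qed.

(** The norm is at most the sum of three coordinates, each at most a + b, and (a + b)^3 <= 4 (a^3 +
    b^3): hence 27 times 4. *)
Lemma enorm_cube_le (u v : V) :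
  enorm u ^+ 3 <= 108 * enorm (u - v) ^+ 3 + 108 * enorm v ^+ 3.
Proof.
set a := enorm (u - v); set b := enorm v.
have a0 : 0 <= a by exact: enorm_ge0.
have b0 : 0 <= b by exact: enorm_ge0.
have h : enorm u <= 3 * (a + b).
  apply: (le_trans (enorm_le u)); rewrite big_ord1.
  apply: (@le_trans _ _ (\sum_(j < 3) (a + b))).
    apply: ler_sum => j _; rewrite -(subrK (v 0 j) (u 0 j)) (le_trans (ler_normD _ _))// lerD//.
      by have := le_enorm (u - v) 0 j; rewrite !mxE.
    exact: le_enorm.
  by rewrite sumr_const card_ord -[leLHS]mulr_natl.
apply: (@le_trans _ _ ((3 * (a + b)) ^+ 3)).
  by rewrite lerXn2r ?nnegrE ?enorm_ge0// mulr_ge0// addr_ge0.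
rewrite -subr_ge0.
have -> : 108 * a ^+ 3 + 108 * b ^+ 3 - (3 * (a + b)) ^+ 3 = 81 * ((a + b) * (a - b) ^+ 2) by ring.
by apply: mulr_ge0 => //; apply: mulr_ge0; [exact: addr_ge0|exact: sqr_ge0].
Qed.

Lemma solenoidal_test_bounded (phi : V -> V) : solenoidal_test phi ->
  exists2 B : R, 0 < B & forall x, `|phi x| <= B.
Proof.
move=> [cphi cpt _]; have [cont _] := cphi 0%N.
have : compact (phi @` closure [set x | phi x != 0]).
  by apply: continuous_compact => //; exact: continuous_subspaceT.
move=> /compact_bounded[B0 [_ hB0]]; have hB := hB0 (`|B0| + 1) _; exists (`|B0| + 1).
  by rewrite ltr_wpDl.
move=> x; have [x0|x0] := eqVneq (phi x) 0; first by rewrite x0 normr0 addr_ge0.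
apply: hB; last by exists x => //; exact: subset_closure.
by rewrite (le_lt_trans (ler_norm _))// ltrDl.
Qed.

(** [U0] is compared with a test field: the remainder is small in L^3 over the whole space, and the
    bounded test field contributes little on small balls. Each part takes half of [d], which is why
    d = 2 (108 d1). *)
Lemma J3_cube_ball (U0 : V -> V) (d : R) : J3 U0 -> 0 < d -> exists2 r : R, 0 < r &
  forall x, (\int[leb3 R]_(z in [set z | enorm (row3 z - x) < r]%R)
                    (enorm (U0 (row3 z)) ^+ 3)%:E <= d%:E)%E.
Proof.
move=> [mU _ dense] d0.
have [d1 d10 dE] : exists2 d1 : R, 0 < d1 & d = 2 * (108 * d1).
  have h : 0 < 216^-1 :> R by rewrite invr_gt0 ltr0n.
  exists (d / 216); first exact: (mulr_gt0 d0 h).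
  by field.
pose e := d1 `^ 3^-1.
have e0 : 0 < e by rewrite powR_gt0.
have e3 : e ^+ 3 = d1.
  by rewrite -powR_mulrn ?powR_ge0// -powRrM mulVf// powRr1// ltW.
have [phi tphi small] := dense e e0.
have [B B0 hB] := solenoidal_test_bounded tphi.
have cphi : continuous phi by have [/(_ 0%N)[]] := tphi.
have mphi i : measurable_fun setT (fun z : T3 => phi (row3 z) 0 i).
  apply: (@continuous_measurable3 _ (fun x => phi x 0 i)) => x.
  apply: (@continuous_comp _ _ _ phi (fun y : V => y 0 i)); first exact: cphi.
  exact: continuous_coord.
pose K := 108 * (3 * B) ^+ 3.
have K0 : 0 < K by rewrite mulr_gt0// exprn_gt0// mulr_gt0.
(* For r <= 1 the cube around the ball has volume (2 r)^3 <= 8 r, and the second bound makes K (8 r)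
   at most d / 2. *)
pose r := Num.min 1 (d / (16 * K)).
have r0 : 0 < r by rewrite lt_min ltr01/= divr_gt0// mulr_gt0.
exists r => // x; set D := (X in integral _ X).
have mU0 : measurable_fun setT (fun z : T3 => enorm (U0 (row3 z)) ^+ 3).
  by apply: measurable_funX; exact: measurable_enorm.
have md : measurable_fun setT (fun z : T3 => enorm (U0 (row3 z) - phi (row3 z)) ^+ 3).
  apply: measurable_funX; apply: measurable_enorm => i.
  under eq_fun do rewrite !mxE; exact: measurable_funB.
have mD : measurable D.
  have := @measurable_enorm (fun z => row3 z - x).
  have H i : measurable_fun setT (fun z : T3 => (row3 z - x) 0 i).
    rewrite (_ : (fun z => _) = fun z : T3 => row3 z 0 i - x 0 i); last first.
      by apply/funext => z; rewrite !mxE.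
    apply: measurable_funB => //.
    by apply: (@continuous_measurable3 _ (fun y : V => y 0 i)); exact: continuous_coord.
  move=> /(_ H) mm; rewrite (_ : D = setT `&` (fun z => enorm (row3 z - x)) @^-1` `]-oo, r[%classic).
    by apply: mm => //; exact: measurable_itv.
  by rewrite setTI; apply/seteqP; split=> z /=; rewrite in_itv.
have bnd z : ((enorm (U0 (row3 z)) ^+ 3)%:E <=
   108%:E * (enorm (U0 (row3 z) - phi (row3 z)) ^+ 3)%:E + K%:E)%E.
  rewrite -EFinM -EFinD lee_fin (le_trans (enorm_cube_le _ (phi (row3 z))))// lerD2l ler_wpM2l//.
  rewrite lerXn2r ?nnegrE ?enorm_ge0//; first by rewrite mulr_ge0// ltW.
  rewrite (le_trans (enorm_le _))// big_ord1.
  apply: (@le_trans _ _ (\sum_(j < 3) B)).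
    by apply: ler_sum => j _; apply: le_trans (hB (row3 z)); exact: rV_norm_le.
  by rewrite sumr_const card_ord -[leLHS]mulr_natl.
have mde : measurable_fun setT (fun z : T3 => (enorm (U0 (row3 z) - phi (row3 z)) ^+ 3)%:E).
  exact/measurable_EFinP.
have d3 : (\int[leb3 R]_z (enorm (U0 (row3 z) - phi (row3 z)) ^+ 3)%:E <= d1%:E)%E.
  have := @poweR_Lnorm _ _ _ (leb3 R) (fun z => (enorm (U0 (row3 z) - phi (row3 z)))%:E) 3
    (lt0r_neq0 (ltr0n _ 3)).
  rewrite (eq_integral (fun z => (enorm (U0 (row3 z) - phi (row3 z)) ^+ 3)%:E)); last first.
    by move=> z _; rewrite abse_EFin poweR_EFin powR_mulrn// ger0_norm// enorm_ge0.
  move=> <-; rewrite -e3 -(powR_mulrn 3 (ltW e0)) -poweR_EFin.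
  apply: gt0_ler_poweR; rewrite ?in_itv/= ?leey ?andbT ?Lnorm_ge0//.
    by rewrite lee_fin ltW.
  exact: ltW.
have s1 : measurable_fun D (fun z : T3 => (enorm (U0 (row3 z)) ^+ 3)%:E).
  by apply/measurable_EFinP; apply: measurable_funS mU0.
have mdD : measurable_fun D (fun z : T3 => (enorm (U0 (row3 z) - phi (row3 z)) ^+ 3)%:E).
  exact: measurable_funS mde.
have md1 : measurable_fun D
   (fun z : T3 => (108%:E * (enorm (U0 (row3 z) - phi (row3 z)) ^+ 3)%:E)%E).
  exact: measurable_funeM.
apply: (le_trans (ge0_le_integral _ mD _ s1 _ (fun z _ => bnd z))).
- by move=> z _; rewrite lee_fin exprn_ge0// enorm_ge0.
- by apply: emeasurable_funD.
rewrite ge0_integralD//; [|by move=> z _; rewrite -EFinM lee_fin mulr_ge0// exprn_ge0// enorm_ge0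
  |by move=> z _; rewrite lee_fin ltW].
rewrite ge0_integralZl//; last by move=> z _; rewrite lee_fin exprn_ge0// enorm_ge0.
rewrite (integral_cst _ mD).
have D2 : (leb3 R D <= ((2 * r) ^+ 3)%:E)%E.
  rewrite -(leb3_box3 x r0); apply: le_measure; rewrite ?inE//.
    by apply: measurable_box3; exact: ltW.
  move=> z /= hz; apply: rV_norm_leP; first exact: ltW.
  by move=> i; rewrite (le_trans (le_enorm _ 0 i))// ltW.
have I1 : (\int[leb3 R]_(z in D) (enorm (U0 (row3 z) - phi (row3 z)) ^+ 3)%:E <= d1%:E)%E.
  apply: le_trans d3; apply: ge0_subset_integral => // z _.
  by rewrite lee_fin exprn_ge0// enorm_ge0.
apply: (@le_trans _ _ (108%:E * d1%:E + K%:E * ((2 * r) ^+ 3)%:E)%E).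
  by apply: leeD; apply: lee_wpmul2l => //; rewrite lee_fin ltW.
rewrite -!EFinM -EFinD lee_fin.
have r1 : r <= 1 by rewrite ge_min lexx.
have r2 : K * (16 * r) <= d.
  have h : r <= d / (16 * K) by rewrite ge_min lexx orbT.
  by move: h; rewrite ler_pdivlMr ?mulr_gt0//; apply: le_trans; rewrite le_eqVlt; apply/orP; left;
    apply/eqP; ring.
have r3 : (2 * r) ^+ 3 <= 8 * r.
  have -> : (2 * r) ^+ 3 = (8 * r) * r ^+ 2 by ring.
  by rewrite ler_piMr ?mulr_ge0 ?(ltW r0)// exprn_ile1// ltW.
have : K * (2 * r) ^+ 3 <= K * (8 * r) by rewrite ler_wpM2l// ltW.
have -> : K * (8 * r) = (K * (16 * r)) / 2 by field.
lra.
Qed.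

(** The regularity and the equation are asserted only at times below the lifespan, so its positivity
    is what gives them content near 0. Half of the threshold 1/(4C) is used for the local norm and
    half for the term with the global norm. *)
Lemma lifespan_lower_bound (C : R) (U0 : V -> V) : 0 < C -> J3 U0 ->
  exists2 b : R, 0 < b & (b%:E <= lifespan C U0)%E.
Proof.
move=> C0 J; pose h : R := (1 / (4 * C)) / 2.
have h0 : 0 < h by rewrite !divr_gt0// mulr_gt0.
have hE : 1 / (4 * C) = h + h by rewrite /h -mulrDr; field; rewrite gt_eqF.
have [r r0 hr] := J3_cube_ball J (exprn_gt0 3 h0).
have loc : (uloc3 U0 r <= h%:E)%E.
  have -> : h = (h ^+ 3) `^ 3^-1 by rewrite -powR_mulrn ?(ltW h0)// -powRrM mulfV// powRr1// ltW.
  rewrite -poweR_EFin /uloc3; set S := ereal_sup _.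
  have Sle : (S <= (h ^+ 3)%:E)%E by apply/ereal_supP => _ [x _ <-]; exact: hr.
  have S0 : (0 <= S)%E.
    apply: le_ereal_sup_tmp; eexists; first by exists 0.
    by apply: integral_ge0 => z _; rewrite lee_fin exprn_ge0// enorm_ge0.
  apply: gt0_ler_poweR => //; rewrite ?in_itv/= ?leey ?andbT//.
  by rewrite lee_fin exprn_ge0// ltW.
have [_ Nlt _] := J; have N0 : (0 <= vLp 3%:E U0)%E by exact: Lnorm_ge0.
have [N N0' NE] : exists2 N : R, 0 <= N & vLp 3%:E U0 = N%:E.
  by exists (fine (vLp 3%:E U0)); [exact: fine_ge0|rewrite fineK// ge0_fin_numE].
pose s := Num.min 1 (h / (10 * (N + 1))).
have N1 : 0 < N + 1 by rewrite ltr_wpDl.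
have s0 : 0 < s by rewrite lt_min ltr01/= divr_gt0// mulr_gt0.
have s1 : s <= 1 by rewrite ge_min lexx.
have sN : 10 * s * (N + 1) <= h.
  have : s <= h / (10 * (N + 1)) by rewrite ge_min lexx orbT.
  by rewrite ler_pdivlMr ?mulr_gt0//; apply: le_trans; rewrite le_eqVlt; apply/orP; left;
    apply/eqP; ring.
(* With this [t] one has sqrt t / r = s and r^2 / (8 t) = 1 / (8 s^2). Since exp(-1/y) <= y, the
   exponential is at most 8 s^2 <= 8 s, so the second term is at most 9 s N, below [h] by the choice
   of [s]. *)
pose t := (s * r) ^+ 2.
have t0 : 0 < t by rewrite exprn_gt0// mulr_gt0.
exists t => //.
apply: (@le_trans _ _ (lifespan_at C U0 r)); last by apply: ereal_sup_ubound; exists r.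
rewrite /lifespan_at le_max; apply/orP; right; apply: ereal_sup_ubound; exists t => //.
split=> //; rewrite NE -EFinM.
apply: (@le_lt_trans _ _ (h%:E + ((expR (- (r ^+ 2 / (8 * t))) + Num.sqrt t / r) * N)%:E)%E).
  exact: leeD2r.
rewrite -EFinD lte_fin hE ltrD2l.
have -> : Num.sqrt t / r = s.
  by rewrite /t sqrtr_sqr gtr0_norm ?mulr_gt0// mulfK// gt_eqF.
have ex : expR (- (r ^+ 2 / (8 * t))) <= 8 * s.
  have -> : r ^+ 2 / (8 * t) = (8 * s ^+ 2)^-1 by rewrite /t; field; rewrite !gt_eqF.
  have y0 : 0 < 8 * s ^+ 2 by rewrite mulr_gt0// exprn_gt0.
  apply: (@le_trans _ _ (8 * s ^+ 2)).
    rewrite expRN -[leRHS]invrK lef_pV2 ?posrE ?expR_gt0 ?invr_gt0//.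
    by apply: le_trans (expR_ge1Dx _); rewrite lerDr.
  by rewrite ler_wpM2l// expr2 ler_piMr// ltW.
apply: (@le_lt_trans _ _ (9 * s * N)).
  by rewrite ler_wpM2r//; lra.
apply: lt_le_trans sN.
have -> : 10 * s * (N + 1) = 9 * s * N + (s * N + 10 * s) by ring.
by rewrite ltrDl ltr_wpDl ?mulr_ge0 ?(ltW s0)// mulr_gt0.
Qed.
End lifespan_pos.

(** * Decay as t tends to 0 *)

Section small_time.
Context (R : realType).
Notation V := 'rV[R]_3.
Variables (C c : R) (U0 : V -> V) (U : R -> V -> V) (p : R -> V -> R).
Hypotheses (C0 : 0 < C) (J : J3 U0) (sol : described_solution C c U0 U p).

Section fixed_time.
Variable t : R.
Hypotheses (t0 : 0 < t) (tT : (t%:E < lifespan C U0)%E).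

Lemma continuous_enorm_sol : continuous (fun x => enorm (U t x)).
Proof.
apply: continuous_sqrt_sum => i j; rewrite ord1.
exact: (reg_continuous (uC_reg sol t0 tT j)).
Qed.

Lemma continuous_grad_norm : continuous (grad_norm (U t)).
Proof.
apply: continuous_sqrt_sum => i j.
rewrite (_ : (fun x => _) = uC1 U t j i); last by apply/funext => x; rewrite mxE.
exact: (reg_continuous (uC1_reg sol t0 tT j i)).
Qed.

Lemma continuous_hess_norm : continuous (hess_norm (U t)).
Proof.
apply: continuous_sqrt_sum => i j; apply: continuous_sqrt_sum => k l; rewrite ord1.
exact: (reg_continuous (uC2_reg sol t0 tT l j i)).
Qed.

Lemma enorm_sol_le x : `|enorm (U t x)| <= \sum_i `|uC U t i x|.
Proof. by rewrite ger0_norm ?enorm_ge0// (le_trans (enorm_le _))// big_ord1. Qed.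

Lemma grad_norm_le x :
  `|grad_norm (U t) x| <= \sum_(q : 'I_3 * 'I_3) `|uC1 U t q.2 q.1 x|.
Proof.
rewrite ger0_norm ?enorm_ge0// (le_trans (enorm_le _))// pair_big/=.
by apply: ler_sum => q _; rewrite mxE.
Qed.

Lemma hess_norm_le x :
  `|hess_norm (U t) x| <= \sum_(q : 'I_3 * 'I_3 * 'I_3) `|uC2 U t q.2 q.1.2 q.1.1 x|.
Proof.
rewrite ger0_norm ?sqrtr_ge0// /hess_norm pair_big/= (le_trans (sqrt_sum_sqr_le _))//.
rewrite [leRHS](_ : _ = \sum_(q : 'I_3 * 'I_3) \sum_k `|uC2 U t k q.2 q.1 x|); last first.
  by rewrite pair_big.
apply: ler_sum => q _; rewrite ger0_norm ?enorm_ge0// (le_trans (enorm_le _))//.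
by rewrite big_ord1.
Qed.
End fixed_time.

Lemma sol_l3 : exists2 A, 0 < A & forall s i, 0 < s -> (s%:E < lifespan C U0)%E ->
  l3 (uC U s i) A.
Proof.
have [_ Nlt _] := J; have N0 : (0 <= vLp 3%:E U0)%E by exact: Lnorm_ge0.
have [N _ NE] : exists2 N : R, 0 <= N & vLp 3%:E U0 = N%:E.
  by exists (fine (vLp 3%:E U0)); [exact: fine_ge0|rewrite fineK// ge0_fin_numE].
(* The sign of [c] is not prescribed and the datum may vanish, while the L^3 estimates require a
   positive bound. *)
have A0 : 0 < `|c * N| + 1 by rewrite ltr_wpDl.
exists (`|c * N| + 1) => // s i s0 sT.
have h : l3 (fun x => enorm (U s x)) (`|c * N| + 1).
  apply: Lp3_l3; [exact: continuous_enorm_sol|exact: ltW|].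
  apply: (le_trans (ds_L3 sol (ltW s0) sT)); rewrite NE -EFinM lee_fin.
  by rewrite (le_trans (ler_norm _))// lerDl.
apply: (l3_dom _ h) => [|x]; first exact: (reg_continuous (uC_reg sol s0 sT i)).
by rewrite [leRHS]ger0_norm ?enorm_ge0//; exact: le_enorm.
Qed.

(** Continuity turns the limits of essential suprema in the description into pointwise bounds of
    components. *)
Lemma sol_small e : 0 < e -> exists2 tau : R, 0 < tau /\ (tau%:E < lifespan C U0)%E &
  (forall s i x, 0 < s -> s <= tau -> `|uC U s i x| <= e / Num.sqrt s) /\
  (forall s i j x, 0 < s -> s <= tau -> `|uC1 U s i j x| <= e / s).
Proof.
move=> e0; have [b b0 bT] := lifespan_lower_bound C0 J.
have pos1 (t : R) : 0 < t -> (0 <= (Num.sqrt t)%:E * vLp +oo (U t))%E.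
  by move=> _; rewrite mule_ge0 ?lee_fin ?sqrtr_ge0// Lnorm_ge0.
have pos2 (t : R) : 0 < t -> (0 <= t%:E * Lp +oo (grad_norm (U t)))%E.
  by move=> t0; rewrite mule_ge0 ?lee_fin ?(ltW t0)// Lnorm_ge0.
have [t1 t10 h1] := (ereal_cvg0P pos1).1 (ds_lim sol) e e0.
have [t2 t20 h2] := (ereal_cvg0P pos2).1 (ds_grad_lim sol) e e0.
pose tau := Num.min (b / 2) (Num.min t1 t2).
have tau0 : 0 < tau by rewrite !lt_min t10 t20 divr_gt0.
have taub : tau < b.
  by rewrite gt_min; apply/orP; left; rewrite ltr_pdivrMr// ltr_pMr// ltr1n.
have tauT : (tau%:E < lifespan C U0)%E by apply: lt_le_trans bT; rewrite lte_fin.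
have inT s : s <= tau -> (s%:E < lifespan C U0)%E.
  by move=> st; apply: le_lt_trans tauT; rewrite lee_fin.
exists tau => //; split=> [s i x s0 st|s i j x s0 st].
  have st1 : s <= t1 by apply: (le_trans st); rewrite !ge_min lexx !orbT.
  have ss0 : 0 < Num.sqrt s by rewrite sqrtr_gt0.
  have := h1 s s0 st1; rewrite muleC -lee_pdivlMr// -EFinM.
  move=> /(le_Lp_infty (continuous_enorm_sol s0 (inT s st))) /(_ x).
  by apply: le_trans; rewrite [leRHS]ger0_norm ?enorm_ge0//; exact: le_enorm.
have st2 : s <= t2 by apply: (le_trans st); rewrite !ge_min lexx !orbT.
have := h2 s s0 st2; rewrite muleC -lee_pdivlMr// -EFinM.
move=> /(le_Lp_infty (continuous_grad_norm s0 (inT s st))) /(_ x).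
apply: le_trans; rewrite [leRHS]ger0_norm ?enorm_ge0//.
by have := le_enorm (grad (U s) x) j i; rewrite mxE.
Qed.

Lemma powR_inv_sqrt (s : R) : 0 < s -> (Num.sqrt s)^-1 = s `^ (- (1 / 2)).
Proof. by move=> s0; rewrite powRN mul1r powR12_sqrt// ltW. Qed.

Lemma powR_invr (s : R) : 0 < s -> s^-1 = s `^ (- 1).
Proof. by move=> s0; rewrite powR_inv1// ltW. Qed.

Lemma powR_inv32 (s : R) : 0 < s -> (s * Num.sqrt s)^-1 = s `^ (- 1 - 1 / 2).
Proof.
move=> s0; rewrite powRD; last by rewrite (gt_eqF s0) implybT.
by rewrite invfM (powR_invr s0) (powR_inv_sqrt s0).
Qed.

Lemma sol_hessian_small e : 0 < e -> exists2 tau : R, 0 < tau /\ (tau%:E < lifespan C U0)%E &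
  forall s i j k x, 0 < s -> s <= tau -> `|uC2 U s i j k x| <= e / (s * Num.sqrt s).
Proof.
move=> e0; have [CH CH0 hCH] := stokes_hessian R.
(* The first two bounds on [d] are those required by the absorption; the third makes the resulting
   constant 72 CH d at most [e]. *)
pose d := Num.min 1 (Num.min (18 * CH)^-1 (e / (72 * CH))).
have CH18 : 0 < 18 * CH by rewrite mulr_gt0.
have CH72 : 0 < 72 * CH by rewrite mulr_gt0.
have d0 : 0 < d by rewrite !lt_min ltr01/= invr_gt0 CH18 divr_gt0.
have d1 : d <= 1 by rewrite ge_min lexx.
have dC : 18 * CH * d <= 1.
  rewrite mulrC -ler_pdivlMr// mul1r /d.
  by rewrite !ge_min lexx !orbT.
have de : 72 * CH * d <= e.
  by rewrite mulrC -ler_pdivlMr// /d !ge_min lexx !orbT.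
have [tau [tau0 tauT] [h1 h2]] := sol_small d0.
have [b b0 bT] := lifespan_lower_bound C0 J.
pose tau' := Num.min tau (b / 2).
have tau'b : tau' < b.
  by rewrite gt_min; apply/orP; right; rewrite ltr_pdivrMr// ltr_pMr// ltr1n.
have tau't : tau' <= tau by rewrite ge_min lexx.
exists tau'.
  split; first by rewrite lt_min tau0 divr_gt0.
  by apply: lt_le_trans bT; rewrite lte_fin.
move=> s i j k x s0 st.
have := hessian_decay sol tau'b bT CH0 hCH d0 d1 dC
  (fun s i x s0 st => h1 s i x s0 (le_trans st tau't))
  (fun s i j x s0 st => h2 s i j x s0 (le_trans st tau't)) i j k x s0 st.
move=> h; apply: (le_trans h); rewrite ler_wpM2r// invr_ge0 mulr_ge0 ?sqrtr_ge0//.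
exact: ltW.
Qed.

(** Only boundedness of t |grad U| and t^(3/2) |D^2 U| in the sup norm enters here, so both
    smallness results are used with e = 1. *)
Lemma sol_derivatives_l3 : exists A tau : R, [/\ 0 < A, 0 < tau, (tau%:E < lifespan C U0)%E &
  forall s, 0 < s -> s <= tau ->
  [/\ forall i, l3 (uC U s i) A, forall i j, l3 (uC1 U s i j) (A / Num.sqrt s)
    & forall i j k, l3 (uC2 U s i j k) (A / s)]].
Proof.
have [A0 A00 hA0] := sol_l3.
have [CG CG0 hCG] := stokes_gradient_l3 R.
have [CH CH0 hCH] := stokes_hessian_l3 R.
have [t1 [t10 t1T] [_ h1]] := sol_small ltr01.
have [t2 [t20 t2T] h2] := sol_hessian_small ltr01.
have [b b0 bT] := lifespan_lower_bound C0 J.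
pose tau := Num.min (b / 2) (Num.min t1 t2).
have tau0 : 0 < tau by rewrite !lt_min t10 t20 divr_gt0.
have taub : tau < b.
  by rewrite gt_min; apply/orP; left; rewrite ltr_pdivrMr// ltr_pMr// ltr1n.
have tauT : (tau%:E < lifespan C U0)%E by apply: lt_le_trans bT; rewrite lte_fin.
have inT s : s <= tau -> (s%:E < lifespan C U0)%E.
  by move=> st; apply: le_lt_trans tauT; rewrite lee_fin.
have st1 s : s <= tau -> s <= t1 by move=> /le_trans; apply; rewrite !ge_min lexx !orbT.
have st2 s : s <= tau -> s <= t2 by move=> /le_trans; apply; rewrite !ge_min lexx !orbT.
have hA s i : 0 < s -> s <= tau -> l3 (uC U s i) A0.
  by move=> s0 st; apply: hA0 => //; exact: inT.
have hu1 s i j x : 0 < s -> s <= tau -> `|uC1 U s i j x| <= 1 / s.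
  by move=> s0 st; apply: h1 => //; exact: st1.
have hu2 s i j k x : 0 < s -> s <= tau -> `|uC2 U s i j k x| <= 1 / (s * Num.sqrt s).
  by move=> s0 st; apply: h2 => //; exact: st2.
pose A1 := 8 * CG * A0; pose A2 := CH * (112 * CG + 12 * 1) * A0.
have A10 : 0 < A1 by exact: (mulr_gt0 (mulr_gt0 (ltr0n R 8) CG0) A00).
have A20 : 0 < A2.
  apply: (mulr_gt0 _ A00); apply: (mulr_gt0 CH0); apply: addr_gt0; last by rewrite mulr1.
  exact: (mulr_gt0 (ltr0n R 112) CG0).
exists (A0 + A1 + A2), tau; split=> //; first by rewrite !addr_gt0.
have le0 : A0 <= A0 + A1 + A2 by lra.
have le1 : A1 <= A0 + A1 + A2 by lra.
have le2 : A2 <= A0 + A1 + A2 by lra.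
move=> s s0 st; split.
- by move=> i; apply: (l3_le (hA s i s0 st)) => //; exact: ltW.
- move=> i j; apply: (l3_le (gradient_l3 sol taub bT CG0 A00 hCG hA hu1 i j s0 st)).
    by apply: divr_ge0; [exact: ltW|exact: sqrtr_ge0].
  by rewrite ler_wpM2r// invr_ge0 sqrtr_ge0.
- move=> i j k.
  apply: (l3_le (hessian_l3 sol taub bT CG0 CH0 A00 ler01 hCG hCH hA hu1 hu2 i j k s0 st)).
    by apply: divr_ge0; exact: ltW.
  by rewrite ler_wpM2r// invr_ge0 ltW.
Qed.
End small_time.

Unset Implicit Arguments.

Theorem corollary1p1 (R : realType) (C c : R) (C_gt0 : 0 < C)
    (U0 : 'rV[R]_3 -> 'rV[R]_3) (U0_J3 : J3 U0)
    (U : R -> 'rV[R]_3 -> 'rV[R]_3) (p : R -> 'rV[R]_3 -> R)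
    (Up_sol : described_solution C c U0 U p) :
  (forall q : R, 3 < q ->
     let mu := (q - 3) / (2 * q) in
     [/\ ereal_littleo (fun t => vLp q%:E (U t)) (fun t => t `^ (- mu)),
         ereal_littleo (fun t => Lp q%:E (grad_norm (U t)))
           (fun t => t `^ (- (1 / 2) - mu))
       & ereal_littleo (fun t => Lp q%:E (hess_norm (U t)))
           (fun t => t `^ (- 1 - mu))])
  /\ ((t `^ (3 / 2))%:E * Lp +oo (hess_norm (U t)))%E @[t --> 0^'+] --> 0%E.
Proof.
have [A [tau [A0 tau0 tauT hA]]] := sol_derivatives_l3 C_gt0 U0_J3 Up_sol.
have inT s : s <= tau -> (s%:E < lifespan C U0)%E.
  by move=> st; apply: le_lt_trans tauT; rewrite lee_fin.
split.
  move=> q q3 mu; split.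
  (* In the three cases the exponent [be] of the L^3 bound is 0, -1/2 and -1, and the sup norms have
     the exponent be - 1/2. *)
  - rewrite -(sub0r mu); apply: (Lp_littleo_sum (g := fun i t => uC U t i) q3 A0).
      exists tau => // t t0 tt; split.
      - exact: (continuous_enorm_sol Up_sol t0 (inT t tt)).
      - exact: enorm_sol_le.
      - by move=> i; rewrite powRr0 mulr1; have [+ _ _] := hA t t0 tt; apply.
    move=> e e0; have [t1 [t10 _] [h1 _]] := sol_small C_gt0 U0_J3 Up_sol e0.
    exists t1 => // t t0 tt i x; rewrite sub0r -powR_inv_sqrt//; exact: h1.
  - apply: (Lp_littleo_sum (g := fun (r : 'I_3 * 'I_3) t => uC1 U t r.2 r.1) q3 A0).
      exists tau => // t t0 tt; split.
      - exact: (continuous_grad_norm Up_sol t0 (inT t tt)).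
      - exact: grad_norm_le.
      - by move=> r; rewrite -powR_inv_sqrt//; have [_ + _] := hA t t0 tt; apply.
    move=> e e0; have [t1 [t10 _] [_ h1]] := sol_small C_gt0 U0_J3 Up_sol e0.
    exists t1 => // t t0 tt i x.
    have -> : - (1 / 2) - 1 / 2 = - 1 :> R by field.
    rewrite -powR_invr//; exact: h1.
  - apply: (Lp_littleo_sum (g := fun (r : 'I_3 * 'I_3 * 'I_3) t => uC2 U t r.2 r.1.2 r.1.1) q3 A0).
      exists tau => // t t0 tt; split.
      - exact: (continuous_hess_norm Up_sol t0 (inT t tt)).
      - exact: hess_norm_le.
      - by move=> r; rewrite -powR_invr//; have [_ _ +] := hA t t0 tt; apply.
    move=> e e0; have [t1 [t10 _] h1] := sol_hessian_small C_gt0 U0_J3 Up_sol e0.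
    exists t1 => // t t0 tt i x; rewrite -powR_inv32//; exact: h1.
apply/ereal_cvg0P => [t t0|e e0].
  by rewrite mule_ge0 ?Lnorm_ge0// lee_fin powR_ge0.
(* The Hessian has 27 components, and its norm is at most the sum of their absolute values. *)
have e27 : 0 < e / 27 by rewrite divr_gt0.
have [t1 [t10 t1T] h1] := sol_hessian_small C_gt0 U0_J3 Up_sol e27.
exists t1 => // t t0 tt.
have q0 : 0 < t `^ (3 / 2) by rewrite powR_gt0.
rewrite muleC -lee_pdivlMr// -EFinM; apply: Lp_infty_le => x.
apply: (le_trans (hess_norm_le _ _ _)).
apply: (@le_trans _ _ (\sum_(r : 'I_3 * 'I_3 * 'I_3) (e / 27 / (t * Num.sqrt t)))).
  by apply: ler_sum => r _; exact: h1.
rewrite sumr_const !card_prod card_ord -[leLHS]mulr_natl powR_inv32//.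
have -> : - 1 - 1 / 2 = - (3 / 2) :> R by field.
rewrite powRN mulrA le_eqVlt; apply/orP; left; apply/eqP.
by congr (_ * _); field.
Qed.
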